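(* Let $(U,g)$ be a connected, analytic Riemannian manifold. Let $h$ be an analytic, symmetric $(0,2)$-tensor on $U$. Let $\Omega\subset U$ be a connected open subset satisfying $\pi_1(U,\Omega)=0$. Then every $h$-Killing vector field $X$ in $\Omega$ can be extended to a unique $h$-Killing vector field on the whole manifold $U$.
   Context: For a symmetric $(0,2)$-tensor $h$ on a Riemannian manifold $(U,g)$, a vector field $X$ is called $h$-Killing if $L_Xg=h$, where $L_X$ is the Lie derivative. ''Analytic'' means real analytic: $(U,g)$ can be covered by (analytically compatible) charts in which $g$ is analytic, and $h$ is analytic in those charts. The condition $\pi_1(U,\Omega)=0$ means that $\Omega$ is connected and the inclusion $\Omega\hookrightarrow U$ induces a surjection $\pi_1(\Omega)\to\pi_1(U)$. *)

(* Defs.v *)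
From HB Require Import structures.
From mathcomp Require Import all_boot all_order all_algebra.
From mathcomp Require Import all_classical all_reals all_analysis.

Set Implicit Arguments.
Unset Strict Implicit.
Unset Printing Implicit Defensive.

Import Order.TTheory GRing.Theory Num.Theory.
Import numFieldNormedType.Exports.

Local Open Scope classical_set_scope.
Local Open Scope ring_scope.

Section functions_on_Rn.
Context {R : realType} {n : nat}.
Implicit Types (f : 'rV[R]_n -> R) (V : set 'rV[R]_n) (a x : 'rV[R]_n).

Definition partial (i : 'I_n) f : 'rV[R]_n -> R :=
  fun x => 'D_(delta_mx 0 i) f x.

Fixpoint iter_partial (s : seq 'I_n) f : 'rV[R]_n -> R :=
  if s is i :: s' then partial i (iter_partial s' f) else f.

(* C^infinity; meant for V open. *)
Definition smooth_on V f := forall (s : seq 'I_n) x, V x ->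
  {for x, continuous (iter_partial s f)} /\
  (forall i, derivable (iter_partial s f) x (delta_mx 0 i)).

Definition powser_term (c : {ffun 'I_n -> nat} -> R) (y : 'rV[R]_n)
    (alpha : {ffun 'I_n -> nat}) : R :=
  c alpha * \prod_(i < n) y 0 i ^+ alpha i.

(* The norm on 'rV_n is the sup norm, so the neighbourhood below is a
   polydisc.  The series over multi-indices converges absolutely, so its sum
   may be computed along the boxes {0, ..., N-1}^n. *)
Definition analytic_at f a :=
  exists (c : {ffun 'I_n -> nat} -> R) (r : R), 0 < r /\
    forall x, `|x - a| < r ->
      summable setT (fun alpha => (powser_term c (x - a) alpha)%:E) /\
      (fun N : nat => \sum_(alpha : {ffun 'I_n -> 'I_N})
         powser_term c (x - a) [ffun i => alpha i : nat]) @ \oo --> f x.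

Definition analytic_on V f := forall a, V a -> analytic_at f a.

End functions_on_Rn.

Section manifolds.
Context {R : realType} {n : nat} {U : topologicalType}.

(* [chart_inv] is the inverse of [chart_map] on [chart_map @` chart_dom];
   the values of [chart_map] outside [chart_dom] and of [chart_inv] outside
   [chart_map @` chart_dom] are junk. *)
Record chart := Chart {
  chart_dom : set U;
  chart_map : U -> 'rV[R]_n;
  chart_inv : 'rV[R]_n -> U;
  chart_dom_open : open chart_dom;
  chart_map_open : open (chart_map @` chart_dom);
  chart_mapK : forall p, chart_dom p -> chart_inv (chart_map p) = p;
  chart_map_continuous : {within chart_dom, continuous chart_map};
  chart_inv_continuous : {within chart_map @` chart_dom, continuous chart_inv} }.

Definition transition (phi psi : chart) : 'rV[R]_n -> 'rV[R]_n :=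
  chart_map psi \o chart_inv phi.

Record analytic_atlas := AnalyticAtlas {
  atlas_index : Type;
  chart_of :> atlas_index -> chart;
  atlas_cover : forall p : U, exists i, chart_dom (chart_of i) p;
  atlas_compatible : forall (i j : atlas_index) (k : 'I_n),
    analytic_on (chart_map (chart_of i) @`
        (chart_dom (chart_of i) `&` chart_dom (chart_of j)))
      (fun x => transition (chart_of i) (chart_of j) x 0 k) }.

Variable A : analytic_atlas.

(* Jacobian at p of the change from chart i to chart j.  It acts on row
   vectors from the right: a tangent vector with components v in chart i has
   components v *m jac i j p in chart j. *)
Definition jac (i j : atlas_index A) (p : U) : 'M[R]_n :=
  'J (transition (A i) (A j)) (chart_map (A i) p).

(* A (0,2)-tensor field is given by its matrix [h i p] of components in each
   chart i at each point p of the domain of i (the values at other points are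
   junk); likewise for the components [X i p] of vector fields. *)
Definition tensor02 (h : atlas_index A -> U -> 'M[R]_n) :=
  forall i j p, chart_dom (A i) p -> chart_dom (A j) p ->
    h i p = jac i j p *m h j p *m (jac i j p)^T.

Definition symmetric_tensor (h : atlas_index A -> U -> 'M[R]_n) :=
  forall i p, chart_dom (A i) p -> (h i p)^T = h i p.

Definition analytic_tensor (h : atlas_index A -> U -> 'M[R]_n) :=
  forall i a b, analytic_on (chart_map (A i) @` chart_dom (A i))
    (fun x => h i (chart_inv (A i) x) a b).

Definition analytic_symmetric_tensor02 (h : atlas_index A -> U -> 'M[R]_n) :=
  [/\ tensor02 h, symmetric_tensor h & analytic_tensor h].

Definition analytic_riemannian_metric (g : atlas_index A -> U -> 'M[R]_n) :=
  analytic_symmetric_tensor02 g /\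
  (forall i p, chart_dom (A i) p -> forall v : 'rV[R]_n, v != 0 ->
     0 < (v *m g i p *m v^T) 0 0).

Definition vector_field (Omega : set U) (X : atlas_index A -> U -> 'rV[R]_n) :=
  (forall i j p, Omega p -> chart_dom (A i) p -> chart_dom (A j) p ->
     X j p = X i p *m jac i j p) /\
  (forall i k, smooth_on (chart_map (A i) @` (chart_dom (A i) `&` Omega))
     (fun x => X i (chart_inv (A i) x) 0 k)).

Definition eq_field_on (Omega : set U) (X Y : atlas_index A -> U -> 'rV[R]_n) :=
  forall i p, Omega p -> chart_dom (A i) p -> X i p = Y i p.

(* (L_X g)(d_a, d_b) = X (g(d_a, d_b)) - g([X, d_a], d_b) - g(d_a, [X, d_b])
   for the coordinate fields d_a, d_b of chart i, where
   [X, d_a] = - sum_k (d_a X^k) d_k. *)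
Definition lie_derivative (X : atlas_index A -> U -> 'rV[R]_n)
    (g : atlas_index A -> U -> 'M[R]_n) (i : atlas_index A) (p : U) : 'M[R]_n :=
  let x := chart_map (A i) p in
  let gc a b := fun y => g i (chart_inv (A i) y) a b in
  let Xc k := fun y => X i (chart_inv (A i) y) 0 k in
  \matrix_(a, b) \sum_(k < n)
    (Xc k x * partial k (gc a b) x
     + partial a (Xc k) x * gc k b x
     + partial b (Xc k) x * gc a k x).

Definition killing_field (g h : atlas_index A -> U -> 'M[R]_n) (Omega : set U)
    (X : atlas_index A -> U -> 'rV[R]_n) :=
  vector_field Omega X /\
  (forall i p, Omega p -> chart_dom (A i) p -> lie_derivative X g i p = h i p).

End manifolds.
Arguments chart : clear implicits.
Arguments analytic_atlas : clear implicits.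

Section fundamental_group.
Context {R : realType} {U : topologicalType}.

Definition loop_in (Omega : set U) (p : U) (gamma : R -> U) :=
  [/\ {within `[0, 1], continuous gamma}, gamma 0 = p, gamma 1 = p
    & forall t, t \in `[0, 1] -> Omega (gamma t)].

Definition loop_homotopic (p : U) (gamma delta : R -> U) :=
  exists H : R * R -> U,
    [/\ {within `[0, 1] `*` `[0, 1], continuous H},
        forall t, t \in `[0, 1] -> H (0, t) = gamma t,
        forall t, t \in `[0, 1] -> H (1, t) = delta t
      & forall s, s \in `[0, 1] -> H (s, 0) = p /\ H (s, 1) = p].

End fundamental_group.

(* pi_1(U, Omega) = 0: Omega is connected, and every class of loops of U based
   at a point of Omega has a representative in Omega, i.e. the inclusion is
   onto on fundamental groups.  [connected] admits the empty set, which has no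
   base point and is excluded explicitly. *)
Definition pi1_rel_trivial (R : realType) (U : topologicalType)
    (Omega : set U) :=
  [/\ Omega !=set0, connected Omega
    & forall p, Omega p -> forall gamma : R -> U, loop_in setT p gamma ->
        exists2 delta : R -> U, loop_in Omega p delta
          & loop_homotopic p gamma delta].

(* Main.v *)
From HB Require Import structures.
Require Import Defs.
From mathcomp Require Import all_boot all_order all_algebra.
From mathcomp Require Import all_classical all_reals all_analysis.
From mathcomp Require Import ring lra.
Set Implicit Arguments.
Unset Strict Implicit.
Unset Printing Implicit Defensive.
Import Order.TTheory GRing.Theory Num.Theory.
Import numFieldNormedType.Exports.
Local Open Scope classical_set_scope.
Local Open Scope ring_scope.

(** An h-Killing field is determined by its 1-jet at one point, and near every
    point there is a neighbourhood, of a size that does not depend on the field,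
    to which every h-Killing germ of that neighbourhood extends.  So h-Killing
    germs can be continued along paths, homotopic paths give the same result,
    and the hypothesis on fundamental groups says that the monodromy of the
    given field is that of loops inside Omega, that is, trivial.

    _Local extension._  In a chart, differentiating the Killing equation once
    and solving for the second derivatives, as one solves for the Christoffel
    symbols, turns it into a total differential system d_b u = M_b u for the
    vector u made of 1, the components of X and their first derivatives; the
    coefficients M_b are analytic.  Conversely, along solutions of that system
    the defect of the Killing equation has zero gradient, so it vanishes as soon
    as it vanishes at one point ([killing_solves], [solves_killing]).  If the
    derivatives of M satisfy Cauchy estimates with constant T on a cube, then
    every solution satisfies |d^s u (x)| <= |u(x)| |s|! T^|s| with the same T
    ([solution_estimate]).  The Taylor series of u at any q of the cube
    therefore converges in a cube of fixed size around q; its sum v has the jet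
    of u at q, hence d_b v - M_b v has zero jet at q and vanishes identically
    ([pfaff_extension]).  The system need not be integrable; analyticity is what
    carries over the system from the jet at q to a whole cube.

    _Analyticity._  It is used throughout in the form of Cauchy estimates on all
    iterated partial derivatives ([cauchy_on], [cauchy_at]), a class stable
    under sums, products, inverses and derivatives.  The bridge from power
    series, and the construction of v, both rest on [limit_cauchy_on]: if smooth
    functions satisfy uniform Cauchy estimates and converge pointwise, then the
    limit is smooth and all derivatives converge.  It is applied to polynomials,
    so no series is ever differentiated term by term.

    _Globalization._  [killing_of_chart] transports a solution found in one
    chart to all charts, by naturality of the Lie derivative ([lie_pullback]).
    The part on germs is independent of geometry: for any notion of solution for
    which each point has a neighbourhood with unique extension of germs, a
    solution on Omega extends when the monodromy is carried by Omega
    ([homotopy_invariance], [global_continuation]). *)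

(** * Lines, cubes and differentiability *)

Section lines.
Context {R : realType} {V : normedModType R}.
Implicit Types (f : V -> R) (x v : V).

Lemma is_derive_line f x v (t : R) : derivable f (t *: v + x) v ->
  is_derive t 1 (fun s => f (s *: v + x)) ('D_v f (t *: v + x)).
Proof.
have E : (fun h : R => h^-1 *: (((fun s => f (s *: v + x)) \o shift t) (h *: 1) - f (t *: v + x)))
   = (fun h => h^-1 *: ((f \o shift (t *: v + x)) (h *: v) - f (t *: v + x))).
  by apply/funext => h /=; rewrite [_%:A]mulr1 scalerDl addrA.
move=> df; split; first by rewrite /derivable E.
by rewrite /derive E.
Qed.

Lemma MVT_line f x v (h : R) :
  (forall t : R, `|t| <= `|h| -> derivable f (t *: v + x) v) ->
  exists2 s : R, `|s| <= `|h| & f (h *: v + x) - f x = h * 'D_v f (s *: v + x).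
Proof.
move=> df.
pose g := fun s => f (s *: v + x).
have Dg (t : R) : `|t| <= `|h| -> is_derive t 1 g ('D_v f (t *: v + x)).
  by move=> th; apply: is_derive_line; exact: df.
have Cg (a b : R) : (forall t : R, t \in `[a, b] -> `|t| <= `|h|) ->
    {within `[a, b], continuous g}.
  by move=> ab; apply: derivable_within_continuous => t /ab /Dg [].
have g0 : g 0 = f x by rewrite /g scale0r add0r.
have [h0|h0] := leP 0 h.
  have in_h : forall s : R, s \in `[0, h] -> `|s| <= `|h|.
    by move=> s; rewrite in_itv /= => /andP[t0 th]; rewrite !ger0_norm.
  have [c ch E] := MVT_segment h0
    (fun t tI => Dg t (in_h t (subset_itv_oo_cc tI))) (Cg 0 h in_h).
  by exists c; [exact: in_h|rewrite -g0 E subr0 mulrC].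
have in_h : forall s : R, s \in `[h, 0] -> `|s| <= `|h|.
  move=> s; rewrite in_itv /= => /andP[th t0].
  by rewrite !ler0_norm ?lerN2 // ltW.
have [c ch E] := MVT_segment (ltW h0)
  (fun t tI => Dg t (in_h t (subset_itv_oo_cc tI))) (Cg h 0 in_h).
exists c; first exact: in_h.
by rewrite -g0 -[LHS]opprB E sub0r mulrN opprK mulrC.
Qed.

End lines.

Section cube.
Context {R : realType} {n : nat}.
Implicit Types (a x y v : 'rV[R]_n) (V : set 'rV[R]_n).

Definition cube a (r : R) : set 'rV[R]_n := [set x | `|x - a| < r].

Lemma cubexx a r : 0 < r -> cube a r a.
Proof. by rewrite /cube /= subrr normr0. Qed.

Lemma cubeE a r : cube a r = ball a r.
Proof. by rewrite -ball_normE; apply/funext => x /=; rewrite /cube /= distrC. Qed.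

Lemma cube_open a r : open (cube a r).
Proof. rewrite cubeE; exact: ball_open. Qed.

Lemma cube_sub a b r s : `|a - b| + r <= s -> cube a r `<=` cube b s.
Proof.
move=> h x; rewrite /cube /= => xa; apply: lt_le_trans h.
rewrite -(subrK a x) -addrA (le_lt_trans (ler_normD _ _)) //.
by rewrite [ltLHS]addrC ltrD2l.
Qed.

Lemma cube_le a r s : r <= s -> cube a r `<=` cube a s.
Proof. by move=> rs; apply: cube_sub; rewrite subrr normr0 add0r. Qed.

Lemma nbhs_cube a r : 0 < r -> nbhs a (cube a r).
Proof. by move=> r0; apply: open_nbhs_nbhs; split; [exact: cube_open|exact: cubexx]. Qed.

Lemma open_cube V a : open V -> V a -> exists2 r, 0 < r & cube a r `<=` V.
Proof.
move=> oV Va; have /nbhs_ballP[r r0 rV] : nbhs a V by exact: open_nbhs_nbhs.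
by exists r => //; rewrite cubeE.
Qed.

Lemma norm_coord v i : `|v 0 i| <= `|v|.
Proof.
rewrite [leRHS]/Num.Def.normr/= mx_normrE.
by apply: (@le_bigmax _ _ _ _ (fun ij : 'I_1 * 'I_n => `|v ij.1 ij.2|) (0, i)).
Qed.

Lemma norm_rV_le v (r : R) : 0 <= r -> (forall i, `|v 0 i| <= r) -> `|v| <= r.
Proof.
move=> r0 h; rewrite [leLHS]/Num.Def.normr/= mx_normrE.
by apply: bigmax_le => // -[i j] _; rewrite (ord1 i); exact: h.
Qed.

Lemma norm_delta i : `|delta_mx 0 i : 'rV[R]_n| = 1.
Proof.
apply/eqP; rewrite eq_le; apply/andP; split.
  by apply: norm_rV_le => // j; rewrite mxE eqxx /=; case: eqP => _; rewrite ?normr1 ?normr0.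
by have := norm_coord (delta_mx 0 i) i; rewrite mxE !eqxx normr1.
Qed.

End cube.

Lemma cvg_sumR {R : realType} {T : Type} {F : set_system T} {FF : Filter F}
    (I : Type) (r : seq I) (f : I -> T -> R) (l : I -> R) :
  (forall i, f i @ F --> l i) ->
  (fun x => \sum_(i <- r) f i x) @ F --> \sum_(i <- r) l i.
Proof.
move=> fl; elim: r => [|i r IH].
  by rewrite big_nil; under eq_fun do rewrite big_nil; exact: cvg_cst.
by rewrite big_cons; under eq_fun do rewrite big_cons; exact: cvgD.
Qed.

Section differentiability.
Context {R : realType} {n : nat}.
Implicit Types (f : 'rV[R]_n -> R) (x v : 'rV[R]_n) (V : set 'rV[R]_n).

Local Notation e_ i := (delta_mx 0 i : 'rV[R]_n).

Definition trunc_row (k : nat) v : 'rV[R]_n :=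
  \row_j (if (j < k)%N then v 0 j else 0).

Lemma trunc_row0 v : trunc_row 0 v = 0.
Proof. by apply/rowP => j; rewrite !mxE. Qed.

Lemma trunc_rown v : trunc_row n v = v.
Proof. by apply/rowP => j; rewrite !mxE ltn_ord. Qed.

Lemma trunc_rowS (k : 'I_n) v :
  trunc_row k.+1 v = v 0 k *: e_ k + trunc_row k v.
Proof.
apply/rowP => j; rewrite !mxE eqxx /= ltnS leq_eqVlt -val_eqE /=.
by case: eqVneq => [/val_inj ->|_] /=; rewrite ?ltnn ?mulr1 ?addr0 // mulr0 add0r.
Qed.

Lemma increment_telescope f x v :
  f (v + x) - f x =
  \sum_(k < n) (f (trunc_row k.+1 v + x) - f (trunc_row k v + x)).
Proof.
rewrite -[in LHS](trunc_rown v) -[in X in _ - X](add0r x) -(trunc_row0 v).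
rewrite -(big_mkord xpredT (fun k => f (trunc_row k.+1 v + x) - f (trunc_row k v + x))).
by rewrite telescope_sumr.
Qed.

Definition linear_form (c : 'I_n -> R) v : R := \sum_i v 0 i * c i.

Lemma linear_form_is_linear c : linear (linear_form c).
Proof.
move=> a u w; rewrite /linear_form scaler_sumr -big_split /=.
by apply: eq_bigr => i _; rewrite !mxE mulrDl -mulrA.
Qed.

HB.instance Definition _ c :=
  GRing.isLinear.Build _ _ _ _ (linear_form c) (linear_form_is_linear c).

Lemma linear_form_continuous c : continuous (linear_form c).
Proof.
move=> x; apply: (@cvg_sumR R _ (nbhs x) _ _ _ (fun i (v : 'rV[R]_n) => v 0 i * c i)) => i.
apply: cvgM; last exact: cvg_cst.
exact: coord_continuous.
Qed.

(** Moving from x to x + v one coordinate at a time and applying the mean value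
    theorem on each edge expresses the increment of f through partial
    derivatives taken near x. *)
Lemma C1_is_diff f V x : open V -> V x ->
  (forall i y, V y -> derivable f y (e_ i)) ->
  (forall i, {for x, continuous (partial i f)}) ->
  differentiable f x /\ forall v, 'd f x v = \sum_i v 0 i * partial i f x.
Proof.
move=> oV Vx df cf.
pose L := linear_form (fun i => partial i f x).
have key : f \o shift x = cst (f x) + L +o_ (0 : 'rV[R]_n) id.
  apply/eqaddoP => _/posnumP[e].
  have [r r0 rV] := open_cube oV Vx.
  have en0 : 0 < e%:num / (n%:R + 1) by rewrite divr_gt0 // ltr_wpDl.
  have : \forall y \near x, forall i, `|partial i f x - partial i f y| < e%:num / (n%:R + 1).
    by apply: (@filter_forall _ _ _ (nbhs x)) => i; move/cvgrPdist_lt: (cf i) => /(_ _ en0).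
  move=> /nbhs_ballP[s s0 hs].
  near=> v.
  have : cube 0 (Num.min r s) v by near: v; apply: nbhs_cube; rewrite lt_min r0.
  rewrite /cube /= subr0; rewrite lt_min => /andP[vr vs].
  rewrite !fctE /= -[leLHS]/(`|f (v + x) - (f x + L v)|).
  rewrite opprD addrA increment_telescope /L /linear_form -sumrB.
  apply: (le_trans (ler_norm_sum _ _ _)).
  apply: (@le_trans _ _ (\sum_(i < n) e%:num / (n%:R + 1) * `|v|)).
    apply: ler_sum => i _.
    have near_x (t : R) : `|t| <= `|v 0 i| ->
        `|t *: e_ i + trunc_row i v| <= `|v|.
      move=> tv; apply: norm_rV_le => // j; rewrite !mxE eqxx /=.
      case: (eqVneq j i) => [->|_]; rewrite ?ltnn ?mulr1 ?addr0.
        exact: le_trans tv (norm_coord _ _).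
      rewrite mulr0 add0r; case: ifP => _; first exact: norm_coord.
      by rewrite normr0.
    have [|t tv] := @MVT_line _ _ f (trunc_row i v + x) (e_ i) (v 0 i).
      move=> t tv; apply: df; apply: rV; rewrite /cube /=.
      by rewrite addrA addrK (le_lt_trans (near_x _ tv)).
    rewrite addrA -trunc_rowS => ->.
    rewrite -mulrBr normrM mulrC ler_pM // ?norm_coord // ltW //.
    rewrite distrC; apply: hs; rewrite -ball_normE /= distrC addrA addrK.
    exact: le_lt_trans (near_x _ tv) vs.
  rewrite sumr_const card_ord -mulrnAl ler_wpM2r // -mulr_natr -mulrA.
  rewrite ger_pMr // mulrC ler_pdivrMr ?mul1r ?lerDl // ltr_wpDl //.
have cL : continuous L by exact: linear_form_continuous.
have dL : 'd f x = L :> ('rV[R]_n -> R) by exact: diff_unique cL key.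
split; last by move=> v; rewrite dL.
by apply/diff_locallyP; rewrite dL.
Unshelve. all: by end_near.
Qed.

End differentiability.

(** * Smooth functions on open sets *)

Section smooth_calculus.
Context {R : realType} {n : nat}.
Implicit Types (f g : 'rV[R]_n -> R) (x v w : 'rV[R]_n) (V : set 'rV[R]_n).

Local Notation e_ i := (delta_mx 0 i : 'rV[R]_n).

Lemma near_eq_on V f g x : open V -> V x -> (forall y, V y -> f y = g y) ->
  {near x, f =1 g}.
Proof.
move=> oV Vx fg.
have H : \forall y \near x, V y by exact: open_nbhs_nbhs.
by apply: filterS H => y /fg.
Qed.

Lemma eq_partial V f g i x : open V -> V x -> (forall y, V y -> f y = g y) ->
  partial i f x = partial i g x.
Proof. by move=> oV Vx fg; apply: near_eq_derive; exact: near_eq_on Vx fg. Qed.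

Lemma eq_derivable V f g x v : open V -> V x -> (forall y, V y -> f y = g y) ->
  derivable f x v -> derivable g x v.
Proof. by move=> oV Vx fg; apply: near_eq_derivable; exact: near_eq_on Vx fg. Qed.

Lemma diffE_partial f x v : differentiable f x ->
  'd f x v = \sum_i v 0 i * partial i f x.
Proof.
move=> df; rewrite [in LHS](row_sum_delta v) linear_sum /=.
by apply: eq_bigr => i _; rewrite linearZ /= /partial deriveE.
Qed.

Lemma derive_partial f x v : differentiable f x ->
  'D_v f x = \sum_i v 0 i * partial i f x.
Proof. by move=> df; rewrite deriveE // diffE_partial. Qed.

Lemma partialD f g i x : derivable f x (e_ i) -> derivable g x (e_ i) ->
  partial i (fun y => f y + g y) x = partial i f x + partial i g x.
Proof. exact: deriveD. Qed.

Lemma partialM f g i x : derivable f x (e_ i) -> derivable g x (e_ i) ->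
  partial i (fun y => f y * g y) x = partial i f x * g x + f x * partial i g x.
Proof. move=> df dg; rewrite /partial deriveM; [|exact: df|exact: dg].
by rewrite addrC /GRing.scale /= [g x * _]mulrC. Qed.

Lemma partialN f i x : derivable f x (e_ i) ->
  partial i (fun y => - f y) x = - partial i f x.
Proof. exact: deriveN. Qed.

Lemma partial_cst (c : R) i : partial i (fun _ : 'rV[R]_n => c) = fun _ => 0.
Proof. by apply/funext => x; exact: derive_cst. Qed.

Lemma derivable_coord k x v : derivable (fun y : 'rV[R]_n => y 0 k) x v.
Proof. exact/diff_derivable/differentiable_coord. Qed.

Lemma partial_coord i k : partial i (fun y : 'rV[R]_n => y 0 k) = fun _ => (k == i)%:R.
Proof.
apply/funext => x; rewrite /partial.
have := @derive_mx R _ 1 n (id : 'rV[R]_n -> 'rV[R]_n) x (e_ i) (@derivable_id _ _ _ _).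
rewrite derive_id => /matrixP /(_ 0 k); rewrite !mxE eqxx /= => <-.
by [].
Qed.

Lemma partialV f i x : f x != 0 -> derivable f x (e_ i) ->
  partial i (fun y => (f y)^-1) x = - (partial i f x * ((f x)^-1 * (f x)^-1)).
Proof.
move=> fx df; rewrite /partial deriveV; [|exact: fx|exact: df]; rewrite /GRing.scale /=.
by rewrite expr2 mulNr invfM mulrC.
Qed.

Lemma eq_continuous_at V f g x : open V -> V x -> (forall y, V y -> f y = g y) ->
  {for x, continuous f} -> {for x, continuous g}.
Proof.
move=> oV Vx fg cf; have fgx := near_eq_on oV Vx fg.
rewrite /prop_for /continuous_at -(fg _ Vx).
by apply: cvg_trans cf; exact: near_eq_cvg fgx.
Qed.

Lemma eq_iter_partial V f g s : open V -> (forall y, V y -> f y = g y) ->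
  forall y, V y -> iter_partial s f y = iter_partial s g y.
Proof.
by move=> oV fg; elim: s => [|i s IH] //= y Vy; exact: eq_partial Vy IH.
Qed.

Lemma iter_partial_cat s t f :
  iter_partial (s ++ t) f = iter_partial s (iter_partial t f).
Proof. by elim: s => //= i s ->. Qed.

Lemma iter_partial_rcons s i f :
  iter_partial (rcons s i) f = iter_partial s (partial i f).
Proof. by rewrite -cats1 iter_partial_cat. Qed.

Definition C1_like V f := forall x, V x ->
  {for x, continuous f} /\ (forall i, derivable f x (e_ i)).

(** The words of partial derivatives are consumed from the inside here, so that
    closure properties are proved by induction on m: the partial derivative of
    a composite is an expression of the same kind, one order lower. *)
Fixpoint Ck (m : nat) V f : Prop :=
  C1_like V f /\ (if m is m'.+1 then forall i, Ck m' V (partial i f) else True).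

Lemma smooth_partial V f i : smooth_on V f -> smooth_on V (partial i f).
Proof. by move=> sf s x Vx; rewrite -iter_partial_rcons; exact: sf. Qed.

Lemma smooth_iter V f s : smooth_on V f -> smooth_on V (iter_partial s f).
Proof. by move=> sf; elim: s => [|i s IH] /=; [exact: sf|exact: smooth_partial]. Qed.

Lemma smooth_Ck V f : smooth_on V f <-> forall m, Ck m V f.
Proof.
split=> [+ m|].
  elim: m f => [|m IH] f sf; first by split => // x; exact: (sf [::]).
  split; first by move=> x; exact: (sf [::]).
  by move=> i; apply: IH; exact: smooth_partial.
move=> H s; elim/last_ind: s f H => [|s i IH] f H x Vx.
  by have [/(_ x Vx)] := H 0%N.
by rewrite iter_partial_rcons; apply: IH => // m; have [_] := H m.+1; exact.
Qed.

Lemma smooth_sub V W f : W `<=` V -> smooth_on V f -> smooth_on W f.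
Proof. by move=> WV sf s x /WV; exact: sf. Qed.

Lemma eq_smooth V f g : open V -> (forall y, V y -> f y = g y) ->
  smooth_on V f -> smooth_on V g.
Proof.
move=> oV fg sf s x Vx; have [c d] := sf s x Vx.
have E := eq_iter_partial s oV fg.
by split=> [|i]; [exact: eq_continuous_at E c|exact: eq_derivable E (d i)].
Qed.

Lemma smooth_local V f :
  (forall x, V x -> exists W, [/\ open W, W x & smooth_on W f]) -> smooth_on V f.
Proof. by move=> H s x /H[W [_ Wx]]; exact. Qed.

Lemma smooth_diff V f x : open V -> smooth_on V f -> V x -> differentiable f x.
Proof.
move=> oV sf Vx.
have d i y : V y -> derivable f y (e_ i) by move=> Vy; exact: (sf [::] y Vy).2.
by have [] := C1_is_diff oV Vx d (fun i => (sf [:: i] x Vx).1).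
Qed.

Lemma CkW m V f : Ck m.+1 V f -> Ck m V f.
Proof.
elim: m f => [|m IH] f [c d]; first by split.
by split => // i; apply: IH.
Qed.

Lemma eq_Ck m V f g : open V -> (forall y, V y -> f y = g y) ->
  Ck m V f -> Ck m V g.
Proof.
move=> oV; elim: m f g => [|m IH] f g fg [c d].
  split; last by []. move=> x Vx; have [cx dx] := c x Vx.
  by split=> [|i]; [exact: eq_continuous_at fg cx|exact: eq_derivable fg (dx i)].
split; last by move=> i; apply: IH (d i) => y Vy; exact: eq_partial fg.
move=> x Vx; have [cx dx] := c x Vx.
by split=> [|i]; [exact: eq_continuous_at fg cx|exact: eq_derivable fg (dx i)].
Qed.

Lemma C1_likeD V f g : C1_like V f -> C1_like V g -> C1_like V (fun y => f y + g y).
Proof.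
move=> Hf Hg x Vx; have [cf df] := Hf x Vx; have [cg dg] := Hg x Vx.
by split=> [|i]; [exact: (@continuousD _ _ _ f g)|exact: derivableD].
Qed.

Lemma C1_likeM V f g : C1_like V f -> C1_like V g -> C1_like V (fun y => f y * g y).
Proof.
move=> Hf Hg x Vx; have [cf df] := Hf x Vx; have [cg dg] := Hg x Vx.
by split=> [|i]; [exact: (@continuousM _ _ f g)|exact: derivableM].
Qed.

Lemma CkD m V f g : open V -> Ck m V f -> Ck m V g -> Ck m V (fun y => f y + g y).
Proof.
move=> oV; elim: m f g => [|m IH] f g [cf df] [cg dg].
  by split; [exact: C1_likeD|].
split; first exact: C1_likeD.
move=> i; apply: (eq_Ck oV _ (IH _ _ (df i) (dg i))) => y Vy.
by rewrite partialD; [|exact: (cf y Vy).2|exact: (cg y Vy).2].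
Qed.

Lemma CkM m V f g : open V -> Ck m V f -> Ck m V g -> Ck m V (fun y => f y * g y).
Proof.
move=> oV; elim: m f g => [|m IH] f g Hf Hg.
  by split; [apply: C1_likeM; [case: Hf|case: Hg]|].
have [cf df] := Hf; have [cg dg] := Hg.
split; first exact: C1_likeM.
move=> i; apply: (eq_Ck oV _ (CkD oV (IH _ _ (df i) (CkW Hg)) (IH _ _ (CkW Hf) (dg i)))).
by move=> y Vy; rewrite partialM; [|exact: (cf y Vy).2|exact: (cg y Vy).2].
Qed.

Lemma Ck_cst m V (c : R) : Ck m V (fun _ : 'rV[R]_n => c).
Proof.
have H (d : R) : C1_like V (fun _ : 'rV[R]_n => d).
  by move=> x Vx; split=> [|i]; [exact: cst_continuous|exact: derivable_cst].
by elim: m c => [|m IH] c; split => // i; rewrite partial_cst.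
Qed.

Lemma smooth_cst V (c : R) : smooth_on V (fun _ : 'rV[R]_n => c).
Proof. by apply/smooth_Ck => m; exact: Ck_cst. Qed.

Lemma smoothD V f g : open V -> smooth_on V f -> smooth_on V g ->
  smooth_on V (fun y => f y + g y).
Proof. by move=> oV /smooth_Ck sf /smooth_Ck sg; apply/smooth_Ck => m; exact: CkD. Qed.

Lemma smoothM V f g : open V -> smooth_on V f -> smooth_on V g ->
  smooth_on V (fun y => f y * g y).
Proof. by move=> oV /smooth_Ck sf /smooth_Ck sg; apply/smooth_Ck => m; exact: CkM. Qed.

Lemma smoothN V f : open V -> smooth_on V f -> smooth_on V (fun y => - f y).
Proof.
move=> oV sf; have := smoothM oV (@smooth_cst V (-1)) sf.
by apply: eq_smooth => // y _; rewrite mulN1r.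
Qed.

Lemma smoothB V f g : open V -> smooth_on V f -> smooth_on V g ->
  smooth_on V (fun y => f y - g y).
Proof. by move=> oV sf sg; apply: (smoothD oV sf); exact: smoothN. Qed.

Lemma smooth_sum V (I : Type) (r : seq I) (P : pred I) (F : I -> 'rV[R]_n -> R) :
  open V -> (forall i, P i -> smooth_on V (F i)) ->
  smooth_on V (fun y => \sum_(i <- r | P i) F i y).
Proof.
move=> oV sF; elim: r => [|i r IH].
  by under eq_fun do rewrite big_nil; exact: smooth_cst.
under eq_fun do rewrite big_cons.
by case: (boolP (P i)) => [/sF Pi|_]; [exact: smoothD|exact: IH].
Qed.

Lemma partial_sum (I : finType) (P : pred I) (F : I -> 'rV[R]_n -> R) i x :
  (forall j, P j -> derivable (F j) x (e_ i)) ->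
  partial i (fun y => \sum_(j | P j) F j y) x = \sum_(j | P j) partial i (F j) x.
Proof.
move=> dF.
suff [] : partial i (fun y => \sum_(j <- index_enum I | P j) F j y) x =
    \sum_(j <- index_enum I | P j) partial i (F j) x /\
    derivable (fun y => \sum_(j <- index_enum I | P j) F j y) x (e_ i) by [].
elim: (index_enum I) => [|j r [IH1 IH2]].
  under eq_fun do rewrite big_nil.
  by rewrite big_nil partial_cst; split; [|exact: derivable_cst].
under eq_fun do rewrite big_cons.
rewrite big_cons; case: (boolP (P j)) => [Pj|_]; last exact: (conj IH1 IH2).
rewrite partialD; [|exact: dF|exact: IH2]; rewrite IH1; split; first by [].
by apply: derivableD; [exact: dF|exact: IH2].
Qed.

Lemma derivable_sum_fin (I : finType) (P : pred I) (F : I -> 'rV[R]_n -> R) i x :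
  (forall j, P j -> derivable (F j) x (e_ i)) ->
  derivable (fun y => \sum_(j | P j) F j y) x (e_ i).
Proof.
move=> dF; elim: (index_enum I) => [|j r IH].
  by under eq_fun do rewrite big_nil; exact: derivable_cst.
under eq_fun do rewrite big_cons.
by case: (boolP (P j)) => [/dF Pj|_]; [exact: derivableD|exact: IH].
Qed.

Lemma smooth_coord V k : smooth_on V (fun y => y 0 k).
Proof.
have H : C1_like V (fun y => y 0 k).
  move=> x _; split=> [|i]; [exact: coord_continuous|exact: derivable_coord].
apply/smooth_Ck => -[|m]; split => // i.
by rewrite partial_coord; exact: Ck_cst.
Qed.

Lemma smoothV V f : open V -> smooth_on V f -> (forall x, V x -> f x != 0) ->
  smooth_on V (fun y => (f y)^-1).
Proof.
move=> oV sf f0; apply/smooth_Ck.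
have C1V : C1_like V (fun y => (f y)^-1).
  move=> x Vx; have [cx dx] := sf [::] x Vx; split=> [|i].
    by apply: continuousV => //; exact: f0.
  by apply: derivableV => //; exact: f0.
elim=> [|m IH]; first by split.
split => // i.
apply: (@eq_Ck m V (fun y => - 1 * partial i f y * ((f y)^-1 * (f y)^-1))) => //.
  move=> y Vy; rewrite partialV; [|exact: f0|exact: (sf [::] y Vy).2].
  by rewrite mulN1r mulNr.
apply: CkM => //; apply: CkM => //; first exact: Ck_cst.
by move/(@smooth_partial V f i)/smooth_Ck : sf.
Qed.

Lemma smooth_continuous V f x : smooth_on V f -> V x -> {for x, continuous f}.
Proof. by move=> sf Vx; exact: (sf [::] x Vx).1. Qed.

Lemma smooth_derivable V f x i : smooth_on V f -> V x -> derivable f x (e_ i).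
Proof. by move=> sf Vx; exact: (sf [::] x Vx).2. Qed.

Lemma derivable_shift f w x v : derivable f (x + w) v ->
  derivable (fun y => f (y + w)) x v.
Proof.
by rewrite /derivable /=; under eq_fun do rewrite addrA.
Qed.

Lemma derive_shift_fun f w x v :
  'D_v (fun y => f (y + w)) x = 'D_v f (x + w).
Proof. by rewrite /derive /=; under eq_fun do rewrite -addrA. Qed.

(** The mean value theorem in the direction i, applied to the increment of f in
    the direction j, and then in the direction j.  The left-hand side is
    symmetric in i and j. *)
Lemma second_difference V f x i j (h : R) : smooth_on V f ->
  cube x (2 * `|h| + `|h|) `<=` V -> h != 0 ->
  exists2 y, `|y - x| <= 2 * `|h| &
    f (h *: e_ i + (x + h *: e_ j)) - f (h *: e_ i + x)
    - (f (x + h *: e_ j) - f x) = h * (h * partial j (partial i f) y).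
Proof.
move=> sf cV h0.
have h0' : 0 < `|h| by rewrite normr_gt0.
have nn (s t : R) : `|s| <= `|h| -> `|t| <= `|h| ->
    `|s *: e_ i + t *: e_ j| <= 2 * `|h|.
  move=> sh th; rewrite (le_trans (ler_normD _ _)) // !normrZ !norm_delta !mulr1.
  by rewrite mulr2n mulrDl mul1r lerD.
have inV (s t : R) : `|s| <= `|h| -> `|t| <= `|h| ->
    V (s *: e_ i + x + t *: e_ j).
  move=> sh th; apply: cV; rewrite /cube /=.
  rewrite addrAC addrK; apply: le_lt_trans (nn _ _ sh th) _.
  by rewrite ltrDl.
have z0 : `|0 : R| <= `|h| by rewrite normr0.
pose G y := f (y + h *: e_ j) - f y.
have [|t th E] := @MVT_line _ _ G x (e_ i) h.
  move=> t th; apply: derivableB.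
    apply: (@derivable_shift f (h *: e_ j)); apply: (smooth_derivable sf); exact: inV.
  apply: (smooth_derivable sf); rewrite -[_ + x]addr0 -[X in _ + X](scale0r (e_ j)).
  exact: inV.
have [|s sh E2] := @MVT_line _ _ (partial i f) (t *: e_ i + x) (e_ j) h.
  move=> s sh; apply: (smooth_derivable (@smooth_partial V f i sf)).
  by rewrite addrC; exact: inV.
exists (s *: e_ j + (t *: e_ i + x)).
  by rewrite addrA addrK addrC; exact: nn.
rewrite (_ : partial j _ _ = 'D_(e_ j) (partial i f) (s *: e_ j + (t *: e_ i + x))) // -E2.
transitivity (G (h *: e_ i + x) - G x); first by rewrite /G addrA; ring.
rewrite E; congr (h * _); rewrite /G deriveB.
- by rewrite derive_shift_fun [h *: _ + _]addrC.
- apply: (@derivable_shift f (h *: e_ j)); apply: (smooth_derivable sf); exact: inV.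
- apply: (smooth_derivable sf); rewrite -[_ + x]addr0 -[X in _ + X](scale0r (e_ j)).
  exact: inV.
Qed.

(** The same second difference of step h is h^2 times either mixed derivative at
    points within 2h of x; let h tend to 0. *)
Lemma schwarz V f x i j : open V -> smooth_on V f -> V x ->
  partial i (partial j f) x = partial j (partial i f) x.
Proof.
move=> oV sf Vx; apply/eqP; rewrite -subr_eq0 -normr_le0; apply/ler_addgt0Pr => e e0.
rewrite add0r.
have e2 : 0 < e / 2 by rewrite divr_gt0.
have [r r0 rV] := open_cube oV Vx.
have c1 := smooth_continuous (@smooth_partial _ _ i (@smooth_partial _ _ j sf)) Vx.
have c2 := smooth_continuous (@smooth_partial _ _ j (@smooth_partial _ _ i sf)) Vx.
have [r1 r10 H1] := (nbhs_ballP _ _).1 ((cvgrPdist_lt _ _).1 c1 _ e2).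
have [r2 r20 H2] := (nbhs_ballP _ _).1 ((cvgrPdist_lt _ _).1 c2 _ e2).
(* The increments use points within 3 h of x. *)
pose h := Num.min r (Num.min r1 r2) / 4.
have h0 : 0 < h by rewrite divr_gt0 // !lt_min r0 r10.
have hr : 4 * h <= r by rewrite /h mulrC divfK // ge_min lexx.
have hr1 : 4 * h <= r1 by rewrite /h mulrC divfK // !ge_min lexx !orbT.
have hr2 : 4 * h <= r2 by rewrite /h mulrC divfK // !ge_min lexx !orbT.
have lt1 : 2 * h < r1 by lra.
have lt2 : 2 * h < r2 by lra.
have hn : `|h| = h by rewrite gtr0_norm.
have cV : cube x (2 * `|h| + `|h|) `<=` V.
  by apply: subset_trans rV; apply: cube_le; rewrite hn; lra.
have [y yx Ey] := second_difference i j sf cV (lt0r_neq0 h0).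
have [z zx Ez] := second_difference j i sf cV (lt0r_neq0 h0).
have Eyz : partial j (partial i f) y = partial i (partial j f) z.
  apply: (mulfI (lt0r_neq0 h0)); apply: (mulfI (lt0r_neq0 h0)).
  apply: (etrans (esym Ey)); apply: (etrans _ Ez).
  have -> : h *: e_ i + (x + h *: e_ j) = h *: e_ j + (x + h *: e_ i).
    by rewrite addrCA [RHS]addrCA; congr (_ + _); rewrite addrC.
  by rewrite [h *: e_ i + x]addrC [h *: e_ j + x]addrC; ring.
clear Ey Ez; have b1 := H1 z; have b2 := H2 y.
rewrite -ball_normE /= in b1; rewrite -ball_normE /= in b2.
have hz : `|x - z| < r1 by clear -zx hn lt1; rewrite distrC (le_lt_trans zx) // hn.
have hy : `|x - y| < r2 by clear -yx hn lt2; rewrite distrC (le_lt_trans yx) // hn.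
move: (b1 hz) (b2 hy); rewrite Eyz.
move: (partial i (partial j f) x) (partial i (partial j f) z) (partial j (partial i f) x).
clear; move=> A B C h1 h2; apply: (le_trans (ler_distD B A C)).
by rewrite (splitr e) ltW // ltrD // distrC.
Qed.

Lemma iter_partial_swap V f s1 a b s2 x : open V -> smooth_on V f -> V x ->
  iter_partial (s1 ++ a :: b :: s2) f x = iter_partial (s1 ++ b :: a :: s2) f x.
Proof.
move=> oV sf Vx; rewrite !iter_partial_cat.
apply: (eq_iter_partial _ oV _ Vx) => y Vy /=.
by apply: (schwarz _ _ oV _ Vy); exact: smooth_iter.
Qed.

End smooth_calculus.

(** * Composition *)

Section composition.
Context {R : realType} {n p : nat}.
Implicit Types (f : 'rV[R]_p -> R) (phi : 'rV[R]_n -> 'rV[R]_p) (x : 'rV[R]_n)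
  (V : set 'rV[R]_n) (W : set 'rV[R]_p).

Local Notation e_ i := (delta_mx 0 i).

Lemma differentiable_rV phi x :
  (forall k, differentiable (fun y => phi y 0 k) x) -> differentiable phi x.
Proof.
move=> H.
have -> : phi = \sum_(k < p) (fun y => phi y 0 k *: (e_ k : 'rV[R]_p)).
  by apply/funext => y; rewrite fct_sumE [LHS]row_sum_delta.
by apply: differentiable_sum => k; exact: differentiableZl.
Qed.

Lemma jacobianE phi x i k : differentiable phi x ->
  ('J phi x) i k = partial i (fun y => phi y 0 k) x.
Proof.
move=> dphi; rewrite /jacobian mxE -deriveE //.
by rewrite derive_mx ?mxE //; exact: diff_derivable.
Qed.

Lemma partial_comp phi f x i : differentiable phi x ->
  differentiable f (phi x) ->
  partial i (f \o phi) x =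
    \sum_k partial i (fun y => phi y 0 k) x * partial k f (phi x).
Proof.
move=> dphi df; rewrite /partial deriveE; last exact: differentiable_comp.
rewrite diff_comp //= diffE_partial //; apply: eq_bigr => k _; congr (_ * _).
by rewrite -deriveE // derive_mx ?mxE //; exact: diff_derivable.
Qed.

Definition smooth_map V phi := forall k, smooth_on V (fun y => phi y 0 k).

Lemma smooth_map_diff V phi x : open V -> smooth_map V phi -> V x ->
  differentiable phi x.
Proof.
by move=> oV sphi Vx; apply: differentiable_rV => k; exact: smooth_diff Vx.
Qed.

(** By the chain rule, a partial derivative of f o phi is a combination of
    functions (d_k f) o phi with smooth coefficients, and d_k f is again smooth. *)
Lemma smooth_comp V W phi f : open V -> open W -> smooth_map V phi ->
  (forall x, V x -> W (phi x)) -> smooth_on W f -> smooth_on V (f \o phi).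
Proof.
move=> oV oW sphi VW sf; apply/smooth_Ck => m.
have dphi x : V x -> differentiable phi x by exact: smooth_map_diff.
have C1 g : smooth_on W g -> C1_like V (g \o phi).
  move=> sg x Vx.
  have dg : differentiable (g \o phi) x.
    apply: differentiable_comp; first exact: dphi.
    by apply: smooth_diff sg _ => //; exact: VW.
  by split=> [|i]; [exact: differentiable_continuous|exact: diff_derivable].
elim: m f sf => [|m IH] f sf; split => //; try exact: C1.
move=> i.
apply: (@eq_Ck _ _ _ _ (fun x => \sum_k partial i (fun y => phi y 0 k) x * (partial k f \o phi) x)) => //.
  move=> x Vx; rewrite partial_comp //; first exact: dphi.
  by apply: smooth_diff sf _ => //; exact: VW.
have Hsum (r : seq 'I_p) : Ck m V (fun x => \sum_(k <- r)
    partial i (fun y => phi y 0 k) x * (partial k f \o phi) x).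
  elim: r => [|k r IHr].
    by under eq_fun do rewrite big_nil; exact: Ck_cst.
  under eq_fun do rewrite big_cons.
  apply: CkD => //; apply: CkM => //.
    by move/smooth_Ck: (@smooth_partial _ _ _ _ i (sphi k)).
  by apply: IH; exact: smooth_partial.
exact: Hsum.
Qed.

End composition.

(** * Cauchy estimates for partial derivatives *)

Section binomial_sum.
Context {R : realType}.

(** The binomial convolution of order m, in the recursive form in which the
    product rule produces it. *)
Fixpoint bsum (m : nat) (a : nat -> nat -> R) : R :=
  if m is m'.+1
  then bsum m' (fun k w => a k.+1 w) + bsum m' (fun k w => a k w.+1)
  else a 0%N 0%N.

Lemma bsumE m a : bsum m a = \sum_(k < m.+1) 'C(m, k)%:R * a k (m - k)%N.
Proof.
elim: m a => [|m IH] a /=; first by rewrite big_ord_recl big_ord0 bin0 mul1r addr0.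
rewrite !IH [RHS]big_ord_recl /= bin0 mul1r subn0.
rewrite [X in X + _ = _]big_ord_recr /= binn mul1r subnn.
rewrite [X in _ + X = _]big_ord_recl /= bin0 mul1r subn0.
rewrite [X in _ = _ + X]big_ord_recr /= binn mul1r subnn.
rewrite [LHS]addrC -addrA; congr (_ + _).
rewrite addrA; congr (_ + _).
rewrite -big_split /=; apply: eq_bigr => k _.
rewrite /bump /= add1n binS natrD mulrDl subSS.
rewrite -subSn; last by case: k.
by congr (_ * _ + _ * _); rewrite subSS.
Qed.

Lemma bin_fact_split m k : (k <= m)%N ->
  ('C(m, k)%:R * (k`!%:R * (m - k)`!%:R) = m`!%:R :> R).
Proof. by move=> km; rewrite -!natrM bin_fact. Qed.

Lemma bsum_fact m (A B L : R) :
  bsum m (fun k w => A * k`!%:R * L ^+ k * (B * w`!%:R * L ^+ w))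
  = A * B * m.+1`!%:R * L ^+ m.
Proof.
rewrite bsumE (eq_bigr (fun=> A * B * m`!%:R * L ^+ m)).
  by rewrite sumr_const card_ord factS natrM -[LHS]mulr_natl; ring.
move=> [k /= km] _; rewrite ltnS in km.
have -> : L ^+ m = L ^+ k * L ^+ (m - k) by rewrite -exprD subnKC.
by rewrite -(bin_fact_split km); ring.
Qed.

End binomial_sum.

Section leibniz.
Context {R : realType} {n : nat}.
Implicit Types (f g : 'rV[R]_n -> R) (x : 'rV[R]_n) (V : set 'rV[R]_n) (s t : seq 'I_n).

Lemma iter_partialD V f g s x : open V -> smooth_on V f -> smooth_on V g -> V x ->
  iter_partial s (fun y => f y + g y) x = iter_partial s f x + iter_partial s g x.
Proof.
move=> oV sf sg Vx; elim: s x Vx => [|i s IH] x Vx //=.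
rewrite (eq_partial i oV Vx IH).
by apply: partialD; [exact: (sf s x Vx).2|exact: (sg s x Vx).2].
Qed.

Lemma iter_partialN V f s x : open V -> smooth_on V f -> V x ->
  iter_partial s (fun y => - f y) x = - iter_partial s f x.
Proof.
move=> oV sf Vx; elim: s x Vx => [|i s IH] x Vx //=.
rewrite (eq_partial i oV Vx IH).
by apply: partialN; exact: (sf s x Vx).2.
Qed.

Lemma iter_partial_cst s (c : R) :
  iter_partial s (fun _ : 'rV[R]_n => c) = fun _ => if s is [::] then c else 0.
Proof.
elim: s => //= i s ->; rewrite partial_cst; apply/funext => y //.
Qed.

Lemma iter_partial_sum V s x (I : Type) (r : seq I) (F : I -> 'rV[R]_n -> R) :
  open V -> (forall i, smooth_on V (F i)) -> V x ->
  iter_partial s (fun y => \sum_(i <- r) F i y) x = \sum_(i <- r) iter_partial s (F i) x.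
Proof.
move=> oV sF Vx; elim: r => [|i r IH].
  under eq_fun do rewrite big_nil.
  by rewrite big_nil iter_partial_cst; case: s.
under eq_fun do rewrite big_cons.
have sr : smooth_on V (fun y => \sum_(j <- r) F j y).
  by apply: (smooth_sum _ oV) => j _; exact: sF.
by rewrite big_cons (iter_partialD s oV (sF i) sr Vx) IH.
Qed.

Lemma iter_partial_rconsM V f g s i x : open V -> smooth_on V f -> smooth_on V g ->
  V x -> iter_partial (rcons s i) (fun y => f y * g y) x =
  iter_partial s (fun y => partial i f y * g y) x +
  iter_partial s (fun y => f y * partial i g y) x.
Proof.
move=> oV sf sg Vx; rewrite iter_partial_rcons.
have E y : V y -> partial i (fun y => f y * g y) y = partial i f y * g y + f y * partial i g y.
  by move=> Vy; apply: partialM; [exact: (sf [::] y Vy).2|exact: (sg [::] y Vy).2].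
rewrite (eq_iter_partial s oV E Vx).
by apply: (iter_partialD s oV _ _ Vx); apply: smoothM => //; exact: smooth_partial.
Qed.

Lemma leibniz_le V x s f g (a : nat -> nat -> R) : open V -> V x ->
  smooth_on V f -> smooth_on V g ->
  (forall t w, (size t + size w)%N = size s ->
     `|iter_partial t f x| * `|iter_partial w g x| <= a (size t) (size w)) ->
  `|iter_partial s (fun y => f y * g y) x| <= bsum (size s) a.
Proof.
move=> oV Vx; elim/last_ind: s f g a => [|s i IH] f g a sf sg H.
  by rewrite /= normrM; exact: (H [::] [::]).
rewrite (iter_partial_rconsM _ _ oV sf sg Vx) size_rcons /=.
apply: le_trans (ler_normD _ _) _; apply: lerD.
  apply: (IH _ _ _ (@smooth_partial _ _ V f i sf) sg).
  move=> t w tw; rewrite -iter_partial_rcons -(size_rcons t i); apply: H.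
  by rewrite !size_rcons addSn tw.
apply: (IH _ _ _ sf (@smooth_partial _ _ V g i sg)).
move=> t w tw; rewrite -iter_partial_rcons -(size_rcons w i); apply: H.
by rewrite !size_rcons addnS tw.
Qed.

(** In the product rule for f g, the term f d^s g is set apart: for a known
    product f g this bounds d^s g by derivatives of g of lower order. *)
Lemma leibniz_lead_le V x s f g (a : nat -> nat -> R) : open V -> V x ->
  smooth_on V f -> smooth_on V g ->
  (forall t w, (0 < size t)%N -> (size t + size w)%N = size s ->
     `|iter_partial t f x| * `|iter_partial w g x| <= a (size t) (size w)) ->
  `|iter_partial s (fun y => f y * g y) x - f x * iter_partial s g x|
    <= bsum (size s) (fun k w => if k is 0%N then 0 else a k w).
Proof.
move=> oV Vx; elim/last_ind: s f g a => [|s i IH] f g a sf sg H.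
  by rewrite /= subrr normr0.
rewrite (iter_partial_rconsM _ _ oV sf sg Vx) size_rcons /=.
rewrite iter_partial_rcons -addrA.
apply: le_trans (ler_normD _ _) _; apply: lerD.
  apply: (leibniz_le oV Vx (@smooth_partial _ _ V f i sf) sg).
  move=> t w tw; rewrite -iter_partial_rcons -(size_rcons t i); apply: H.
    by rewrite size_rcons.
  by rewrite !size_rcons addSn tw.
apply: (IH f (partial i g) (fun k w => a k w.+1) sf); first exact: smooth_partial.
move=> t w t0 tw; rewrite -iter_partial_rcons -(size_rcons w i); apply: H => //.
by rewrite !size_rcons addnS tw.
Qed.

End leibniz.

Section cauchy_on.
Context {R : realType} {n : nat}.
Implicit Types (f g : 'rV[R]_n -> R) (a x : 'rV[R]_n) (V W : set 'rV[R]_n) (s t : seq 'I_n).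

(** On a neighbourhood of each point, estimates of this form characterize real
    analytic functions. *)
Definition cauchy_on V f (C L : R) := [/\ smooth_on V f, 0 <= C, 0 <= L &
  forall s x, V x -> `|iter_partial s f x| <= C * (size s)`!%:R * L ^+ size s].

Lemma cauchy_on_smooth V f C L : cauchy_on V f C L -> smooth_on V f. Proof. by case. Qed.

Lemma cauchy_on_sub V W f C L : W `<=` V -> cauchy_on V f C L -> cauchy_on W f C L.
Proof.
move=> WV [sf C0 L0 H]; split; [exact: smooth_sub sf|exact: C0|exact: L0|].
by move=> s x /WV; exact: H.
Qed.

Lemma eq_cauchy_on V f g C L : open V -> (forall y, V y -> f y = g y) ->
  cauchy_on V f C L -> cauchy_on V g C L.
Proof.
move=> oV fg [sf C0 L0 H]; split; [exact: eq_smooth sf|exact: C0|exact: L0|].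
by move=> s x Vx; rewrite -(eq_iter_partial s oV fg Vx); exact: H.
Qed.

Lemma cauchy_onW V f C L C' L' : C <= C' -> L <= L' -> cauchy_on V f C L -> cauchy_on V f C' L'.
Proof.
move=> CC LL [sf C0 L0 H].
have C'0 := le_trans C0 CC; have L'0 := le_trans L0 LL.
split; [exact: sf|exact: C'0|exact: L'0|].
move=> s x Vx; apply: le_trans (H s x Vx) _.
apply: ler_pM; [by rewrite mulr_ge0|exact: exprn_ge0|by rewrite ler_wpM2r|].
by apply: lerXn2r.
Qed.

Lemma cauchy_on_cst V (c : R) : cauchy_on V (fun _ => c) `|c| 0.
Proof.
split => //; first exact: smooth_cst.
move=> s x _; rewrite iter_partial_cst; case: s => [|i s] /=.
  by rewrite fact0 expr0 !mulr1.
by rewrite normr0 expr0n mulr0.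
Qed.

Lemma cauchy_onD V f g C D L : open V -> cauchy_on V f C L -> cauchy_on V g D L ->
  cauchy_on V (fun y => f y + g y) (C + D) L.
Proof.
move=> oV [sf C0 L0 Hf] [sg D0 _ Hg]; split; [exact: smoothD|exact: addr_ge0|exact: L0|].
move=> s x Vx; rewrite (iter_partialD s oV sf sg Vx).
apply: le_trans (ler_normD _ _) _.
by rewrite !mulrDl lerD; [|exact: Hf|exact: Hg].
Qed.

Lemma cauchy_onN V f C L : open V -> cauchy_on V f C L -> cauchy_on V (fun y => - f y) C L.
Proof.
move=> oV [sf C0 L0 Hf]; split; [exact: smoothN|exact: C0|exact: L0|].
by move=> s x Vx; rewrite (iter_partialN s oV sf Vx) normrN; exact: Hf.
Qed.

Lemma cauchy_on_sum V (I : Type) (r : seq I) (F : I -> 'rV[R]_n -> R) (C L : R) :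
  open V -> 0 <= C -> 0 <= L -> (forall i, cauchy_on V (F i) C L) ->
  cauchy_on V (fun y => \sum_(i <- r) F i y) ((size r)%:R * C) L.
Proof.
move=> oV C0 L0 H; elim: r => [|i r IH].
  under eq_fun do rewrite big_nil.
  by apply: cauchy_onW (cauchy_on_cst V 0); rewrite ?normr0 ?mul0r.
under eq_fun do rewrite big_cons.
by rewrite /= -natr1 addrC mulrDl mul1r; exact: cauchy_onD.
Qed.

Lemma succ_le_pow2 m : (m.+1 <= 2 ^ m)%N.
Proof. by elim: m => // m IH; rewrite expnS mul2n -addnn -addn1 leq_add // expn_gt0. Qed.

Lemma succ_fact_le m (L : R) : 0 <= L ->
  m.+1`!%:R * L ^+ m <= m`!%:R * (2 * L) ^+ m.
Proof.
move=> L0; rewrite factS natrM exprMn mulrA ler_wpM2r ?exprn_ge0 // mulrC.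
by rewrite ler_wpM2l // -natrX ler_nat; exact: succ_le_pow2.
Qed.

Lemma cauchy_onM V f g C D L : open V -> cauchy_on V f C L -> cauchy_on V g D L ->
  cauchy_on V (fun y => f y * g y) (C * D) (2 * L).
Proof.
move=> oV [sf C0 L0 Hf] [sg D0 _ Hg].
split; [exact: smoothM|exact: mulr_ge0|exact: mulr_ge0|].
move=> s x Vx.
apply: le_trans (leibniz_le (a := fun k w => C * k`!%:R * L ^+ k * (D * w`!%:R * L ^+ w)) oV Vx sf sg _) _.
  by move=> t w _; apply: ler_pM => //; [exact: Hf|exact: Hg].
rewrite bsum_fact -!mulrA; do 2 (apply: ler_wpM2l => //).
exact: succ_fact_le.
Qed.

Lemma cauchy_on_partial V f C L i : cauchy_on V f C L -> cauchy_on V (partial i f) (C * L) (2 * L).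
Proof.
move=> [sf C0 L0 Hf]; split; [exact: smooth_partial|exact: mulr_ge0|exact: mulr_ge0|].
move=> s x Vx; rewrite -iter_partial_rcons; apply: le_trans (Hf _ _ Vx) _.
rewrite size_rcons exprS -!mulrA ler_wpM2l // mulrCA ler_wpM2l //.
exact: succ_fact_le.
Qed.

Lemma geometric_tail_le m (K L : R) : 0 <= L -> 2 <= K ->
  \sum_(k < m) L ^+ k.+1 * (K * L) ^+ (m - k.+1) <= 2 / K * (K * L) ^+ m.
Proof.
move=> L0 K2; have K0 : 0 < K by apply: lt_le_trans K2.
have KL : 0 <= K * L by rewrite mulr_ge0 // ltW.
elim: m => [|m IH]; first by rewrite big_ord0 expr0 mulr1 divr_ge0 // ltW.
rewrite big_ord_recl /= expr1 subSS subn0.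
rewrite (eq_bigr (fun k : 'I_m => L * (L ^+ k.+1 * (K * L) ^+ (m - k.+1)))); last first.
  by move=> k _; rewrite /bump /= add1n subSS exprS mulrA.
rewrite -mulr_sumr -mulrDr exprS.
have -> : 2 / K * (K * L * (K * L) ^+ m) = L * (2 * (K * L) ^+ m).
  by field; rewrite gt_eqF.
rewrite ler_wpM2l // [leRHS]mulr_natl mulr2n lerD2l (le_trans IH) //.
by rewrite ler_piMl ?exprn_ge0 // ler_pdivrMr // mul1r.
Qed.

(** Apply d^s to f (1/f) = 1 and isolate f d^s (1/f): the other terms involve
    lower derivatives of 1/f, bounded by induction.  The growth rate is L times
    the factor K = 2 + 2 A / d, chosen so that the geometric sum that appears is
    at most d / A. *)
Lemma cauchy_onV V f A L (d : R) : open V -> cauchy_on V f A L -> 0 < d ->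
  (forall x, V x -> d <= `|f x|) ->
  cauchy_on V (fun y => (f y)^-1) d^-1 ((2 + 2 * A / d) * L).
Proof.
move=> oV [sf A0 L0 Hf] d0 fd.
have f0 x : V x -> f x != 0.
  by move=> Vx; rewrite -normr_gt0 (lt_le_trans d0) // fd.
pose K := 2 + 2 * A / d.
have K2 : 2 <= K by rewrite lerDl !mulr_ge0 // invr_ge0 ltW.
have K0 : 0 < K by apply: lt_le_trans K2.
have KL : 0 <= K * L by rewrite mulr_ge0 // ltW.
have sv := smoothV oV sf f0.
split; [exact: sv|by rewrite invr_ge0 ltW|exact: KL|].
rewrite -/K => s x Vx.
have [m] := ubnP (size s); elim: m s => // m IH s; rewrite ltnS => sm.
case: (posnP (size s)) => [/size0nil ->|s0].
  rewrite /= normfV fact0 expr0 !mulr1 lef_pV2 ?posrE //; first exact: fd.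
  by rewrite normr_gt0 f0.
have E0 : iter_partial s (fun y => f y * (f y)^-1) x = 0.
  rewrite (@eq_iter_partial _ _ V _ (fun=> 1) s oV _ _ Vx); last first.
    by move=> y Vy; rewrite mulfV // f0.
  by rewrite iter_partial_cst; case: (s) s0.
have := leibniz_lead_le (s := s) (a := fun k w => A * k`!%:R * L ^+ k * (d^-1 * w`!%:R * (K * L) ^+ w)) oV Vx sf sv.
rewrite E0 sub0r normrN normrM => /(_ _)/wrap[].
  move=> t w t0 tw; apply: ler_pM => //; first exact: Hf.
  by apply: IH; apply: leq_trans sm; rewrite -tw -addn1 addnC leq_add2r.
rewrite bsumE big_ord_recl mulr0 add0r => H.
have {}H : d * `|iter_partial s (fun y => (f y)^-1) x| <=
    A / d * (size s)`!%:R * \sum_(k < size s) L ^+ k.+1 * (K * L) ^+ (size s - k.+1).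
  apply: le_trans (le_trans _ H) _; first by rewrite ler_wpM2r // fd.
  rewrite mulr_sumr; apply: ler_sum => -[k km] _ /=.
  rewrite /bump /= add1n -(bin_fact_split km) le_eqVlt.
  by apply/orP; left; apply/eqP; ring.
rewrite -(ler_pM2l d0); apply: le_trans H _.
apply: (@le_trans _ _ (A / d * (size s)`!%:R * (2 / K * (K * L) ^+ size s))).
  by rewrite ler_wpM2l ?geometric_tail_le // !mulr_ge0 // invr_ge0 ltW.
have -> : A / d * (size s)`!%:R * (2 / K * (K * L) ^+ size s) =
  (2 * A / d / K) * ((size s)`!%:R * (K * L) ^+ size s) by ring.
have -> : d * (d^-1 * (size s)`!%:R * (K * L) ^+ size s) =
   (size s)`!%:R * (K * L) ^+ size s by field; rewrite gt_eqF.
by rewrite ler_piMl ?mulr_ge0 ?exprn_ge0 // ler_pdivrMr // mul1r /K lerDr.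
Qed.

Definition cauchy_at f a := exists (r C L : R), 0 < r /\ cauchy_on (cube a r) f C L.

Lemma cauchy_at_eq f g a r : 0 < r ->
  (forall y, cube a r y -> f y = g y) -> cauchy_at f a -> cauchy_at g a.
Proof.
move=> r0 fg [r' [C [L [r'0 H]]]]; exists (Num.min r r'), C, L.
split; first by rewrite lt_min r0.
apply: (@eq_cauchy_on _ f); first exact: cube_open.
  by move=> y yc; apply: fg; apply: cube_le yc; rewrite ge_min lexx.
by apply: cauchy_on_sub H; apply: cube_le; rewrite ge_min lexx orbT.
Qed.

Lemma cauchy_at2 f g a : cauchy_at f a -> cauchy_at g a -> exists (r C L : R),
  [/\ 0 < r, cauchy_on (cube a r) f C L & cauchy_on (cube a r) g C L].
Proof.
move=> [r [C [L [r0 Hf]]]] [r' [C' [L' [r'0 Hg]]]].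
exists (Num.min r r'), (Num.max C C'), (Num.max L L'); split.
- by rewrite lt_min r0.
- apply: (@cauchy_onW _ _ C L); rewrite ?le_max ?lexx //.
  by apply: cauchy_on_sub Hf; apply: cube_le; rewrite ge_min lexx.
- apply: (@cauchy_onW _ _ C' L'); rewrite ?le_max ?lexx ?orbT //.
  by apply: cauchy_on_sub Hg; apply: cube_le; rewrite ge_min lexx orbT.
Qed.

Lemma cauchy_at_cst a (c : R) : cauchy_at (fun _ => c) a.
Proof. by exists 1, `|c|, 0; split => //; exact: cauchy_on_cst. Qed.

Lemma cauchy_atD f g a : cauchy_at f a -> cauchy_at g a -> cauchy_at (fun y => f y + g y) a.
Proof.
move=> /cauchy_at2 H /H[r [C [L [r0 Hf Hg]]]].
by exists r, (C + C), L; split => //; apply: cauchy_onD => //; exact: cube_open.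
Qed.

Lemma cauchy_atM f g a : cauchy_at f a -> cauchy_at g a -> cauchy_at (fun y => f y * g y) a.
Proof.
move=> /cauchy_at2 H /H[r [C [L [r0 Hf Hg]]]].
by exists r, (C * C), (2 * L); split => //; apply: cauchy_onM => //; exact: cube_open.
Qed.

Lemma cauchy_atN f a : cauchy_at f a -> cauchy_at (fun y => - f y) a.
Proof.
by move=> [r [C [L [r0 H]]]]; exists r, C, L; split => //; apply: cauchy_onN => //; exact: cube_open.
Qed.

Lemma cauchy_at_sum (I : Type) (r : seq I) (P : pred I) (F : I -> 'rV[R]_n -> R) a :
  (forall i, cauchy_at (F i) a) -> cauchy_at (fun y => \sum_(i <- r | P i) F i y) a.
Proof.
move=> H; elim: r => [|i r IH].
  by under eq_fun do rewrite big_nil; exact: cauchy_at_cst.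
under eq_fun do rewrite big_cons.
by case: (P i); [exact: cauchy_atD|exact: IH].
Qed.

Lemma cauchy_at_prod (I : Type) (r : seq I) (F : I -> 'rV[R]_n -> R) a :
  (forall i, cauchy_at (F i) a) -> cauchy_at (fun y => \prod_(i <- r) F i y) a.
Proof.
move=> H; elim: r => [|i r IH].
  by under eq_fun do rewrite big_nil; exact: cauchy_at_cst.
by under eq_fun do rewrite big_cons; exact: cauchy_atM.
Qed.

Lemma cauchy_at_partial f a i : cauchy_at f a -> cauchy_at (partial i f) a.
Proof.
move=> [r [C [L [r0 H]]]]; exists r, (C * L), (2 * L); split => //.
exact: cauchy_on_partial.
Qed.

Lemma cauchy_atV f a : cauchy_at f a -> f a != 0 -> cauchy_at (fun y => (f y)^-1) a.
Proof.
move=> [r [C [L [r0 H]]]] fa.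
have d0 : 0 < `|f a| / 2 by rewrite divr_gt0 // normr_gt0.
have cf := smooth_continuous (cauchy_on_smooth H) (cubexx a r0).
have [r1 r10 H1] := (nbhs_ballP _ _).1 ((cvgrPdist_lt _ _).1 cf _ d0).
exists (Num.min r r1), (`|f a| / 2)^-1, ((2 + 2 * C / (`|f a| / 2)) * L).
split; first by rewrite lt_min r0.
apply: cauchy_onV => //; first exact: cube_open.
  by apply: cauchy_on_sub H; apply: cube_le; rewrite ge_min lexx.
move=> x xc; have /H1 /= : ball a r1 x.
  by rewrite -cubeE; apply: cube_le xc; rewrite ge_min lexx orbT.
have := ler_normD (f a - f x) (f x); rewrite subrK.
by move=> h1 /ltW h2; clear -h1 h2; lra.
Qed.

Lemma cauchy_at_det k (M : 'rV[R]_n -> 'M[R]_k) a :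
  (forall i j, cauchy_at (fun y => M y i j) a) -> cauchy_at (fun y => \det (M y)) a.
Proof.
move=> H; apply: cauchy_at_sum => s; apply: cauchy_atM; first exact: cauchy_at_cst.
by apply: cauchy_at_prod => i; exact: H.
Qed.

Lemma cauchy_at_invmx k (M : 'rV[R]_n -> 'M[R]_k) a r : 0 < r ->
  (forall i j, cauchy_at (fun y => M y i j) a) ->
  (forall y, cube a r y -> M y \in unitmx) ->
  forall i j, cauchy_at (fun y => invmx (M y) i j) a.
Proof.
move=> r0 H Mu i j.
apply: (@cauchy_at_eq (fun y => (\det (M y))^-1 * cofactor (M y) j i) _ _ _ r0).
  by move=> y /Mu My; rewrite /invmx My !mxE.
apply: cauchy_atM.
  by apply: cauchy_atV; [exact: cauchy_at_det|have := Mu _ (cubexx a r0); rewrite unitmxE unitfE].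
apply: cauchy_atM; first exact: cauchy_at_cst.
by apply: cauchy_at_det => i' j'; under eq_fun do rewrite !mxE; exact: H.
Qed.

End cauchy_on.

(** * Limits of smooth functions and vanishing theorems *)

(** The truth value of P is locally constant on A, hence constant. *)
Lemma connected_ind (T : topologicalType) (A : set T) (P : T -> Prop) (x0 : T) :
  connected A -> A x0 -> P x0 ->
  (forall x, A x -> exists2 V, open_nbhs x V &
     forall y z, V y -> V z -> A y -> A z -> P y -> P z) ->
  forall x, A x -> P x.
Proof.
move=> cA Ax0 Px0 loc.
pose good_nbhd V := open V /\ forall y z, V y -> V z -> A y -> A z -> P y -> P z.
pose U1 := \bigcup_(V in [set V | good_nbhd V /\ exists2 y, V y & A y /\ P y]) V.
pose U2 := \bigcup_(V in [set V | good_nbhd V /\ exists2 y, V y & A y /\ ~ P y]) V.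
have oU1 : open U1 by apply: bigcup_open => V [[]].
have oU2 : open U2 by apply: bigcup_open => V [[]].
have E : A `&` P = A.
  apply: cA; first by exists x0.
  - exists U1 => //; apply/seteqP; split=> x [Ax].
      move=> Px; split => //; have [V [oV Vx] H] := loc x Ax.
      by exists V => //; split => //; exists x.
    by move=> [V [[_ H] [y Vy [Ay Py]]] Vx]; split => //; exact: H Py.
  - exists (~` U2); first exact: open_closedC.
    apply/seteqP; split=> x [Ax].
      move=> Px; split => // -[V [[_ H] [y Vy [Ay nPy]]] Vx].
      by apply: nPy; exact: H Px.
    move=> nU; split => //; apply: contrapT => nPx; apply: nU.
    have [V [oV Vx] H] := loc x Ax.
    by exists V => //; split => //; exists x.
move=> x Ax; have [] : (A `&` P) x by rewrite E.
by [].
Qed.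

Section limits.
Context {R : realType}.

Lemma lim_dist_le (u : nat -> R) (l c B : R) :
  u @ \oo --> l -> (forall N, `|u N - c| <= B) -> `|l - c| <= B.
Proof.
move=> ul H; apply/ler_addgt0Pr => e e0.
have [N _ /(_ N (leqnn N)) /= h] := (cvgrPdist_le _ _).1 ul e e0.
apply: le_trans (ler_distD (u N) l c) _.
by rewrite addrC; exact: lerD.
Qed.

Context {n : nat}.
Implicit Types (f : 'rV[R]_n -> R) (x : 'rV[R]_n) (V : set 'rV[R]_n).
Local Notation e_ i := (delta_mx 0 i : 'rV[R]_n).

(** This bound for f(x + h e_i) - f(x) - h d_i f(x) is uniform over functions with
    the same bound for the second derivative, so it passes to pointwise limits. *)
Lemma second_order_le V f x i (h C : R) : smooth_on V f ->
  (forall t : R, `|t| <= `|h| -> V (t *: e_ i + x)) ->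
  (forall y, V y -> `|iter_partial [:: i; i] f y| <= C) ->
  `|f (h *: e_ i + x) - f x - h * partial i f x| <= C * `|h| * `|h|.
Proof.
move=> sf hV H.
have [|t th ->] := @MVT_line _ _ f x (e_ i) h.
  by move=> t th; exact: (sf [::] _ (hV t th)).2.
have [|s sh] := @MVT_line _ _ (partial i f) x (e_ i) t.
  by move=> s st; exact: (sf [:: i] _ (hV s (le_trans st th))).2.
rewrite -[X in X - _ = _]/(partial i f (t *: e_ i + x)) => E.
rewrite -mulrBr normrM mulrC ler_wpM2r //.
rewrite -[X in `|X - _|]/(partial i f (t *: e_ i + x)) E normrM mulrC.
apply: ler_pM => //; apply: H; apply: hV; exact: le_trans th.
Qed.

Lemma lipschitz_le V f x y (C : R) : smooth_on V f -> open V ->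
  (forall t : R, `|t| <= 1 -> V (t *: (y - x) + x)) ->
  (forall i z, V z -> `|partial i f z| <= C) ->
  `|f y - f x| <= n%:R * C * `|y - x|.
Proof.
move=> sf oV hV H.
have [|t t1] := @MVT_line _ _ f x (y - x) 1.
  move=> t t1; apply: diff_derivable; apply: (smooth_diff oV sf).
  by apply: hV; rewrite normr1 in t1.
rewrite scale1r subrK mul1r => ->.
have Vt : V (t *: (y - x) + x) by apply: hV; rewrite normr1 in t1.
rewrite derive_partial; last exact: (smooth_diff oV sf Vt).
apply: le_trans (ler_norm_sum _ _ _) _.
apply: (@le_trans _ _ (\sum_(i < n) C * `|y - x|)).
  apply: ler_sum => i _; rewrite normrM mulrC; apply: ler_pM => //.
    exact: H.
  exact: norm_coord.
by rewrite sumr_const card_ord -[leLHS]mulr_natl mulrA.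
Qed.

Section limit_of_smooth.
Variables (V : set 'rV[R]_n) (F : nat -> 'rV[R]_n -> R) (f : 'rV[R]_n -> R).
Hypothesis oV : open V.
Hypothesis sF : forall N, smooth_on V (F N).
Hypothesis bF : forall s, exists C, forall N y, V y -> `|iter_partial s (F N) y| <= C.
Hypothesis Ff : forall y, V y -> F ^~ y @ \oo --> f y.

(** Difference quotients differ from derivatives by at most C |h|, uniformly in N.
    They converge for each fixed h, so the derivatives form a Cauchy sequence, and
    the estimate persists in the limit. *)
Lemma limit_partial x i : V x ->
  derivable f x (e_ i) /\ (fun N => partial i (F N) x) @ \oo --> partial i f x.
Proof.
move=> Vx; have [r r0 rV] := open_cube oV Vx.
have [C0 HC0] := bF [:: i; i].
pose C := `|C0| + 1.
have C1 : 0 < C by rewrite ltr_wpDl.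
have HC N y : V y -> `|iter_partial [:: i; i] (F N) y| <= C.
  move=> Vy; apply: le_trans (HC0 N y Vy) _; apply: le_trans (ler_norm C0) _.
  by rewrite lerDl.
have hV (h : R) : `|h| < r -> forall t : R, `|t| <= `|h| -> V (t *: e_ i + x).
  move=> hr t th; apply: rV; rewrite /cube /= addrK normrZ norm_delta mulr1.
  exact: le_lt_trans hr.
have est N (h : R) : `|h| < r ->
    `|F N (h *: e_ i + x) - F N x - h * partial i (F N) x| <= C * `|h| * `|h|.
  by move=> hr; apply: second_order_le (sF N) (hV h hr) (HC N).
have estd N (h : R) : h != 0 -> `|h| < r ->
    `|h^-1 * (F N (h *: e_ i + x) - F N x) - partial i (F N) x| <= C * `|h|.
  move=> h0 hr; rewrite -(ler_pM2r (_ : 0 < `|h|)) ?normr_gt0 //.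
  rewrite -normrM mulrBl mulrAC mulVf // mul1r [_ * h]mulrC; exact: est.
have cq (h : R) : `|h| < r ->
    (fun N => F N (h *: e_ i + x) - F N x) @ \oo --> f (h *: e_ i + x) - f x.
  by move=> hr; apply: cvgB; apply: Ff => //; exact: hV (lexx _).
have cF : cvg ((fun N => partial i (F N) x) @ \oo).
  apply/cauchy_cvgP; apply: cauchy_exP => e e0.
  pose h := Num.min (r / 2) (e / 2 / C).
  have h0 : 0 < h by rewrite lt_min !divr_gt0.
  have hr : `|h| < r.
    rewrite gtr0_norm // (@le_lt_trans _ _ (r / 2)) ?ge_min ?lexx //.
    by rewrite ltr_pdivrMr // ltr_pMr // ltr1n.
  have hC : C * `|h| <= e / 2.
    rewrite gtr0_norm // mulrC -ler_pdivlMr //.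
    by rewrite ge_min lexx orbT.
  exists (h^-1 * (f (h *: e_ i + x) - f x)).
  have ch : (fun N => h^-1 * (F N (h *: e_ i + x) - F N x)) @ \oo
     --> h^-1 * (f (h *: e_ i + x) - f x).
    by apply: cvgM; [exact: cvg_cst|exact: cq].
  have e2 : 0 < e / 2 by rewrite divr_gt0.
  have [N0 _ HN] := (cvgrPdist_lt _ _).1 ch _ e2.
  exists N0 => // N /HN /= h1; rewrite -ball_normE /=.
  apply: le_lt_trans (ler_distD (h^-1 * (F N (h *: e_ i + x) - F N x)) _ _) _.
  rewrite [ltRHS]splitr; apply: ltr_leD => //.
  by apply: le_trans hC; apply: estd => //; rewrite gt_eqF.
have [v cv] := (cvg_ex _).1 cF.
have lest (h : R) : h != 0 -> `|h| < r ->
    `|h^-1 * (f (h *: e_ i + x) - f x) - v| <= C * `|h|.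
  move=> h0 hr.
  have := @lim_dist_le (fun N => h^-1 * (F N (h *: e_ i + x) - F N x) - partial i (F N) x) 
    (h^-1 * (f (h *: e_ i + x) - f x) - v) 0 (C * `|h|).
  rewrite subr0; apply.
    by apply: cvgB => //; apply: cvgM; [exact: cvg_cst|exact: cq].
  by move=> N; rewrite subr0; exact: estd.
have cd : (fun h : R => h^-1 *: ((f \o shift x) (h *: e_ i) - f x)) @ 0^' --> v.
  apply/cvgrPdist_le => e e0; near=> h.
  rewrite distrC; apply: (@le_trans _ _ (C * `|h|)).
    apply: lest; first by near: h; exact: nbhs_dnbhs_neq.
    by near: h; exact: dnbhs0_lt.
  rewrite mulrC -ler_pdivlMr //.
  by near: h; apply: dnbhs0_le; rewrite divr_gt0.
split; first by apply/cvg_ex; exists v.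
suff -> : partial i f x = v by [].
exact: cvg_lim cd.
Unshelve. all: by end_near.
Qed.

Lemma limit_continuous x : V x -> {for x, continuous f}.
Proof.
move=> Vx; have [r r0 rV] := open_cube oV Vx.
have [C HC] : exists C, forall i N y, V y -> `|partial i (F N) y| <= C.
  have /choice[c Hc] : forall i, exists C, forall N y, V y -> `|partial i (F N) y| <= C.
    by move=> i; exact: (bF [:: i]).
  exists (\sum_i `|c i|) => i N y Vy; apply: le_trans (Hc i N y Vy) _.
  rewrite (bigD1 i) //=; apply: le_trans (ler_norm _) _.
  by rewrite lerDl sumr_ge0.
have est y : `|y - x| < r -> `|f y - f x| <= n%:R * `|C| * `|y - x|.
  move=> yr; have Vy : V y by exact: rV.
  have := @lim_dist_le (fun N => F N y - F N x) (f y - f x) 0 (n%:R * `|C| * `|y - x|).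
  rewrite subr0; apply; first by apply: cvgB; exact: Ff.
  move=> N; rewrite subr0; apply: (lipschitz_le (sF N) oV) => [t t1|i z Vz].
    apply: rV; rewrite /cube /= addrK normrZ; apply: le_lt_trans yr.
    by rewrite ler_piMl.
  by apply: le_trans (HC i N z Vz) _; exact: ler_norm.
apply/(@cvgrPdist_le _ _ _ (nbhs x) _) => e e0.
pose K := n%:R * `|C| + 1.
have K0 : 0 < K by rewrite ltr_wpDl ?mulr_ge0.
have nb : nbhs x (cube x (Num.min r (e / K))).
  by apply: nbhs_cube; rewrite lt_min r0 divr_gt0.
apply: filterS nb => y; rewrite /cube /= lt_min => /andP[yr yK].
rewrite distrC; apply: le_trans (est y yr) _.
rewrite ltr_pdivlMr // in yK; apply: le_trans (ltW yK).
by rewrite mulrC ler_wpM2l // lerDl.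
Qed.

End limit_of_smooth.

(** Pointwise convergence is enough, because all derivatives are bounded
    uniformly: [limit_partial] applies to one derivative after another. *)
Lemma limit_smooth V (F : nat -> 'rV[R]_n -> R) f : open V ->
  (forall N, smooth_on V (F N)) ->
  (forall s, exists C, forall N y, V y -> `|iter_partial s (F N) y| <= C) ->
  (forall y, V y -> F ^~ y @ \oo --> f y) ->
  smooth_on V f /\ forall s y, V y ->
    (fun N => iter_partial s (F N) y) @ \oo --> iter_partial s f y.
Proof.
move=> oV sF bF Ff.
have bs s t : exists C, forall N y, V y -> `|iter_partial t (iter_partial s (F N)) y| <= C.
  by have [C H] := bF (t ++ s); exists C => N y; rewrite -iter_partial_cat; exact: H.
have ss s N : smooth_on V (iter_partial s (F N)) by exact: smooth_iter.
have cs s : forall y, V y ->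
    (fun N => iter_partial s (F N) y) @ \oo --> iter_partial s f y.
  elim: s => [|i s IH] y Vy; first exact: Ff.
  exact: (limit_partial oV (ss s) (bs s) IH i Vy).2.
split => // s x Vx; split.
  exact: (limit_continuous oV (ss s) (bs s) (cs s) Vx).
by move=> i; exact: (limit_partial oV (ss s) (bs s) (cs s) i Vx).1.
Qed.

Lemma limit_cauchy_on V (F : nat -> 'rV[R]_n -> R) f (C L : R) : open V ->
  0 <= C -> 0 <= L ->
  (forall N, cauchy_on V (F N) C L) ->
  (forall y, V y -> F ^~ y @ \oo --> f y) ->
  cauchy_on V f C L /\ forall s y, V y ->
    (fun N => iter_partial s (F N) y) @ \oo --> iter_partial s f y.
Proof.
move=> oV C0 L0 bF Ff.
have [|s|sf cf] := limit_smooth oV _ _ Ff.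
- by move=> N; case: (bF N).
- exists (C * (size s)`!%:R * L ^+ size s) => N y Vy.
  by have [_ _ _ H] := bF N; exact: H.
split => //; split => // s x Vx.
have := @lim_dist_le _ _ 0 (C * (size s)`!%:R * L ^+ size s) (cf s x Vx).
rewrite subr0; apply => N; rewrite subr0.
by have [_ _ _ H] := bF N; exact: H.
Qed.

Lemma cube_line (a x y : 'rV[R]_n) (r t : R) : cube a r x -> cube a r y ->
  0 <= t <= 1 -> cube a r (t *: (y - x) + x).
Proof.
rewrite /cube /= => xr yr /andP[t0 t1].
have -> : t *: (y - x) + x - a = t *: (y - a) + (1 - t) *: (x - a).
  by apply/rowP => j; rewrite !mxE; ring.
have t1' : 0 <= 1 - t by rewrite subr_ge0.
have r0 : 0 < r by apply: le_lt_trans xr.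
have [->|tn0] := eqVneq t 0; first by rewrite scale0r add0r subr0 scale1r.
apply: le_lt_trans (ler_normD _ _) _; rewrite !normrZ !ger0_norm //.
apply: (@lt_le_trans _ _ (t * r + (1 - t) * r)); last by rewrite -mulrDl addrC subrK mul1r.
apply: ltr_leD; last by rewrite ler_wpM2l // ltW.
by rewrite ltr_pM2l // lt_neqAle eq_sym tn0.
Qed.

Lemma derivable_on_segment V f x v (t : R) : open V -> smooth_on V f ->
  V (t *: v + x) ->
  is_derive t 1 (fun s => f (s *: v + x)) (\sum_i v 0 i * partial i f (t *: v + x)).
Proof.
move=> oV sf Vt; have df := smooth_diff oV sf Vt.
by rewrite -derive_partial //; apply: is_derive_line; exact: diff_derivable.
Qed.

Lemma is_derive_scale (c : R) (f : R -> R) (s df : R) : is_derive s 1 f df ->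
  is_derive s 1 (fun t => c * f t) (c * df).
Proof.
move=> [d <-]; split; first exact: (@derivableZ _ _ _ f c).
exact: (@deriveZ _ _ _ f c).
Qed.

Lemma is_derive_pow (m : nat) (s : R) :
  is_derive s 1 (fun t : R => t ^+ m.+1) (m.+1%:R * s ^+ m).
Proof.
split; first exact: exprn_derivable.
by rewrite exp_derive /GRing.scale /= mulr1.
Qed.

(** Integration of the bound for the derivative, in the form of the mean value
    theorem for B t^(m+1) / (m+1) - phi and B t^(m+1) / (m+1) + phi. *)
Lemma segment_bound (phi dphi : R -> R) (B : R) (m : nat) : 0 <= B ->
  (forall t : R, 0 <= t <= 1 -> is_derive t 1 phi (dphi t)) -> phi 0 = 0 ->
  (forall t : R, 0 <= t <= 1 -> `|dphi t| <= B * t ^+ m) ->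
  forall t : R, 0 <= t <= 1 -> `|phi t| <= B / m.+1%:R * t ^+ m.+1.
Proof.
move=> B0 D p0 H t /andP[t0 t1].
have key (e : R) : `|e| = 1 -> e * phi t <= B / m.+1%:R * t ^+ m.+1.
  move=> e1.
  pose psi s := B / m.+1%:R * s ^+ m.+1 - e * phi s.
  have Dpsi (s : R) : 0 <= s <= 1 -> is_derive s 1 psi (B * s ^+ m - e * dphi s).
    move=> s01; have Ds := D s s01.
    have De := is_derive_scale e Ds.
    have := is_derive_scale (B / m.+1%:R) (is_derive_pow m s).
    have -> : B / m.+1%:R * (m.+1%:R * s ^+ m) = B * s ^+ m.
      by rewrite -mulrA mulKf // pnatr_eq0.
    move=> Dp.
    exact: is_deriveB.
  have [|c|] := @MVT_segment _ psi (fun s => B * s ^+ m - e * dphi s) 0 t t0.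
  - move=> s; rewrite in_itv /= => /andP[s0 s1]; apply: Dpsi.
    by rewrite (ltW s0) /= (le_trans (ltW s1)).
  - apply: derivable_within_continuous => s; rewrite in_itv /= => /andP[s0 s1].
    have Ds : is_derive s 1 psi (B * s ^+ m - e * dphi s).
      by apply: Dpsi; rewrite s0 (le_trans s1).
    exact: ex_derive.
  move=> c; rewrite in_itv /= => /andP[c0 ct] E.
  have c01 : 0 <= c <= 1 by rewrite c0 (le_trans ct).
  rewrite -subr_ge0 -[leRHS]/(psi t).
  have -> : psi t = psi t - psi 0 by rewrite {3}/psi p0 mulr0 expr0n mulr0 !subr0.
  rewrite E subr0 mulr_ge0 // subr_ge0; apply: le_trans (ler_norm _) _.
  by rewrite normrM e1 mul1r; exact: H.
rewrite ler_norml lerNl; apply/andP; split; last by rewrite -[phi t]mul1r key ?normr1.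
by rewrite -mulN1r key // normrN1.
Qed.

(** Integrating m times along the segment from q, where all derivatives of w
    vanish, gives |w(y)| <= C (n K |y - q|)^m for every m. *)
Lemma taylor_vanish (q : 'rV[R]_n) (r C K : R) (w : 'rV[R]_n -> R) : cauchy_on (cube q r) w C K ->
  (forall s, iter_partial s w q = 0) ->
  forall y, cube q r y -> n%:R * K * `|y - q| < 1 -> w y = 0.
Proof.
move=> [sw C0 K0 H] w0 y yr small.
pose v := y - q; pose d := n%:R * `|v|.
have d0 : 0 <= d by rewrite mulr_ge0.
have inV (t : R) : 0 <= t <= 1 -> cube q r (t *: v + q).
  by apply: cube_line => //; apply: cubexx; apply: le_lt_trans yr.
have main m : forall s (t : R), 0 <= t <= 1 ->
    `|iter_partial s w (t *: v + q)| <=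
    C * (size s + m)`!%:R * K ^+ (size s + m) * d ^+ m / m`!%:R * t ^+ m.
  elim: m => [|m IH] s t t01.
    by rewrite addn0 fact0 !expr0 invr1 !mulr1; apply: H; exact: inV.
  have := @segment_bound (fun t => iter_partial s w (t *: v + q))
     (fun t => \sum_i v 0 i * partial i (iter_partial s w) (t *: v + q))
     (d * (C * (size s + m.+1)`!%:R * K ^+ (size s + m.+1) * d ^+ m / m`!%:R)) m.
  move=> /(_ _ _ _ _ t t01)/wrap[].
  - by rewrite !mulr_ge0 ?exprn_ge0 // invr_ge0.
  - move=> s' s01; apply: (@derivable_on_segment (cube q r)) => //.
    + exact: cube_open.
    + exact: smooth_iter.
    + exact: inV.
  - by rewrite scale0r add0r; exact: w0.
  - move=> s' s01; apply: le_trans (ler_norm_sum _ _ _) _.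
    apply: (@le_trans _ _ (\sum_(i < n) `|v| * (C * (size s + m.+1)`!%:R *
       K ^+ (size s + m.+1) * d ^+ m / m`!%:R * s' ^+ m))).
      apply: ler_sum => i _; rewrite normrM; apply: ler_pM => //.
        exact: norm_coord.
      by have := IH (i :: s) s' s01; rewrite /= addSnnS.
    rewrite sumr_const card_ord -[X in X <= _]mulr_natl /d.
    by rewrite le_eqVlt; apply/orP; left; apply/eqP; ring.
  move=> /le_trans; apply; rewrite le_eqVlt; apply/orP; left; apply/eqP.
  rewrite [m.+1`!]factS natrM [d ^+ m.+1]exprS invfM.
  move: (C * _ * _) (d ^+ m) (t ^+ m.+1) (m`!%:R^-1 : R) (m.+1%:R^-1 : R) => *.
  by ring.
have le_m m : `|w y| <= C * (n%:R * K * `|y - q|) ^+ m.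
  have := main m [::] 1; rewrite ler01 lexx => /(_ isT); rewrite /= scale1r subrK.
  move=> /le_trans; apply; rewrite expr1n mulr1 add0n.
  rewrite le_eqVlt; apply/orP; left; apply/eqP.
  have -> : n%:R * K * `|y - q| = K * d by rewrite /d mulrCA mulrA.
  rewrite [(K * d) ^+ m]exprMn.
  have f0 : m`!%:R != 0 :> R by rewrite pnatr_eq0 -lt0n fact_gt0.
  by field.
have c0 : (fun m => C * (n%:R * K * `|y - q|) ^+ m) @ \oo --> (0 : R).
  rewrite -(mulr0 C); apply: cvgM; first exact: cvg_cst.
  by apply: cvg_expr; rewrite ger0_norm // !mulr_ge0.
apply/eqP; rewrite -normr_le0; apply/ler_addgt0Pr => e e0; rewrite add0r.
have [N _ /(_ N (leqnn N)) /= h] := (cvgrPdist_le _ _).1 c0 e e0.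
apply: le_trans (le_m N) _; move: h; rewrite sub0r normrN.
exact: le_trans (ler_norm _).
Qed.

Lemma zero_gradient (a : 'rV[R]_n) (r : R) (w : 'rV[R]_n -> R) : smooth_on (cube a r) w ->
  (forall i x, cube a r x -> partial i w x = 0) ->
  forall x y, cube a r x -> cube a r y -> w x = w y.
Proof.
move=> sw g0 x y xr yr.
have inV (t : R) : 0 <= t <= 1 -> cube a r (t *: (y - x) + x) by exact: cube_line.
have D (t : R) : 0 <= t <= 1 ->
    is_derive t 1 (fun t => w (t *: (y - x) + x) - w x) 0.
  move=> t01.
  have D0 := @derivable_on_segment (cube a r) w x (y - x) t (@cube_open R n a r) sw (inV t t01).
  have E : \sum_i (y - x) 0 i * partial i w (t *: (y - x) + x) = 0.
    by rewrite big1 // => i _; rewrite g0 ?mulr0 //; exact: inV.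
  rewrite E in D0.
  by apply: is_derive_eq; rewrite subr0.
have := @segment_bound _ (fun=> 0) 0 0 (lexx 0) D.
rewrite scale0r add0r subrr => /(_ erefl) /(_ _ 1)/wrap[].
  by move=> t _; rewrite normr0 mul0r.
rewrite ler01 lexx => /(_ isT); rewrite !mul0r scale1r subrK normr_le0 subr_eq0.
by move/eqP.
Qed.

End limits.

(** * Power series *)

Section power_series.
Context {R : realType} {n : nat}.
Implicit Types (f : 'rV[R]_n -> R) (a x y : 'rV[R]_n) (V : set 'rV[R]_n) (s w : seq 'I_n).

Lemma cauchy_onZ V f (c C L : R) : open V -> cauchy_on V f C L ->
  cauchy_on V (fun y => c * f y) (`|c| * C) L.
Proof.
move=> oV [sf C0 L0 H].
have sc : smooth_on V (fun y => c * f y) by apply: smoothM => //; exact: smooth_cst.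
split => //; first exact: mulr_ge0.
move=> s x Vx.
have -> : iter_partial s (fun y => c * f y) x = c * iter_partial s f x.
  elim: s x Vx => [|i s IH] x Vx //=; rewrite (eq_partial i oV Vx IH).
  rewrite partialM; [|exact: derivable_cst|exact: (sf s x Vx).2].
  by rewrite partial_cst mul0r add0r.
by rewrite normrM -!mulrA ler_wpM2l // mulrA; exact: H.
Qed.

Lemma cauchy_on_sumC V (I : Type) (r : seq I) (F : I -> 'rV[R]_n -> R) (C : I -> R) (L : R) :
  open V -> 0 <= L -> (forall i, cauchy_on V (F i) (C i) L) ->
  cauchy_on V (fun y => \sum_(i <- r) F i y) (\sum_(i <- r) C i) L.
Proof.
move=> oV L0 H; elim: r => [|i r IH].
  under eq_fun do rewrite big_nil.
  by rewrite big_nil; apply: cauchy_onW (cauchy_on_cst V 0); rewrite ?normr0.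
by under eq_fun do rewrite big_cons; rewrite big_cons; exact: cauchy_onD.
Qed.

Lemma smooth_center_coord V a j : open V -> smooth_on V (fun x => (x - a) 0 j).
Proof.
move=> oV; have := smoothB oV (@smooth_coord _ _ V j) (smooth_cst (a 0 j)).
by apply: eq_smooth => // y _; rewrite !mxE.
Qed.

Lemma partial_center_coord a i j :
  partial i (fun x => (x - a) 0 j) = fun _ => (j == i)%:R.
Proof.
apply/funext => x.
have -> : (fun x : 'rV[R]_n => (x - a) 0 j) = (fun x => x 0 j + - a 0 j).
  by apply/funext => y; rewrite !mxE.
rewrite partialD; [|exact: derivable_coord|exact: derivable_cst].
by rewrite partial_coord partial_cst addr0.
Qed.

(** By induction on the degree: only the terms of order 0 and 1 in the linear
    factor survive in the product rule, and each contributes r times the bound for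
    the remaining monomial, whence the factor 2 r per variable. *)
Lemma cauchy_on_monomial a w (r : R) : 0 < r ->
  cauchy_on (cube a r) (fun x => \prod_(j <- w) (x - a) 0 j) (\prod_(j <- w) (2 * r)) r^-1.
Proof.
move=> r0; have oV := @cube_open R n a r.
have ri0 : 0 <= r^-1 by rewrite invr_ge0 ltW.
elim: w => [|j w IH].
  under eq_fun do rewrite big_nil.
  by rewrite big_nil; apply: cauchy_onW (cauchy_on_cst _ 1); rewrite ?normr1.
under eq_fun do rewrite big_cons.
rewrite big_cons; set D := \prod_(_ <- w) _ in IH *.
have [sg D0 _ H] := IH.
have sc := smooth_center_coord a j oV.
split; [exact: smoothM|by rewrite !mulr_ge0 // ltW|exact: ri0|].
move=> s x xr.
pose b k := if k is 0%N then r else if k is 1%N then 1 else 0 : R.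
apply: le_trans (leibniz_le (a := fun k m => b k * (D * m`!%:R * r^-1 ^+ m)) oV xr sc sg _) _.
  move=> t t' _; apply: ler_pM => //; last exact: H.
  case: t => [|i t] /=.
    by apply: le_trans (norm_coord _ _) _; exact: ltW.
  case/lastP: t => [|t i'] /=.
    by rewrite partial_center_coord; case: eqP => _; rewrite ?normr1 ?normr0.
  rewrite size_rcons -[partial i _]/(iter_partial (i :: rcons t i') _).
  rewrite -rcons_cons iter_partial_rcons partial_center_coord.
  by rewrite iter_partial_cst normr0.
rewrite bsumE big_ord_recl bin0 mul1r subn0 /=.
case: (size s) => [|m].
  rewrite big_ord0 addr0 fact0 !expr0 !mulr1 -mulrA [leRHS]mulr_natl mulr2n lerDl.
  by rewrite mulr_ge0 // ltW.
rewrite big_ord_recl /= big1 ?addr0; last first.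
  by move=> k _; rewrite /= mul0r mulr0.
rewrite bin1 subn1 /= mul1r factS natrM.
rewrite exprS mulrACA.
have -> : 2 * r * D * (m.+1%:R * m`!%:R) * (r^-1 * r^-1 ^+ m) =
  r * (D * (m.+1%:R * m`!%:R) * (r^-1 * r^-1 ^+ m)) + (r * r^-1) * (m.+1%:R * (D * m`!%:R * r^-1 ^+ m)) by ring.
rewrite mulfV ?gt_eqF // mul1r le_eqVlt; apply/orP; left; apply/eqP.
by rewrite /bump /=; ring.
Qed.

(** A word in which i occurs alpha i times: the monomial with exponent alpha is
    the product of the coordinates along this word. *)
Definition word_of (alpha : {ffun 'I_n -> nat}) : seq 'I_n :=
  flatten [seq nseq (alpha i) i | i <- enum 'I_n].

Lemma prod_word_of (F : 'I_n -> R) alpha :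
  \prod_(j <- word_of alpha) F j = \prod_i F i ^+ alpha i.
Proof.
rewrite /word_of big_flatten big_map big_enum; apply: eq_bigr => i _.
elim: (alpha i) => [|k IH]; first by rewrite big_nil.
by rewrite /= big_cons IH exprS.
Qed.

Lemma summable_finite_le (T : choiceType) (J : finType) (e : J -> T) (F : T -> R) :
  injective e -> summable setT (fun t => (F t)%:E) ->
  \sum_j `|F (e j)| <= fine (\esum_(t in setT) `|(F t)%:E|%E).
Proof.
move=> ie sF.
rewrite -lee_fin fineK; last first.
  rewrite ge0_fin_numE //; apply: esum_ge0 => t _; exact: abse_ge0.
have ur : uniq [seq e j | j <- index_enum J].
  by rewrite (map_inj_uniq ie) index_enum_uniq.
apply: esum_ge; exists [set` [seq e j | j <- index_enum J]].
  by split => //; exact: finite_seq.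
by rewrite -fsbig_seq // big_map sumEFin.
Qed.

(** The partial sums over boxes are polynomials.  On the cube of radius r / 4 their
    derivatives are bounded by the sum of the absolute values of the terms of the
    series at the point a + (r/2, ..., r/2), where the series converges. *)
Lemma analytic_cauchy_at f a : analytic_at f a -> cauchy_at f a.
Proof.
move=> [c [r [r0 H]]].
(* The monomial bound involves 2 r1, which must stay below r. *)
pose r1 := r / 4; have r10 : 0 < r1 by rewrite divr_gt0.
pose x0 : 'rV[R]_n := a + const_mx (2 * r1).
have x0r : `|x0 - a| < r.
  rewrite /x0 addrAC subrr add0r.
  apply: (@le_lt_trans _ _ (2 * r1)); last by rewrite /r1; lra.
  apply: norm_rV_le => [|i]; first by rewrite mulr_ge0 // ltW.
  by rewrite mxE gtr0_norm // mulr_gt0.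
have [sx0 _] := H x0 x0r.
pose e N (al : {ffun 'I_n -> 'I_N}) : {ffun 'I_n -> nat} := [ffun i => al i : nat].
have ie N : injective (@e N).
  move=> al be /ffunP E; apply/ffunP => i; apply: val_inj.
  by have := E i; rewrite !ffunE.
pose C := fine (\esum_(al in setT) `|(powser_term c (x0 - a) al)%:E|%E).
have C0 : 0 <= C.
  by rewrite fine_ge0 //; apply: esum_ge0 => t _; exact: abse_ge0.
have ri0 : 0 <= r1^-1 by rewrite invr_ge0 ltW.
pose F N x := \sum_(al : {ffun 'I_n -> 'I_N}) powser_term c (x - a) (e N al).
have oV := @cube_open R n a r1.
have bF N : cauchy_on (cube a r1) (F N) C r1^-1.
  have term al : cauchy_on (cube a r1) (fun x => powser_term c (x - a) al)
      `|powser_term c (x0 - a) al| r1^-1.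
    have := cauchy_onZ (c al) oV (cauchy_on_monomial a (word_of al) r10).
    rewrite !prod_word_of => B.
    have -> : `|powser_term c (x0 - a) al| = `|c al| * \prod_(i < n) (2 * r1) ^+ al i.
      rewrite /powser_term normrM normr_prod; congr (_ * _); apply: eq_bigr => i _.
      by rewrite /x0 addrAC subrr add0r mxE normrX gtr0_norm // mulr_gt0.
    by apply: eq_cauchy_on B => // y _; rewrite /powser_term prod_word_of.
  apply: cauchy_onW (cauchy_on_sumC (index_enum _) oV ri0 (fun al => term (e N al))) => //.
  exact: summable_finite_le (ie N) sx0.
exists r1, C, r1^-1; split => //.
have Ff y : cube a r1 y -> F ^~ y @ \oo --> f y.
  move=> yr; apply: (H y _).2; apply: lt_trans yr _.
  by rewrite /r1 ltr_pdivrMr // ltr_pMr // ltr1n.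
exact: (limit_cauchy_on oV C0 ri0 bF Ff).1.
Qed.

(** If U s is the derivative d^s u (q), then hpoly m U y / m! is the homogeneous
    part of degree m of the Taylor expansion of u at q, in the variable y; the sum
    runs over words instead of multi-indices. *)
Fixpoint hpoly (m : nat) (U : seq 'I_n -> R) y : R :=
  if m is m'.+1 then \sum_c y 0 c * hpoly m' (U \o cons c) y else U [::].

Definition swap_invariant (U : seq 'I_n -> R) := forall s1 b c s2,
  U (s1 ++ b :: c :: s2) = U (s1 ++ c :: b :: s2).

Lemma swap_cons U b : swap_invariant U -> swap_invariant (U \o cons b).
Proof. by move=> sU s1 i j s2; exact: (sU (b :: s1)). Qed.

Lemma swap_catrev U s : swap_invariant U -> swap_invariant (U \o catrev s).
Proof.
move=> sU; elim: s => [//|i s IH] s1 b c s2.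
exact: (IH (i :: s1)).
Qed.

Lemma hpoly_le m U y (D : R) : (forall w, size w = m -> `|U w| <= D) ->
  `|hpoly m U y| <= D * (n%:R * `|y|) ^+ m.
Proof.
elim: m U => [|m IH] U H /=; first by rewrite expr0 mulr1; exact: H.
apply: le_trans (ler_norm_sum _ _ _) _.
apply: (@le_trans _ _ (\sum_(c < n) `|y| * (D * (n%:R * `|y|) ^+ m))).
  apply: ler_sum => c _; rewrite normrM; apply: ler_pM => //.
    exact: norm_coord.
  by apply: IH => w sw; apply: H; rewrite /= sw.
by rewrite sumr_const card_ord -[leLHS]mulr_natl exprS le_eqVlt; apply/orP; left; apply/eqP; ring.
Qed.

Lemma smooth_hpoly V m U : open V -> smooth_on V (hpoly m U).
Proof.
move=> oV; elim: m U => [|m IH] U /=; first exact: smooth_cst.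
apply: (smooth_sum _ oV) => c _; apply: (smoothM oV); last exact: IH.
exact: smooth_coord.
Qed.

Lemma derivable_hpoly m U y i : derivable (hpoly m U) y (delta_mx 0 i).
Proof. by have := (@smooth_hpoly setT m U openT [::] y I).2. Qed.

(** Each of the m + 1 letters of a word can be the one that is differentiated;
    symmetry of U under exchange of letters makes all these terms equal. *)
Lemma partial_hpoly b m U : swap_invariant U ->
  partial b (hpoly m.+1 U) = fun y => m.+1%:R * hpoly m (U \o cons b) y.
Proof.
move=> sU; apply/funext; elim: m U sU => [|m IH] U sU y.
  rewrite mul1r /= partial_sum; last first.
    by move=> c _; apply: derivableM; [exact: derivable_coord|exact: derivable_cst].
  rewrite (bigD1 b) //= big1 ?addr0; last first.
    move=> c cb; rewrite partialM; [|exact: derivable_coord|exact: derivable_cst].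
    by rewrite partial_coord partial_cst (negbTE cb) mul0r mulr0 addr0.
  rewrite partialM; [|exact: derivable_coord|exact: derivable_cst].
  by rewrite partial_coord partial_cst eqxx mulr0 addr0 mul1r.
have -> : hpoly m.+2 U = (fun y => \sum_c y 0 c * hpoly m.+1 (U \o cons c) y).
  by apply/funext.
rewrite partial_sum; last first.
  by move=> c _; apply: derivableM; [exact: derivable_coord|exact: derivable_hpoly].
rewrite (eq_bigr (fun c => (c == b)%:R * hpoly m.+1 (U \o cons c) y +
    m.+1%:R * (y 0 c * hpoly m ((U \o cons b) \o cons c) y))); last first.
  move=> c _; rewrite partialM; [|exact: derivable_coord|exact: derivable_hpoly].
  rewrite partial_coord IH; last exact: swap_cons.
  congr (_ + _); rewrite mulrCA; congr (_ * (_ * hpoly _ _ _)).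
  by apply/funext => s /=; exact: (sU [::]).
have E1 : \sum_c (c == b)%:R * hpoly m.+1 (U \o cons c) y = hpoly m.+1 (U \o cons b) y.
  rewrite (bigD1 b) // eqxx mul1r big1; first exact: addr0.
  by move=> c cb; rewrite (negbTE cb) mul0r.
rewrite big_split -mulr_sumr E1 -[_ (hpoly _ _ _) _]/(_ + _).
by rewrite -[X in X + _]mul1r -[\sum_c _]/(hpoly m.+1 (U \o cons b) y) -mulrDl nat1r.
Qed.

Definition tpoly (N : nat) (U : seq 'I_n -> R) y : R :=
  \sum_(m < N) hpoly m U y / m`!%:R.

Lemma partial_tpoly b N U q : swap_invariant U ->
  partial b (fun y => tpoly N U (y - q)) = fun y => tpoly N.-1 (U \o cons b) (y - q).
Proof.
move=> sU; apply/funext => y.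
have -> : partial b (fun y => tpoly N U (y - q)) y = partial b (tpoly N U) (y - q).
  exact: (derive_shift_fun (tpoly N U) (- q)).
case: N => [|N].
  have -> : tpoly 0 U = fun=> 0 by apply/funext => z; rewrite /tpoly big_ord0.
  by rewrite partial_cst /tpoly big_ord0.
move: (y - q) => {}y; rewrite /tpoly partial_sum; last first.
  by move=> m _; apply: derivableM; [exact: derivable_hpoly|exact: derivable_cst].
have D m : partial b (fun y => hpoly m U y / m`!%:R) y = partial b (hpoly m U) y / m`!%:R.
  rewrite partialM; [|exact: derivable_hpoly|exact: derivable_cst].
  by rewrite partial_cst mulr0 addr0.
have h0 : hpoly 0 U = (fun=> U [::]) by apply/funext.
rewrite big_ord_recl D h0 partial_cst mul0r add0r.
apply: eq_bigr => m _; rewrite lift0 D partial_hpoly // factS natrM invfM.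
by rewrite mulrACA mulfV ?mul1r // pnatr_eq0.
Qed.

Lemma iter_partial_tpoly s N U q : swap_invariant U ->
  iter_partial s (fun y => tpoly N U (y - q)) =
  fun y => tpoly (N - size s) (U \o catrev s) (y - q).
Proof.
move=> sU; elim: s => [|i s IH] /=; first by rewrite subn0.
rewrite IH partial_tpoly; last exact: swap_catrev.
by apply/funext => y; rewrite subnS.
Qed.

Lemma fact_add_le k m : ((k + m)`! <= k`! * m`! * 2 ^ (k + m))%N.
Proof.
have bin_le N j : ('C(N, j) <= 2 ^ N)%N.
  elim: N j => [|N IH] [|j] //; first by rewrite bin0 expn_gt0.
  by rewrite binS expnS mul2n -addnn leq_add.
have := @bin_fact (k + m) k (leq_addr _ _); rewrite addKn => <-.
by rewrite mulnC leq_mul2l bin_le orbT.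
Qed.

Lemma half_sum_le N : \sum_(m < N) (2^-1 : R) ^+ m <= 2.
Proof.
suff : \sum_(m < N) (2^-1 : R) ^+ m = 2 - 2 * 2^-1 ^+ N.
  by move=> ->; rewrite gerBl mulr_ge0 // exprn_ge0 // invr_ge0.
elim: N => [|N IH]; first by rewrite big_ord0 expr0 mulr1 subrr.
by rewrite big_ord_recr /= IH exprS; field.
Qed.

Lemma taylor_term_le U (C T : R) s m y :
  0 <= C -> 0 <= T ->
  (forall w, `|U w| <= C * (size w)`!%:R * T ^+ size w) ->
  4 * (n%:R * T * `|y|) <= 1 ->
  `|hpoly m (U \o catrev s) y / m`!%:R| <=
     C * (size s)`!%:R * (2 * T) ^+ size s * 2^-1 ^+ m.
Proof.
move=> C0 T0 HU sm.
have m0 : 0 < m`!%:R :> R by rewrite ltr0n fact_gt0.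
rewrite normrM normfV [`|m`!%:R|]gtr0_norm // ler_pdivrMr //.
have := @hpoly_le m (U \o catrev s) y (C * (size s + m)`!%:R * T ^+ (size s + m)).
move=> /(_ _)/wrap[].
  move=> w <-; have := HU (catrev s w).
  by have -> : size (catrev s w) = (size s + size w)%N by rewrite catrevE size_cat size_rev.
move=> /le_trans; apply.
have F : (size s + m)`!%:R <= (size s)`!%:R * m`!%:R * 2 ^+ (size s + m) :> R.
  by rewrite -natrX -!natrM ler_nat fact_add_le.
apply: (@le_trans _ _ (C * ((size s)`!%:R * m`!%:R * 2 ^+ (size s + m)) * T ^+ (size s + m)
    * (n%:R * `|y|) ^+ m)).
  rewrite ler_wpM2r ?exprn_ge0 ?mulr_ge0 // ler_wpM2r ?exprn_ge0 //.
  by rewrite ler_wpM2l.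
have -> : C * ((size s)`!%:R * m`!%:R * 2 ^+ (size s + m)) * T ^+ (size s + m)
    * (n%:R * `|y|) ^+ m =
  C * (size s)`!%:R * (2 * T) ^+ size s * m`!%:R * (2 * (n%:R * T * `|y|)) ^+ m.
  by rewrite !exprD !exprMn; ring.
rewrite -[leRHS]mulrA [2^-1 ^+ m * _]mulrC [leRHS]mulrA.
rewrite ler_wpM2l //; first by rewrite !mulr_ge0 // exprn_ge0 // mulr_ge0.
have y0 : 0 <= n%:R * T * `|y| by rewrite !mulr_ge0.
apply: lerXn2r; rewrite ?nnegrE ?mulr_ge0 ?invr_ge0 //.
by move: (_ * T * _) sm y0 => z; lra.
Qed.

(** A jet with Cauchy estimates is the jet of a function on a cube whose size
    depends on T only.  The list is reversed because the differentiations
    accumulate letters in the opposite order; see [iter_partial_tpoly]. *)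
Lemma taylor_realization U (C T rho : R) q : swap_invariant U ->
  0 <= C -> 0 <= T -> (forall w, `|U w| <= C * (size w)`!%:R * T ^+ size w) ->
  4 * (n%:R * T * rho) <= 1 -> 0 < rho ->
  exists u, cauchy_on (cube q rho) u (2 * C) (2 * T) /\
    forall s, iter_partial s u q = U (rev s).
Proof.
move=> sU C0 T0 HU sm rho0.
have oV := @cube_open R n q rho.
have small y : cube q rho y -> 4 * (n%:R * T * `|y - q|) <= 1.
  move=> yr; apply: le_trans sm; rewrite ler_wpM2l // ler_wpM2l ?mulr_ge0 //.
  exact: ltW.
pose F N y := tpoly N U (y - q).
pose f y := lim (F ^~ y @ \oo).
have cF y : cube q rho y -> F ^~ y @ \oo --> f y.
  move=> yr; suff : cvg (F ^~ y @ \oo) by [].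
  have -> : F ^~ y = series (fun m => hpoly m U (y - q) / m`!%:R).
    by apply/funext => N; rewrite /F /tpoly /series /= big_mkord.
  apply: normed_cvg; apply: (@series_le_cvg _ _ (geometric C 2^-1)).
  - by move=> m; exact: normr_ge0.
  - by move=> m; rewrite /= mulr_ge0 // exprn_ge0 // invr_ge0.
  - move=> m; have := @taylor_term_le U C T [::] m (y - q) C0 T0 HU (small y yr).
    by rewrite /= fact0 expr0 !mulr1.
  - by apply: is_cvg_geometric_series; rewrite gtr0_norm ?invr_gt0 // invf_lt1 // ltr1n.
have bF N : cauchy_on (cube q rho) (F N) (2 * C) (2 * T).
  split.
  - have := @smooth_sum _ _ (cube q rho) _ (index_enum 'I_N) xpredT (fun m y => hpoly m U (y - q) / m`!%:R) oV.
    apply => m _; apply: (smoothM oV); last exact: smooth_cst.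
    apply: (@smooth_comp _ _ _ (cube q rho) setT (fun y => y - q) (hpoly m U)) => //.
    + exact: openT.
    + by move=> k; exact: smooth_center_coord.
    + by apply: smooth_hpoly; exact: openT.
  - exact: mulr_ge0.
  - exact: mulr_ge0.
  move=> s y yr; rewrite /F iter_partial_tpoly // /tpoly.
  apply: le_trans (ler_norm_sum _ _ _) _.
  apply: (@le_trans _ _ (\sum_(m < N - size s) C * (size s)`!%:R * (2 * T) ^+ size s * 2^-1 ^+ m)).
    by apply: ler_sum => m _; apply: taylor_term_le => //; exact: small.
  rewrite -mulr_sumr -[2 * C * _ * _]mulrA -[2 * C * _]mulrA [leRHS]mulrC.
  rewrite -[C * _ * _]mulrA ler_wpM2l ?half_sum_le // !mulr_ge0 // exprn_ge0 //.
  exact: mulr_ge0.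
have C20 : 0 <= 2 * C by exact: mulr_ge0.
have T20 : 0 <= 2 * T by exact: mulr_ge0.
have [bf cf] := limit_cauchy_on oV C20 T20 bF cF.
exists f; split => // s.
have cs := cf s q (cubexx q rho0).
apply: (cvg_unique _ cs) => //.
apply: (@cvg_trans _ (cst (U (rev s)) @ \oo)); last exact: cvg_cst.
apply: near_eq_cvg; exists (size s).+1 => // N /= sN.
rewrite /F iter_partial_tpoly // subrr -(subnSK sN) /tpoly big_ord_recl /=.
rewrite fact0 divr1 big1 ?addr0 // => m _.
by rewrite big1 ?mul0r // => c _; rewrite mxE mul0r.
Qed.

End power_series.

(** * Pfaffian systems with analytic coefficients *)

Section pfaffian_system.
Context {R : realType} {n : nat} {I : finType}.
Variable M : 'I_n -> I -> I -> 'rV[R]_n -> R.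
Implicit Types (u : I -> 'rV[R]_n -> R) (a x y q : 'rV[R]_n) (V W : set 'rV[R]_n)
  (s : seq 'I_n).

Definition solves V u := (forall i, smooth_on V (u i)) /\
  forall b i x, V x -> partial b (u i) x = \sum_j M b i j x * u j x.

Lemma solves_sub V W u : W `<=` V -> solves V u -> solves W u.
Proof.
move=> WV [su H]; split=> [i|b i x /WV]; first exact: smooth_sub (su i).
exact: H.
Qed.

Lemma solvesB V u v : open V -> solves V u -> solves V v ->
  solves V (fun i y => u i y - v i y).
Proof.
move=> oV [su Hu] [sv Hv]; split=> [i|b i x Vx]; first exact: smoothB.
rewrite partialD; [|exact: (su i [::] x Vx).2|exact/derivableN/(sv i [::] x Vx).2].
rewrite partialN; last exact: (sv i [::] x Vx).2.
rewrite Hu // Hv // -sumrB; apply: eq_bigr => j _.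
by rewrite mulrBr.
Qed.

(** The growth rate T depends on the system alone, and the constant D only on the
    value of u at x: one derivative costs a product with the coefficients M, whose
    effect on the constant, at most #|I| A, is absorbed by the new factor T. *)
Lemma solution_estimate V (A T D : R) u x : open V ->
  (forall b i j, cauchy_on V (M b i j) A T) -> #|I|%:R * A <= T ->
  solves V u -> V x -> (forall j, `|u j x| <= D) ->
  forall s i, `|iter_partial s (u i) x| <= D * (size s)`!%:R * T ^+ size s.
Proof.
move=> oV bM AT [su Hu] Vx uD s.
have [m] := ubnP (size s); elim: m s => // m IH s; rewrite ltnS => sm i.
have D0 : 0 <= D by apply: le_trans (uD i).
case/lastP: s sm => [|s b]; first by rewrite /= fact0 expr0 !mulr1.
rewrite size_rcons => sm.
have [_ A0 T0 _] := bM b i i.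
rewrite iter_partial_rcons (eq_iter_partial s oV (Hu b i) Vx).
rewrite (iter_partial_sum s _ oV _ Vx); last first.
  by move=> j; apply: (smoothM oV); [exact: cauchy_on_smooth (bM b i j)|exact: su].
apply: le_trans (ler_norm_sum _ _ _) _.
apply: (@le_trans _ _ (\sum_(j : I) A * D * (size s).+1`!%:R * T ^+ size s)).
  apply: ler_sum => j _; rewrite -bsum_fact.
  apply: (leibniz_le oV Vx (cauchy_on_smooth (bM b i j)) (su j)) => t w tw.
  apply: ler_pM => //; first by have [_ _ _] := bM b i j; exact.
  by apply: IH; apply: leq_trans sm; rewrite ltnS -tw leq_addl.
rewrite sumr_const -[leLHS]mulr_natl exprS.
have -> : #|I|%:R * (A * D * (size s).+1`!%:R * T ^+ size s) =
  D * (size s).+1`!%:R * (#|I|%:R * A * T ^+ size s) by ring.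
rewrite ler_wpM2l ?mulr_ge0 // ler_wpM2r // exprn_ge0 //.
Qed.

Lemma line_continuous x v : continuous (fun t : R => t *: v + x).
Proof.
move=> t; apply: (@continuousD _ _ _ (fun t : R => t *: v) (fun=> x)); last exact: cst_continuous.
exact: scalel_continuous.
Qed.

(** With D = 0 the estimate shows that all derivatives of u vanish at p, and with
    D = 1, on a cube where |u| <= 1, it provides the bounds needed to conclude that
    u vanishes. *)
Lemma solves_vanish_near a (r A L : R) u p :
  (forall b i j, cauchy_on (cube a r) (M b i j) A L) ->
  solves (cube a r) u -> cube a r p -> (forall i, u i p = 0) ->
  exists2 e : R, 0 < e & forall y, cube p e y -> forall i, u i y = 0.
Proof.
move=> bM su pr u0.
have [i0 _|noI] := pickP (fun i : I => true); last first.
  by exists 1 => // y _ i; have := noI i.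
have [b0 _|nob] := pickP (fun b : 'I_n => true); last first.
  exists 1; first exact: ltr01.
  move=> y _ k; have -> : y = p by apply/rowP => b; have := nob b.
  exact: u0.
have [_ A0 L0 _] := bM b0 i0 i0.
pose T := Num.max L (#|I|%:R * A).
have T0 : 0 <= T by rewrite le_max L0.
have bMT b i j : cauchy_on (cube a r) (M b i j) A T.
  by apply: cauchy_onW (bM b i j) => //; rewrite le_max lexx.
have AT : #|I|%:R * A <= T by rewrite le_max lexx orbT.
have [r1 r10 r1sub] := open_cube (@cube_open R n a r) pr.
have near1 : nbhs p (fun y => forall i, `|u i y| <= 1).
  apply: (@filter_forall _ _ _ (nbhs p)) => i.
  have /(@cvgrPdist_le _ _ _ (nbhs p) _) /(_ 1 ltr01) := smooth_continuous (su.1 i) pr.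
  by apply: filterS => y; rewrite u0 sub0r normrN.
have [r2 r20 r2sub] := (nbhs_ballP _ _).1 near1.
pose e := Num.min (Num.min r1 r2) (n%:R * T + 1)^-1.
have nT0 : 0 < n%:R * T + 1 by rewrite ltr_wpDl // mulr_ge0.
have e0 : 0 < e by rewrite !lt_min r10 r20 invr_gt0.
have sub1 : cube p e `<=` cube a r.
  by apply: subset_trans r1sub; apply: cube_le; rewrite !ge_min lexx.
have oV := @cube_open R n p e.
exists e => // y ye i.
have bu : cauchy_on (cube p e) (u i) 1 T.
  split=> //; first exact: smooth_sub sub1 (su.1 i).
  move=> s x xe.
  have bMe b k j : cauchy_on (cube p e) (M b k j) A T by apply: cauchy_on_sub (bMT b k j).
  apply: (solution_estimate oV bMe AT (solves_sub sub1 su) xe) => j.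
  apply: r2sub; rewrite -cubeE; apply: cube_le xe.
  by rewrite !ge_min lexx orbT.
apply: (taylor_vanish bu) => //.
  move=> s; apply/eqP; rewrite -normr_le0.
  have := @solution_estimate (cube a r) A T 0 u p (@cube_open _ _ _ _) bMT AT su pr.
  by move=> /(_ _ s i)/wrap[j|]; rewrite ?u0 ?normr0 // !mul0r.
have : `|y - p| < (n%:R * T + 1)^-1.
  by apply: lt_le_trans ye _; rewrite ge_min lexx orbT.
rewrite -[ltRHS]mul1r ltr_pdivlMr //; apply: le_lt_trans.
by rewrite mulrC ler_wpM2l // lerDl.
Qed.

Lemma solves_unique a (r A L : R) u v q :
  (forall b i j, cauchy_on (cube a r) (M b i j) A L) ->
  solves (cube a r) u -> solves (cube a r) v -> cube a r q ->
  (forall i, u i q = v i q) ->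
  forall x, cube a r x -> forall i, u i x = v i x.
Proof.
move=> bM su sv qr uv x xr.
have oV := @cube_open R n a r.
have sd := solvesB oV su sv.
set d := fun i y => _ in sd.
suff H : forall i, d i x = 0 by move=> i; apply/eqP; rewrite -subr_eq0; apply/eqP; exact: H.
pose gam (t : R) := t *: (x - q) + q.
have gam_open W : open W -> open (gam @^-1` W).
  by move/open_comp; apply => t _; exact: line_continuous.
have inV (t : R) : `[0, 1]%classic t -> cube a r (gam t).
  by rewrite /= in_itv /=; exact: cube_line.
have I0 : `[0, 1]%classic (0 : R) by rewrite /= in_itv /= lexx ler01.
have I1 : `[0, 1]%classic (1 : R) by rewrite /= in_itv /= lexx ler01.
have -> : x = gam 1 by rewrite /gam scale1r subrK.
apply: (connected_ind (P := fun t => forall i, d i (gam t) = 0) (@segment_connected R 0 1) I0 _ _ I1).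
  by move=> i; rewrite /gam scale0r add0r /d uv subrr.
move=> t /inV tr.
have [d0|] := pselect (forall i, d i (gam t) = 0).
  have [e e0 He] := solves_vanish_near bM sd tr d0.
  exists (gam @^-1` cube (gam t) e).
    by split; [apply: gam_open; exact: cube_open|exact: cubexx].
  by move=> y z _ ze _ _ _; exact: He.
move=> /existsNP[i /eqP di].
have near0 : nbhs (gam t) (fun y => d i y != 0).
  have di0 : 0 < `|d i (gam t)| by rewrite normr_gt0.
  have /(@cvgrPdist_lt _ _ _ (nbhs (gam t)) _) /(_ _ di0) := smooth_continuous (sd.1 i) tr.
  by apply: filterS => y; apply: contraTneq => ->; rewrite subr0 ltxx.
have [e e0 He] := (nbhs_ballP _ _).1 near0.
exists (gam @^-1` cube (gam t) e).
  by split; [apply: gam_open; exact: cube_open|exact: cubexx].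
move=> y z ye _ _ _ /(_ i) dy; have := He (gam y).
by rewrite -cubeE => /(_ ye) /=; rewrite dy eqxx.
Qed.

Lemma cauchy_at_common (J : finType) (F : J -> 'rV[R]_n -> R) a :
  (forall j, cauchy_at (F j) a) -> exists (r C L : R),
   [/\ 0 < r, 0 <= C, 0 <= L & forall j, cauchy_on (cube a r) (F j) C L].
Proof.
move=> H.
suff [r [C [L [r0 C0 L0 K]]]] : exists (r C L : R),
    [/\ 0 < r, 0 <= C, 0 <= L & forall j, j \in enum J -> cauchy_on (cube a r) (F j) C L].
  by exists r, C, L; split => // j; apply: K; rewrite mem_enum.
elim: (enum J) => [|j s [r [C [L [r0 C0 L0 K]]]]]; first by exists 1, 0, 0; split.
have [r' [C' [L' [r'0 K']]]] := H j.
exists (Num.min r r'), (Num.max C C'), (Num.max L L'); split.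
- by rewrite lt_min r0.
- by rewrite le_max C0.
- by rewrite le_max L0.
move=> k; rewrite inE => /orP[/eqP ->|/K Kk].
  apply: (@cauchy_onW _ _ _ _ C' L'); rewrite ?le_max ?lexx ?orbT //.
  by apply: cauchy_on_sub K'; apply: cube_le; rewrite ge_min lexx orbT.
apply: (@cauchy_onW _ _ _ _ C L); rewrite ?le_max ?lexx //.
by apply: cauchy_on_sub Kk; apply: cube_le; rewrite ge_min lexx.
Qed.

Lemma jet_product_zero V f g q : open V -> V q -> smooth_on V f -> smooth_on V g ->
  (forall s, iter_partial s g q = 0) ->
  forall s, iter_partial s (fun y => f y * g y) q = 0.
Proof.
move=> oV Vq sf sg g0 s; apply/eqP; rewrite -normr_le0.
apply: le_trans (leibniz_le (a := fun _ _ => 0) oV Vq sf sg _) _.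
  by move=> t w _; rewrite g0 normr0 mulr0.
suff -> : forall m, bsum m (fun _ _ => 0) = 0 :> R by [].
by elim=> //= m ->; rewrite addr0.
Qed.

(** The jet of u at q, summed as a Taylor series v, satisfies the system in the
    sense of jets at q.  Both sides of the system are functions with Cauchy
    estimates on a cube of fixed size, so [taylor_vanish] gives the system on the
    whole cube. *)
Lemma pfaff_extension a : (forall b i j, cauchy_at (M b i j) a) ->
  exists (r A L : R), [/\ 0 < r, forall b i j, cauchy_on (cube a r) (M b i j) A L &
    forall q V u, cube a r q -> open V -> V q -> solves V u ->
    exists2 v, solves (cube a r) v &
      exists W, [/\ open W, W q & forall x, W x -> forall i, v i x = u i x]].
Proof.
move=> HM.
have [r [A [L [r0 A0 L0 bM']]]] := @cauchy_at_common _ (fun z : 'I_n * I * I => M z.1.1 z.1.2 z.2) a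
  (fun z => HM z.1.1 z.1.2 z.2).
have bM b i j : cauchy_on (cube a r) (M b i j) A L by exact: (bM' (b, i, j)).
pose T := Num.max L (#|I|%:R * A).
have T0 : 0 <= T by rewrite le_max L0.
have bMT b i j : cauchy_on (cube a r) (M b i j) A T.
  by apply: cauchy_onW (bM b i j) => //; rewrite le_max lexx.
have AT : #|I|%:R * A <= T by rewrite le_max lexx orbT.
have nT0 : 0 < 5 * (n%:R * T) + 1 by rewrite ltr_wpDl // !mulr_ge0.
(* The Taylor series needs 4 n T rho0 <= 1, and the vanishing theorem, for a
   function of growth rate 4 T, needs 4 n T |x - q| < 1. *)
pose rho0 := Num.min (r / 2) (5 * (n%:R * T) + 1)^-1.
have rho00 : 0 < rho0 by rewrite lt_min divr_gt0 // invr_gt0.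
have small : 5 * (n%:R * T) * rho0 < 1.
  have : rho0 <= (5 * (n%:R * T) + 1)^-1 by rewrite ge_min lexx orbT.
  rewrite -[leRHS]mul1r ler_pdivlMr // => h.
  by move: (n%:R * T) h => z h; nra.
have small4 : 4 * (n%:R * T * rho0) <= 1.
  have : 0 <= n%:R * T * rho0 by rewrite !mulr_ge0 // ltW.
  by move: small; rewrite -mulrA; move: (n%:R * T * rho0) => z; lra.
have rho0r : rho0 <= r / 2 by rewrite ge_min lexx.
pose rho := rho0 / 2.
have rho_gt0 : 0 < rho by rewrite divr_gt0.
have rho_r : rho <= r by rewrite /rho; lra.
exists rho, A, L; split => //.
  by move=> b i j; apply: cauchy_on_sub (bM b i j); exact: cube_le.
move=> q V u qr oV Vq su.
have oQ := @cube_open R n q rho0.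
have Qa : cube q rho0 `<=` cube a r.
  apply: cube_sub; rewrite distrC.
  have : `|a - q| < rho by rewrite distrC.
  by rewrite /rho => h; move: (`|a - q|) h => z h; rewrite /rho in rho_r; lra.
have aQ : cube a rho `<=` cube q rho0.
  apply: cube_sub; move: qr; rewrite /cube /= distrC => h.
  by move: (`|a - q|) h => z h; rewrite /rho in h *; lra.
have Qq : cube q rho0 q by exact: cubexx.
have qa : cube a r q by exact: Qa.
pose VQ := V `&` cube q rho0.
have oVQ : open VQ by exact: openI.
have VQq : VQ q by [].
have suQ : solves VQ u by apply: solves_sub su => x [].
pose D := \sum_j `|u j q|.
have D0 : 0 <= D by apply: sumr_ge0.
have uD j : `|u j q| <= D by rewrite /D (bigD1 j) //= lerDl sumr_ge0.
have bMVQ b i j : cauchy_on VQ (M b i j) A T by apply: cauchy_on_sub (bMT b i j) => x [_ /Qa].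
have jet := solution_estimate oVQ bMVQ AT suQ VQq uD.
have /choice[v Hv] : forall i, exists v, cauchy_on (cube q rho0) v (2 * D) (2 * T) /\
    forall s, iter_partial s v q = iter_partial s (u i) q.
  move=> i.
  have [|w|v [bv jv]] := @taylor_realization _ _ (fun w => iter_partial (rev w) (u i) q)
      D T rho0 q _ D0 T0 _ small4 rho00.
  - move=> s1 b c s2; rewrite !rev_cat !rev_cons -!cats1 -!catA /=.
    exact: (iter_partial_swap _ _ _ _ oVQ (suQ.1 i) VQq).
  - by have := jet (rev w) i; rewrite size_rev.
  - by exists v; split => // s; rewrite jv revK.
have sv i : smooth_on (cube q rho0) (v i) by exact: cauchy_on_smooth (Hv i).1.
have sM b i j : smooth_on (cube q rho0) (M b i j).
  by apply: smooth_sub Qa _; exact: cauchy_on_smooth (bM b i j).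
have svQ i : smooth_on VQ (v i) by apply: smooth_sub (sv i) => x [].
have sMQ b i j : smooth_on VQ (M b i j) by apply: smooth_sub (sM b i j) => x [].
have solv : solves (cube q rho0) v.
  split => // b i x xQ.
  pose w y := partial b (v i) y - \sum_j M b i j y * v j y.
  have bMv j : cauchy_on (cube q rho0) (fun y => M b i j y * v j y) (A * (2 * D)) (2 * (2 * T)).
    apply: cauchy_onM => //; last exact: (Hv j).1.
    apply: (@cauchy_onW _ _ _ _ A T) => //; first by rewrite ler_peMl // ler1n.
    exact: cauchy_on_sub (bMT b i j).
  have C0 : 0 <= A * (2 * D) by rewrite !mulr_ge0.
  have T20 : 0 <= 2 * (2 * T) by rewrite !mulr_ge0.
  have bw := cauchy_onD oQ (cauchy_on_partial b (Hv i).1) (cauchy_onN oQ (cauchy_on_sum (index_enum I) oQ C0 T20 bMv)).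
  suff : w x = 0 by move/eqP; rewrite subr_eq0 => /eqP.
  apply: (taylor_vanish bw) => //.
    move=> s; rewrite -/w.
    pose dd j y := v j y - u j y.
    have sdd j : smooth_on VQ (dd j) by apply: smoothB => //; exact: suQ.1.
    have dd0 j t : iter_partial t (dd j) q = 0.
      rewrite (iter_partialD t oVQ (svQ j) (smoothN oVQ (suQ.1 j)) VQq).
      by rewrite (iter_partialN t oVQ (suQ.1 j) VQq) (Hv j).2 subrr.
    pose w1 y := \sum_j M b i j y * dd j y.
    have sw1 : smooth_on VQ w1.
      by apply: (smooth_sum _ oVQ) => j _; exact: smoothM.
    have E y : VQ y -> w y = partial b (dd i) y - w1 y.
      move=> Vy; rewrite /w /w1 /dd partialD; [|exact: (svQ i [::] y Vy).2|exact/derivableN/(suQ.1 i [::] y Vy).2].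
      rewrite partialN; last exact: (suQ.1 i [::] y Vy).2.
      rewrite suQ.2 // -addrA -opprD; congr (_ - _).
      by rewrite -big_split /=; apply: eq_bigr => j _; rewrite mulrBr addrC subrK.
    rewrite (eq_iter_partial s oVQ E VQq).
    have spd : smooth_on VQ (partial b (dd i)) by exact: smooth_partial.
    rewrite (iter_partialD s oVQ spd (smoothN oVQ sw1) VQq).
    rewrite (iter_partialN s oVQ sw1 VQq) -iter_partial_rcons dd0 sub0r.
    rewrite /w1 (iter_partial_sum s _ oVQ _ VQq); last by move=> j; exact: smoothM.
    rewrite big1 ?oppr0 // => j _.
    exact: (jet_product_zero oVQ VQq (sMQ b i j) (sdd j) (dd0 j)).
  have h : `|x - q| < rho0 by [].
  have : n%:R * T * `|x - q| <= n%:R * T * rho0.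
    by rewrite ler_wpM2l ?mulr_ge0 // ltW.
  have -> : n%:R * (2 * (2 * T)) * `|x - q| = 4 * (n%:R * T * `|x - q|) by ring.
  have : 0 <= n%:R * T * rho0 by rewrite !mulr_ge0 // ltW.
  move: small; rewrite -mulrA; clear.
  by move: (n%:R * T * _) (n%:R * T * _) => z z'; lra.
exists v; first exact: solves_sub solv.
have [e e0 eVQ] := open_cube oVQ VQq.
exists (cube q e); split; [exact: cube_open|exact: cubexx|].
apply: (@solves_unique q e A L v u q) => //.
- by move=> b i j; apply: cauchy_on_sub (bM b i j) => x /eVQ[_ /Qa].
- by apply: solves_sub solv => x /eVQ[].
- by apply: solves_sub suQ.
- exact: cubexx.
- by move=> i; exact: ((Hv i).2 [::]).
Qed.

End pfaffian_system.

(** * The Killing equation in one chart *)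

Section killing_in_coordinates.
Context {R : realType} {n : nat}.
Implicit Types (x q : 'rV[R]_n) (V W : set 'rV[R]_n).
Local Notation fn := ('rV[R]_n -> R).

Definition lie_coord (G : 'I_n -> 'I_n -> fn) (X : 'I_n -> fn) (a b : 'I_n) : fn := fun x =>
  \sum_k (X k x * partial k (G a b) x + partial a (X k) x * G k b x
     + partial b (X k) x * G a k x).

Definition killing_coord (G H : 'I_n -> 'I_n -> fn) V (X : 'I_n -> fn) :=
  (forall k, smooth_on V (X k)) /\ forall a b x, V x -> lie_coord G X a b x = H a b x.

(** Indices of the unknowns of the first-order system: the constant 1, which makes
    the system homogeneous, the components X^k, and the derivatives d_a X^k. *)
Definition jet_index : Type := (unit + ('I_n + 'I_n * 'I_n))%type.
HB.instance Definition _ := Finite.on jet_index.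

Definition i1 : jet_index := inl tt.
Definition iX (k : 'I_n) : jet_index := inr (inl k).
Definition iD (a k : 'I_n) : jet_index := inr (inr (a, k)).

Lemma sum_jet_index (F : jet_index -> R) :
  \sum_j F j = F i1 + (\sum_k F (iX k) + \sum_a \sum_k F (iD a k)).
Proof.
rewrite [LHS]big_sumType /=; congr (_ + _); first by rewrite (big_pred1 tt) // => -[].
rewrite big_sumType /=; congr (_ + _).
by rewrite pair_bigA /=; apply: eq_bigr => -[].
Qed.

Variables (G H Gi : 'I_n -> 'I_n -> fn) (U : set 'rV[R]_n).
Hypothesis oU : open U.
Hypothesis sG : forall a b, smooth_on U (G a b).
Hypothesis sH : forall a b, smooth_on U (H a b).
Hypothesis symG : forall a b x, U x -> G a b x = G b a x.
Hypothesis symH : forall a b x, U x -> H a b x = H b a x.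
Hypothesis GGi : forall k l x, U x -> \sum_b G k b x * Gi b l x = (k == l)%:R.
Hypothesis GiG : forall b c x, U x -> \sum_k Gi b k x * G k c x = (b == c)%:R.

(** Differentiating the Killing equation for (a, b) in the direction c gives
    T_{ca,b} + T_{cb,a} = P_{c,ab}, where T_{ca,b} = sum_k (d_c d_a X^k) g_kb and
    P_{c,ab} depends affinely on the 1-jet of X; these are its coefficients. *)
Definition Pcoef (c a b : 'I_n) (j : jet_index) : fn :=
  match j with
  | inl _ => partial c (H a b)
  | inr (inl l) => fun x => - partial c (partial l (G a b)) x
  | inr (inr (d, l)) => fun x =>
      - ((d == c)%:R * partial l (G a b) x + (d == a)%:R * partial c (G l b) x
         + (d == b)%:R * partial c (G a l) x)
  end.

Definition Pval c a b (u : jet_index -> R) x := \sum_j Pcoef c a b j x * u j.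

(** T_{ca,b} is symmetric in c and a, so that the three cyclic equations can be
    solved: 2 T_{ca,b} = P_{c,ab} + P_{a,bc} - P_{b,ca}.  Raising the index b gives
    the second derivatives d_c d_a X^k. *)
Definition Mcoef (c : 'I_n) (i j : jet_index) : fn :=
  match i with
  | inl _ => fun _ => 0
  | inr (inl k) => fun _ => (j == iD c k)%:R
  | inr (inr (a, k)) => fun x =>
     \sum_b (2^-1 * (Pcoef c a b j x + Pcoef a b c j x - Pcoef b c a j x)) * Gi b k x
  end.

Lemma PvalE c a b u x : Pval c a b u x =
  partial c (H a b) x * u i1 - \sum_l (u (iX l) * partial c (partial l (G a b)) x
   + u (iD c l) * partial l (G a b) x + u (iD a l) * partial c (G l b) x
   + u (iD b l) * partial c (G a l) x).
Proof.
have pick (d : 'I_n) (F : 'I_n -> R) : \sum_e (e == d)%:R * F e = F d.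
  rewrite (bigD1 d) //= eqxx mul1r big1 ?addr0 // => e /negbTE ->.
  by rewrite mul0r.
rewrite /Pval sum_jet_index /=; congr (_ + _).
rewrite [X in _ + X](_ : _ = - \sum_l (u (iD c l) * partial l (G a b) x
   + u (iD a l) * partial c (G l b) x + u (iD b l) * partial c (G a l) x)); last first.
  rewrite exchange_big /= -sumrN; apply: eq_bigr => l _.
  rewrite -(pick c (fun d => u (iD d l) * partial l (G a b) x)).
  rewrite -(pick a (fun d => u (iD d l) * partial c (G l b) x)).
  rewrite -(pick b (fun d => u (iD d l) * partial c (G a l) x)).
  by rewrite -!big_split -sumrN /=; apply: eq_bigr => d _; ring.
rewrite -[X in _ + X]sumrN -[RHS]sumrN -big_split /=; apply: eq_bigr => l _.
by ring.
Qed.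

Lemma Pval_sym c a b u x : U x -> Pval c a b u x = Pval c b a u x.
Proof.
move=> Ux; rewrite !PvalE.
have dG d e f : partial d (G e f) x = partial d (G f e) x.
  by apply: eq_partial Ux _ => // y Uy; exact: symG.
have dH : partial c (H a b) x = partial c (H b a) x.
  by apply: eq_partial Ux _ => // y Uy; exact: symH.
rewrite dH; congr (_ - _); apply: eq_bigr => l _.
have -> : partial c (partial l (G a b)) x = partial c (partial l (G b a)) x.
  apply: eq_partial Ux _ => // y Uy; apply: eq_partial Uy _ => // z Uz; exact: symG.
rewrite (dG l a b) (dG c l b) (dG c a l).
by rewrite addrAC.
Qed.

Definition defect (u : jet_index -> fn) a b : fn := fun x =>
  \sum_k (u (iX k) x * partial k (G a b) x + u (iD a k) x * G k b x
     + u (iD b k) x * G a k x) - H a b x.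

Lemma smooth_dG V i a b : V `<=` U -> smooth_on V (partial i (G a b)).
Proof. by move=> VU; apply: smooth_sub VU _; apply: smooth_partial. Qed.

Lemma smooth_defect V u a b : open V -> V `<=` U ->
  (forall j, smooth_on V (u j)) -> smooth_on V (defect u a b).
Proof.
move=> oV VU su; apply: (smoothB oV); last exact: smooth_sub VU (sH a b).
apply: (smooth_sum _ oV) => k _.
apply: (smoothD oV); last by apply: (smoothM oV) => //; exact: smooth_sub VU (sG _ _).
apply: (smoothD oV); last by apply: (smoothM oV) => //; exact: smooth_sub VU (sG _ _).
by apply: (smoothM oV) => //; exact: smooth_dG.
Qed.

(** The derivative of the defect is the left-hand side minus the right-hand side of
    the equation that defines P; it uses the system only for the first derivatives
    of the components of X. *)
Lemma partial_defect V u c a b x : open V -> V `<=` U -> V x ->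
  (forall j, smooth_on V (u j)) -> (forall y, V y -> u i1 y = 1) ->
  (forall k y, V y -> partial c (u (iX k)) y = u (iD c k) y) ->
  partial c (defect u a b) x =
  \sum_k (partial c (u (iD a k)) x * G k b x + partial c (u (iD b k)) x * G a k x)
  - Pval c a b (u ^~ x) x.
Proof.
move=> oV VU Vx su u1 uX; have Ux := VU x Vx.
have du j : derivable (u j) x (delta_mx 0 c) := (su j [::] x Vx).2 c.
have dG i j : derivable (G i j) x (delta_mx 0 c) := (sG i j [::] Ux).2 c.
have ddG l i j : derivable (partial l (G i j)) x (delta_mx 0 c) := (sG i j [:: l] Ux).2 c.
have dH : derivable (H a b) x (delta_mx 0 c) := (sH a b [::] Ux).2 c.
have dt1 k : derivable (fun y => u (iX k) y * partial k (G a b) y) x (delta_mx 0 c).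
  by apply: derivableM; [exact: du|exact: ddG].
have dt2 k : derivable (fun y => u (iD a k) y * G k b y) x (delta_mx 0 c).
  by apply: derivableM; [exact: du|exact: dG].
have dt3 k : derivable (fun y => u (iD b k) y * G a k y) x (delta_mx 0 c).
  by apply: derivableM; [exact: du|exact: dG].
have dt12 k : derivable (fun y => u (iX k) y * partial k (G a b) y + u (iD a k) y * G k b y) x (delta_mx 0 c).
  by apply: derivableD; [exact: dt1|exact: dt2].
have dt k : derivable (fun y => u (iX k) y * partial k (G a b) y + u (iD a k) y * G k b y
     + u (iD b k) y * G a k y) x (delta_mx 0 c).
  by apply: derivableD; [exact: dt12|exact: dt3].
rewrite /defect partialD; [|by apply: derivable_sum_fin => k _; exact: dt|exact/derivableN/dH].
rewrite partialN; last exact: dH.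
rewrite partial_sum; last by move=> k _; exact: dt.
rewrite PvalE u1 // mulr1 opprB [RHS]addrA -big_split /=; congr (_ - _).
apply: eq_bigr => k _.
rewrite partialD; [|exact: dt12|exact: dt3].
rewrite partialD; [|exact: dt1|exact: dt2].
rewrite partialM; [|exact: du|exact: ddG].
rewrite partialM; [|exact: du|exact: dG].
rewrite partialM; [|exact: du|exact: dG].
rewrite uX //.
move: (partial c (u (iD a k)) x) (partial c (u (iD b k)) x) => A B.
move: (partial c _ x) (partial c _ x) (partial c _ x) (partial k _ x) => C D E F.
by move: (u _ _) (u _ _) (u _ _) (u _ _) (G _ _ _) (G _ _ _) => *; ring.
Qed.

Definition prolong (X : 'I_n -> fn) (j : jet_index) : fn :=
  match j with
  | inl _ => fun _ => 1
  | inr (inl k) => X k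
  | inr (inr (a, k)) => partial a (X k)
  end.

Lemma killing_solves V X : open V -> V `<=` U -> killing_coord G H V X ->
  solves Mcoef V (prolong X).
Proof.
move=> oV VU [sX HX].
have su j : smooth_on V (prolong X j).
  case: j => [?|[k|[a k]]] /=; [exact: smooth_cst|exact: sX|exact: smooth_partial].
split=> // c [?|[k|[a k]]] x Vx /=.
- by rewrite partial_cst big1 // => j _; rewrite mul0r.
- rewrite (bigD1 (iD c k)) //= eqxx mul1r big1 ?addr0 // => j /negbTE ->.
  by rewrite mul0r.
have Ux := VU x Vx.
pose T (c a b : 'I_n) := \sum_k partial c (partial a (X k)) x * G k b x.
have Tsym d e f : T d e f = T e d f.
  by apply: eq_bigr => m _; rewrite (schwarz d e oV (sX m) Vx).
have key d e f : T d e f + T d f e = Pval d e f ((prolong X) ^~ x) x.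
  have def0 y : V y -> defect (prolong X) e f y = 0.
    by move=> Vy; rewrite /defect -(HX e f y Vy) subrr.
  have := @partial_defect V (prolong X) d e f x oV VU Vx su (fun _ _ => erefl) (fun _ _ _ => erefl).
  rewrite (eq_partial d oV Vx def0) partial_cst => /esym/eqP; rewrite subr_eq0 => /eqP <-.
  rewrite /T -big_split; apply: eq_bigr => m _ /=; congr (_ + _ * _).
  exact: symG.
have T2 d e f : T d e f = 2^-1 * (Pval d e f ((prolong X) ^~ x) x
    + Pval e f d ((prolong X) ^~ x) x - Pval f d e ((prolong X) ^~ x) x).
  rewrite -!key (Tsym e f d) (Tsym f d e) (Tsym e d f).
  by move: (T _ _ _) (T _ _ _) (T _ _ _) => *; field.
transitivity (\sum_b T c a b * Gi b k x).
  rewrite /T; under eq_bigr do rewrite mulr_suml.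
  rewrite exchange_big /= (bigD1 k) //= [X in _ + X]big1 ?addr0; last first.
    move=> m mk; under eq_bigr do rewrite -mulrA.
    by rewrite -mulr_sumr GGi // (negbTE mk) mulr0.
  by under eq_bigr do rewrite -mulrA; rewrite -mulr_sumr GGi // eqxx mulr1.
under [RHS]eq_bigr do rewrite mulr_suml.
rewrite exchange_big; apply: eq_bigr => b _ /=.
rewrite T2 /Pval -big_split -sumrB mulr_sumr mulr_suml; apply: eq_bigr => j _ /=.
by ring.
Qed.

(** By [partial_defect] and the definition of M, the gradient of the defect is
    zero, because P_{c,ab} is symmetric in a and b. *)
Lemma solves_killing (a : 'rV[R]_n) (r : R) (u : jet_index -> fn) q W :
  cube a r `<=` U -> solves Mcoef (cube a r) u ->
  cube a r q -> open W -> W q -> (forall y, W y -> u i1 y = 1) ->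
  (forall i j y, W y -> cube a r y -> defect u i j y = 0) ->
  killing_coord G H (cube a r) (fun k => u (iX k)).
Proof.
move=> VU [su Hu] qr oW Wq uW dW.
have oV := @cube_open R n a r.
have u1 y : cube a r y -> u i1 y = 1.
  move=> yr; rewrite -(uW q Wq); apply: (zero_gradient (su i1)) => // c x xr.
  by rewrite Hu // big1 // => j _; rewrite /= mul0r.
have uX c k y : cube a r y -> partial c (u (iX k)) y = u (iD c k) y.
  move=> yr; rewrite Hu // (bigD1 (iD c k)) //= eqxx mul1r big1 ?addr0 // => j /negbTE ->.
  by rewrite mul0r.
have T2 d e f x : cube a r x -> \sum_k partial d (u (iD e k)) x * G k f x =
    2^-1 * (Pval d e f (u ^~ x) x + Pval e f d (u ^~ x) x - Pval f d e (u ^~ x) x).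
  move=> xr; have Ux := VU x xr.
  pose Q b := 2^-1 * (Pval d e b (u ^~ x) x
     + Pval e b d (u ^~ x) x - Pval b d e (u ^~ x) x).
  have E k : partial d (u (iD e k)) x = \sum_b Q b * Gi b k x.
    rewrite Hu //; under eq_bigr do rewrite /Mcoef /= mulr_suml.
    rewrite exchange_big; apply: eq_bigr => b _ /=.
    rewrite /Q /Pval -big_split -sumrB mulr_sumr mulr_suml; apply: eq_bigr => j _ /=.
    by ring.
  rewrite -/(Q f); under eq_bigr do rewrite E mulr_suml.
  rewrite exchange_big /= (bigD1 f) //= [X in _ + X]big1 ?addr0; last first.
    move=> m mk; under eq_bigr do rewrite -mulrA.
    by rewrite -mulr_sumr GiG // (negbTE mk) mulr0.
  by under eq_bigr do rewrite -mulrA; rewrite -mulr_sumr GiG // eqxx mulr1.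
split=> [k|b c x xr]; first exact: su.
suff : defect u b c x = 0.
  move=> /eqP; rewrite subr_eq0 => /eqP <-; apply: eq_bigr => k _.
  by rewrite !uX.
transitivity (defect u b c q); last exact: dW Wq qr.
apply: (zero_gradient (@smooth_defect (cube a r) u b c oV VU su) _ xr qr) => d y yr.
have Uy := VU y yr.
rewrite (partial_defect b c oV VU yr su u1 (uX d)) big_split /= T2 //.
under [X in _ + X - _]eq_bigr do rewrite (symG _ _ Uy).
rewrite T2 // (@Pval_sym d c b) // (@Pval_sym b d c) // (@Pval_sym c b d) //.
by move: (Pval _ _ _ _ _) (Pval _ _ _ _ _) (Pval _ _ _ _ _) => *; field.
Qed.

Hypothesis HG : forall x a b, U x -> cauchy_at (G a b) x.
Hypothesis HH : forall x a b, U x -> cauchy_at (H a b) x.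
Hypothesis HGi : forall x a b, U x -> cauchy_at (Gi a b) x.

Lemma cauchy_at_Mcoef x c i j : U x -> cauchy_at (Mcoef c i j) x.
Proof.
move=> Ux.
have AP d e f : cauchy_at (Pcoef d e f j) x.
  case: j => [?|[k|[a k]]] /=.
  - by apply: cauchy_at_partial; exact: HH.
  - by apply: cauchy_atN; apply: cauchy_at_partial; apply: cauchy_at_partial; exact: HG.
  - apply: cauchy_atN; apply: cauchy_atD; [apply: cauchy_atD|];
    by apply: cauchy_atM; [exact: cauchy_at_cst|apply: cauchy_at_partial; exact: HG].
case: i => [?|[k|[a k]]] /=; [exact: cauchy_at_cst|exact: cauchy_at_cst|].
apply: cauchy_at_sum => b; apply: cauchy_atM; last exact: HGi.
apply: cauchy_atM; first exact: cauchy_at_cst.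
by apply: cauchy_atD; [apply: cauchy_atD|apply: cauchy_atN].
Qed.

Lemma killing_local_extension (a : 'rV[R]_n) : U a ->
  exists r : R, [/\ 0 < r, cube a r `<=` U,
   forall q V X, cube a r q -> open V -> V q -> killing_coord G H V X ->
    exists2 Y, killing_coord G H (cube a r) Y &
      exists W, [/\ open W, W q & forall x, W x -> forall k, Y k x = X k x] &
   forall q V X Y, cube a r q -> open V -> V q ->
     killing_coord G H (cube a r) X -> killing_coord G H (cube a r) Y ->
     (forall x, V x -> forall k, X k x = Y k x) ->
     forall x, cube a r x -> forall k, X k x = Y k x].
Proof.
move=> Ua; have [r0 r00 r0U] := open_cube oU Ua.
have [r1 [A [L [r10 bM ext]]]] := pfaff_extension (fun c i j => @cauchy_at_Mcoef a c i j Ua).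
pose r := Num.min r0 r1.
have r_gt0 : 0 < r by rewrite lt_min r00.
have rU : cube a r `<=` U by apply: subset_trans r0U; apply: cube_le; rewrite ge_min lexx.
have rr1 : cube a r `<=` cube a r1 by apply: cube_le; rewrite ge_min lexx orbT.
have oR := @cube_open R n a r.
exists r; split => //.
- move=> q V X qr oV Vq [sX HX].
  pose V' := V `&` cube a r.
  have oV' : open V' by exact: openI.
  have V'U : V' `<=` U by move=> x [_ /rU].
  have kX : killing_coord G H V' X.
    split=> [k|b c x [Vx _]]; last exact: HX.
    by apply: smooth_sub (sX k) => x [].
  have V'q : V' q by [].
  have [u su [W [oW Wq Wu]]] := ext q V' _ (rr1 _ qr) oV' V'q (killing_solves oV' V'U kX).
  have su' := solves_sub rr1 su.
  pose W' := W `&` V'.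
  have oW' : open W' by exact: openI.
  have W'q : W' q by [].
  exists (fun k => u (iX k)); last first.
    by exists W; split => // x Wx k; rewrite (Wu x Wx (iX k)).
  apply: (@solves_killing a r u q W' rU su' qr oW' W'q) => [y [Wy _]|i j y [Wy V'y] _].
    exact: (Wu y Wy i1).
  rewrite /defect -(HX i j y (V'y.1)) /lie_coord.
  by under eq_bigr do rewrite !(Wu y Wy) /=; rewrite subrr.
- move=> q V X Y qr oV Vq kX kY XY x xr k.
  have sX := killing_solves oR rU kX.
  have sY := killing_solves oR rU kY.
  have bM' b i j : cauchy_on (cube a r) (Mcoef b i j) A L by apply: cauchy_on_sub (bM b i j).
  apply: (solves_unique bM' sX sY qr _ xr (iX k)).
  move=> [?|[l|[b l]]] //=; first exact: XY.
  apply: eq_partial Vq _ => // y Vy; exact: XY.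
Qed.

End killing_in_coordinates.

(** * The Lie derivative under a change of coordinates *)

Section lie_pullback.
Context {R : realType} {n : nat}.
Local Notation fn := ('rV[R]_n -> R).

Lemma lie_coord_mx (G : 'I_n -> 'I_n -> fn) (X : 'I_n -> fn) (x : 'rV[R]_n) :
  \matrix_(a, b) lie_coord G X a b x =
   \sum_k X k x *: (\matrix_(a, b) partial k (G a b) x)
   + (\matrix_(a, k) partial a (X k) x) *m (\matrix_(a, b) G a b x)
   + (\matrix_(a, b) G a b x) *m (\matrix_(a, k) partial a (X k) x)^T.
Proof.
apply/matrixP => a b; rewrite !mxE summxE /lie_coord -!big_split /=.
apply: eq_bigr => k _; rewrite !mxE; congr (_ + _ + _).
by rewrite mulrC.
Qed.

(** In matrix form, with J the Jacobian of phi, A the derivative of X' and B that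
    of X, the derivative of the relation between X and X' reads
    J B = A J + (D_X' J), by symmetry of the second derivatives of phi.  The terms
    in D_X' J cancel against those coming from the derivative of J G J^T. *)
Lemma lie_pullback (V W : set 'rV[R]_n) (phi : 'rV[R]_n -> 'rV[R]_n)
    (G G' : 'I_n -> 'I_n -> fn) (X X' : 'I_n -> fn) :
  open V -> open W -> smooth_map V phi -> (forall z, V z -> W (phi z)) ->
  (forall k l, smooth_on W (G k l)) -> (forall k, smooth_on W (X k)) ->
  (forall k, smooth_on V (X' k)) ->
  let J a k := partial a (fun z => phi z 0 k) in
  (forall a b z, V z -> G' a b z = \sum_k \sum_l J a k z * G k l (phi z) * J b l z) ->
  (forall k z, V z -> X k (phi z) = \sum_c X' c z * J c k z) ->
  forall x, V x -> \matrix_(a, b) lie_coord G' X' a b x =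
    (\matrix_(a, k) J a k x) *m (\matrix_(a, b) lie_coord G X a b (phi x))
      *m (\matrix_(a, k) J a k x)^T.
Proof.
move=> oV oW sphi VW sG sX sX' J GG' XX' x Vx.
have Wy := VW x Vx.
have dphi : differentiable phi x by exact: smooth_map_diff sphi Vx.
pose Jm := \matrix_(a, k) J a k x.
pose D c := \matrix_(a, k) partial c (J a k) x.
pose gm := \matrix_(a, b) G a b (phi x).
pose dg m := \matrix_(a, b) partial m (G a b) (phi x).
pose A := \matrix_(a, k) partial a (X' k) x.
pose B := \matrix_(a, k) partial a (X k) (phi x).
have sJ a k : smooth_on V (J a k) by apply: smooth_partial; exact: sphi.
have dJ a k c : derivable (J a k) x (delta_mx 0 c) := (sJ a k [::] x Vx).2 c.
have sGp k l : smooth_on V (G k l \o phi) by exact: smooth_comp (sG k l).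
have dGp k l c : derivable (G k l \o phi) x (delta_mx 0 c) := (sGp k l [::] x Vx).2 c.
have dX' k c : derivable (X' k) x (delta_mx 0 c) := (sX' k [::] x Vx).2 c.
have pG k l c : partial c (G k l \o phi) x = \sum_m J c m x * partial m (G k l) (phi x).
  by rewrite partial_comp //; exact: smooth_diff (sG k l) Wy.
have pX k c : partial c (X k \o phi) x = \sum_m J c m x * partial m (X k) (phi x).
  by rewrite partial_comp //; exact: smooth_diff (sX k) Wy.
have E0 : \matrix_(a, b) G' a b x = Jm *m gm *m Jm^T.
  apply/matrixP => a b; rewrite !mxE GG' // exchange_big /=; apply: eq_bigr => l _.
  by rewrite !mxE mulr_suml; apply: eq_bigr => k _; rewrite !mxE.
have E1 c : \matrix_(a, b) partial c (G' a b) x =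
    D c *m gm *m Jm^T + Jm *m (\sum_m J c m x *: dg m) *m Jm^T + Jm *m gm *m (D c)^T.
  apply/matrixP => a b.
  have t1 k l : derivable (fun z => J a k z * (G k l \o phi) z) x (delta_mx 0 c).
    by apply: derivableM; [exact: dJ|exact: dGp].
  have t2 k l : derivable (fun z => J a k z * (G k l \o phi) z * J b l z) x (delta_mx 0 c).
    by apply: derivableM; [exact: t1|exact: dJ].
  have t3 k : derivable (fun z => \sum_l J a k z * (G k l \o phi) z * J b l z) x (delta_mx 0 c).
    by apply: derivable_sum_fin => l _; exact: t2.
  rewrite mxE (eq_partial c oV Vx (GG' a b)).
  rewrite (@partial_sum _ _ _ _ (fun k z => \sum_l J a k z * (G k l \o phi) z * J b l z)); last first.
    by move=> k _; exact: t3.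
  transitivity (\sum_k \sum_l (partial c (J a k) x * G k l (phi x) * J b l x
     + J a k x * (\sum_m J c m x * partial m (G k l) (phi x)) * J b l x
     + J a k x * G k l (phi x) * partial c (J b l) x)).
    apply: eq_bigr => k _.
    rewrite (@partial_sum _ _ _ _ (fun l z => J a k z * (G k l \o phi) z * J b l z)); last first.
      by move=> l _; exact: t2.
    apply: eq_bigr => l _.
    rewrite partialM; [|exact: t1|exact: dJ].
    rewrite partialM; [|exact: dJ|exact: dGp].
    by rewrite pG mulrDl.
  rewrite exchange_big !mxE -!big_split /=; apply: eq_bigr => l _; rewrite !mxE !mulr_suml -!big_split /=.
  apply: eq_bigr => k _; rewrite !mxE; congr (_ + _ * _ + _).
  by rewrite summxE; congr (_ * _); apply: eq_bigr => m _; rewrite !mxE.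
have Dsym a c k : partial a (J c k) x = partial c (J a k) x.
  exact: (schwarz a c oV (sphi k) Vx).
have R1 : Jm *m B = A *m Jm + \sum_c X' c x *: D c.
  apply/matrixP => a k; rewrite !mxE summxE.
  transitivity (partial a (X k \o phi) x).
    by rewrite pX; apply: eq_bigr => m _; rewrite !mxE.
  rewrite (eq_partial a oV Vx (XX' k)) partial_sum; last first.
    by move=> c _; apply: derivableM; [exact: dX'|exact: dJ].
  rewrite -big_split /=; apply: eq_bigr => c _.
  rewrite partialM; [|exact: dX'|exact: dJ].
  by rewrite !mxE Dsym.
rewrite !lie_coord_mx -/Jm -/gm -/A -/B E0.
under eq_bigr do rewrite E1 !scalerDr.
rewrite !big_split /=.
have S1 : \sum_c X' c x *: (D c *m gm *m Jm^T) = (\sum_c X' c x *: D c) *m gm *m Jm^T.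
  by rewrite !mulmx_suml; apply: eq_bigr => c _; rewrite -!scalemxAl.
have S3 : \sum_c X' c x *: (Jm *m gm *m (D c)^T) = Jm *m gm *m (\sum_c X' c x *: D c)^T.
  rewrite linear_sum mulmx_sumr; apply: eq_bigr => c _.
  by rewrite linearZ /= -scalemxAr.
have S2 : \sum_c X' c x *: (Jm *m (\sum_m J c m x *: dg m) *m Jm^T) =
    Jm *m (\sum_k X k (phi x) *: dg k) *m Jm^T.
  transitivity (Jm *m (\sum_c X' c x *: (\sum_m J c m x *: dg m)) *m Jm^T).
    rewrite mulmx_sumr mulmx_suml; apply: eq_bigr => c _.
    by rewrite -scalemxAr -scalemxAl.
  congr (_ *m _ *m _); under eq_bigr do rewrite scaler_sumr.
  rewrite exchange_big /=; apply: eq_bigr => k _.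
  by rewrite XX' // scaler_suml; apply: eq_bigr => c _; rewrite scalerA.
rewrite S1 S2 S3.
rewrite !mulmxDr !mulmxDl.
have -> : Jm *m (B *m gm) *m Jm^T = (Jm *m B) *m gm *m Jm^T by rewrite !mulmxA.
have -> : Jm *m (gm *m B^T) *m Jm^T = Jm *m gm *m (Jm *m B)^T by rewrite trmx_mul !mulmxA.
rewrite R1 linearD /= trmx_mul !mulmxDl mulmxDr !mulmxA.
have reorder (p q r s t : 'M[R]_n) : p + q + r + s + t = q + (s + p) + (t + r).
  by rewrite [p + q]addrC [s + p]addrC -!addrA [r + (s + t)]addrCA [r + t]addrC.
exact: reorder.
Qed.

End lie_pullback.

(** * Charts *)

Section charts.
Context {R : realType} {n : nat} {U : topologicalType}.

Lemma chart_invK (c : chart R n U) x : (chart_map c @` chart_dom c) x ->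
  chart_dom c (chart_inv c x) /\ chart_map c (chart_inv c x) = x.
Proof. by move=> [p cp <-]; rewrite chart_mapK. Qed.

Lemma chart_image_open (c : chart R n U) (W : set U) : open W ->
  open (chart_map c @` (chart_dom c `&` W)).
Proof.
move=> oW.
have -> : chart_map c @` (chart_dom c `&` W) =
    (chart_map c @` chart_dom c) `&` (chart_inv c @^-1` W).
  apply/seteqP; split=> x.
    by move=> [p [cp Wp] <-]; split; [exists p|rewrite /= chart_mapK].
  move=> [xi Wx]; have [ci E] := chart_invK xi.
  by exists (chart_inv c x).
have := @chart_inv_continuous _ _ _ c.
rewrite (continuous_open_subspace _ (@chart_map_open _ _ _ c)) => ci.
rewrite openE => x [xi Wx]; apply: filterI.
  by apply: open_nbhs_nbhs; split => //; exact: chart_map_open.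
by apply: (ci x (mem_set xi)); apply: open_nbhs_nbhs.
Qed.

Lemma chart_preimage_open (c : chart R n U) (B : set 'rV[R]_n) : open B ->
  open (chart_dom c `&` chart_map c @^-1` B).
Proof.
move=> oB; have := @chart_map_continuous _ _ _ c.
rewrite (continuous_open_subspace _ (@chart_dom_open _ _ _ c)) => cc.
rewrite openE => p [pd Bp]; apply: filterI.
  by apply: open_nbhs_nbhs; split => //; exact: chart_dom_open.
by apply: (cc p (mem_set pd)); apply: open_nbhs_nbhs.
Qed.

Lemma chart_inv_cont_at (c : chart R n U) x : (chart_map c @` chart_dom c) x ->
  {for x, continuous (chart_inv c)}.
Proof.
have := @chart_inv_continuous _ _ _ c.
rewrite (continuous_open_subspace _ (@chart_map_open _ _ _ c)) => ci xi.
by apply: ci; exact: mem_set.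
Qed.

Variable A : analytic_atlas R n U.
Local Notation I := (atlas_index A).
Local Notation dom i := (chart_dom (A i)).
Local Notation map i := (chart_map (A i)).
Local Notation inv i := (chart_inv (A i)).
Local Notation tau i j := (transition (A i) (A j)).

Definition overlap (i j : I) : set 'rV[R]_n := map i @` (dom i `&` dom j).

Lemma overlap_open i j : open (overlap i j).
Proof. by apply: chart_image_open; exact: chart_dom_open. Qed.

Arguments overlap_open : clear implicits.

Lemma tau_map i j p : dom i p -> tau i j (map i p) = map j p.
Proof. by move=> pi; rewrite /transition /= chart_mapK. Qed.

Lemma cauchy_at_smooth (V : set 'rV[R]_n) f : (forall a, V a -> cauchy_at f a) -> smooth_on V f.
Proof.
move=> H; apply: smooth_local => a /H[r [C [L [r0 B]]]].
by exists (cube a r); split; [exact: cube_open|exact: cubexx|exact: cauchy_on_smooth B].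
Qed.

Lemma analytic_smooth (V : set 'rV[R]_n) f : analytic_on V f -> smooth_on V f.
Proof. by move=> H; apply: cauchy_at_smooth => a /H; exact: analytic_cauchy_at. Qed.

Lemma smooth_tau i j : smooth_map (overlap i j) (tau i j).
Proof. by move=> k; apply: analytic_smooth; exact: atlas_compatible. Qed.

Lemma jacE i j p a k : dom i p -> dom j p ->
  jac i j p a k = partial a (fun z => tau i j z 0 k) (map i p).
Proof.
move=> pi pj; rewrite /jac jacobianE //.
apply: (smooth_map_diff (overlap_open i j) (@smooth_tau i j)).
by exists p.
Qed.

(** A locked copy of the Jacobian: unification could otherwise unfold it down to
    differentials. *)
Definition jacm := locked (@jac R n U A).

Lemma jac_jacm : @jac R n U A = jacm. Proof. by rewrite /jacm -lock. Qed.

Lemma jacmE i j p a k : dom i p -> dom j p ->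
  jacm i j p a k = partial a (fun z => tau i j z 0 k) (map i p).
Proof. by rewrite -jac_jacm; exact: jacE. Qed.

Lemma tau_comp i j k x : (map i @` (dom i `&` (dom j `&` dom k))) x ->
  tau i k x = tau j k (tau i j x).
Proof.
move=> [p [pi [pj pk]] <-].
rewrite (tau_map k pi).
rewrite (tau_map j pi).
by rewrite (tau_map k pj).
Qed.

(** The chain rule for the transition maps. *)
Lemma jac_cocycle i j k p : dom i p -> dom j p -> dom k p ->
  jacm i k p = jacm i j p *m jacm j k p.
Proof.
move=> pi pj pk.
apply/matrixP => a b.
rewrite (jacmE a b pi pk).
rewrite [RHS]mxE.
pose V := map i @` (dom i `&` (dom j `&` dom k)).
have oV : open V by apply: chart_image_open; apply: openI; exact: chart_dom_open.
have Vp : V (map i p) by exists p.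
have E z : V z -> tau i k z 0 b = ((fun y => tau j k y 0 b) \o tau i j) z.
  by move=> Vz; rewrite (tau_comp Vz).
rewrite (eq_partial a oV Vp E) partial_comp.
- apply: eq_bigr => c _.
  by rewrite (jacmE a c pi pj) (jacmE c b pj pk) (tau_map j pi).
- by apply: (smooth_map_diff (overlap_open i j) (@smooth_tau i j)); exists p.
- rewrite (tau_map j pi); apply: (smooth_diff (overlap_open j k) (@smooth_tau j k b)).
  by exists p.
Qed.

Lemma jac_refl i p : dom i p -> jacm i i p = 1%:M.
Proof.
move=> pi; apply/matrixP => a b; rewrite (jacmE a b pi pi) mxE.
have Vp : overlap i i (map i p) by exists p.
have E z : overlap i i z -> tau i i z 0 b = z 0 b.
  by move=> [q [qi _] <-]; rewrite (tau_map i qi).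
by rewrite (eq_partial a (overlap_open i i) Vp E) partial_coord eq_sym.
Qed.

Definition field_of_chart (i : I) (Y : 'I_n -> 'rV[R]_n -> R) (j : I) (p : U) : 'rV[R]_n :=
  (\row_k Y k (map i p)) *m jacm i j p.

Definition gcomp (g : I -> U -> 'M[R]_n) i (a b : 'I_n) (y : 'rV[R]_n) : R :=
  g i (inv i y) a b.

Definition xcomp (X : I -> U -> 'rV[R]_n) i (k : 'I_n) (y : 'rV[R]_n) : R :=
  X i (inv i y) 0 k.

Lemma lie_derivativeE X g i p :
  lie_derivative X g i p = \matrix_(a, b) lie_coord (gcomp g i) (xcomp X i) a b (map i p).
Proof. by apply/matrixP => a b; rewrite !mxE. Qed.

Variables (g h : I -> U -> 'M[R]_n).
Hypothesis tg : tensor02 g.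
Hypothesis th : tensor02 h.
Hypothesis ag : analytic_tensor g.

Lemma smooth_gcomp i a b : smooth_on (map i @` dom i) (gcomp g i a b).
Proof. by apply: analytic_smooth; exact: ag. Qed.

Lemma killing_in_chart (V : set U) X i : killing_field g h V X ->
  killing_coord (gcomp g i) (gcomp h i) (map i @` (dom i `&` V)) (xcomp X i).
Proof.
move=> [[_ sX] HX]; split=> [k|a b x [p [pi Vp] <-]]; first exact: sX.
have := HX i p Vp pi; rewrite lie_derivativeE => /matrixP /(_ a b).
by rewrite mxE => ->; rewrite /gcomp chart_mapK.
Qed.

(** The other components are obtained by multiplication with the Jacobians.  They
    are smooth because transition maps are, and they solve the equation in every
    chart because both sides of it are tensors. *)
Lemma killing_of_chart i (W : set U) Y : open W -> W `<=` dom i ->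
  killing_coord (gcomp g i) (gcomp h i) (map i @` W) Y ->
  killing_field g h W (field_of_chart i Y).
Proof.
move=> oW Wi [sY HY].
have oWi : open (map i @` W).
  by rewrite (_ : W = dom i `&` W); [exact: chart_image_open|rewrite setIC; apply/esym/setIidl].
have compE j k z : (map j @` (dom j `&` W)) z ->
    field_of_chart i Y j (inv j z) 0 k =
    ((fun y => \sum_l Y l y * partial l (fun z => tau i j z 0 k) y) \o tau j i) z.
  move=> [p [pj Wp] <-]; rewrite chart_mapK // /field_of_chart mxE /=.
  rewrite (tau_map i pj); apply: eq_bigr => l _; rewrite mxE.
  by rewrite (jacmE l k (Wi p Wp) pj).
have oj j : open (map j @` (dom j `&` W)) by exact: chart_image_open.
have sub j : map j @` (dom j `&` W) `<=` overlap j i.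
  by move=> z [p [pj Wp] <-]; exists p => //; split => //; exact: Wi.
have stau j : smooth_map (map j @` (dom j `&` W)) (tau j i).
  by move=> k; apply: smooth_sub (@sub j) _; exact: smooth_tau.
have tauW j z : (map j @` (dom j `&` W)) z -> (map i @` (W `&` dom j)) (tau j i z).
  by move=> [p [pj Wp] <-]; exists p; [split|rewrite (tau_map i pj)].
have oWij j : open (map i @` (W `&` dom j)).
  have -> : W `&` dom j = dom i `&` (W `&` dom j).
    by apply/seteqP; split=> p; [move=> [Wp pj]; split => //; exact: Wi|move=> []].
  by apply: chart_image_open; apply: openI => //; exact: chart_dom_open.
have sX j k : smooth_on (map j @` (dom j `&` W)) (xcomp (field_of_chart i Y) j k).
  apply: (@eq_smooth _ _ _ ((fun y => \sum_l Y l y * partial l (fun z => tau i j z 0 k) y) \o tau j i)) => //.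
    by move=> z Vz; apply/esym; exact: compE Vz.
  apply: (smooth_comp (oj j) (oWij j) (stau j) (@tauW j)).
  apply: (smooth_sum _ (oWij j)) => l _; apply: (smoothM (oWij j)).
    by apply: smooth_sub (sY l) => z [p [Wp _] <-]; exists p.
  apply: smooth_partial; apply: smooth_sub _ (@smooth_tau i j k).
  by move=> z [p [Wp pj] <-]; exists p => //; split => //; exact: Wi.
split; first split.
- move=> j k p Wp pj pk; rewrite jac_jacm /field_of_chart -mulmxA.
  by rewrite -(jac_cocycle (Wi p Wp) pj pk).
- by move=> j k; exact: sX.
move=> j p Wp pj.
have pi := Wi p Wp.
pose V := map j @` (dom j `&` W).
have Vx : V (map j p) by exists p.
have VW z : V z -> (map i @` W) (tau j i z) by move=> /tauW[q [Wq _] <-]; exists q.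
have sG k l : smooth_on (map i @` W) (gcomp g i k l).
  by apply: smooth_sub (@smooth_gcomp i k l) => z [q Wq <-]; exists q => //; exact: Wi.
have T1 a b z : V z -> gcomp g j a b z = \sum_k \sum_l
    partial a (fun z => tau j i z 0 k) z * gcomp g i k l (tau j i z) * partial b (fun z => tau j i z 0 l) z.
  move=> [q [qj Wq] <-]; have qi := Wi q Wq.
  rewrite /gcomp (tau_map i qj) (chart_mapK qj) (chart_mapK qi) (tg qj qi) jac_jacm.
  rewrite [LHS]mxE exchange_big /=.
  apply: eq_bigr => l _; rewrite mxE mulr_suml; apply: eq_bigr => k _.
  by rewrite [(_^T) _ _]mxE (jacmE a k qj qi) (jacmE b l qj qi).
have T2 k z : V z -> Y k (tau j i z) =
    \sum_c xcomp (field_of_chart i Y) j c z * partial c (fun z => tau j i z 0 k) z.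
  move=> [q [qj Wq] <-]; have qi := Wi q Wq.
  rewrite (tau_map i qj).
  transitivity ((field_of_chart i Y j q *m jacm j i q) 0 k).
    by rewrite /field_of_chart -mulmxA -(jac_cocycle qi qj qi) (jac_refl qi) mulmx1 mxE.
  rewrite mxE; apply: eq_bigr => c _.
  by rewrite /xcomp (chart_mapK qj) (jacmE c k qj qi).
have P := lie_pullback (oj j) oWi (stau j) VW sG sY (sX j) T1 T2 Vx.
rewrite lie_derivativeE P (th pj pi) jac_jacm.
have Jm : \matrix_(a, k) partial a (fun z => tau j i z 0 k) (map j p) = jacm j i p.
  by apply/matrixP => a k; rewrite mxE (jacmE a k pj pi).
rewrite Jm; congr (_ *m _ *m _); apply/matrixP => a b.
rewrite mxE (tau_map i pj) HY; last by exists p.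
by rewrite /gcomp (chart_mapK pi).
Qed.

Lemma killing_sub (V W : set U) X : W `<=` V ->
  killing_field g h V X -> killing_field g h W X.
Proof.
move=> WV [[tX sX] HX]; split; first split.
- by move=> i j p /WV; exact: tX.
- move=> i k; apply: smooth_sub (sX i k) => z [p [pi Wp] <-].
  by exists p => //; split => //; exact: WV.
by move=> i p /WV; exact: HX.
Qed.

Lemma killing_local (X : I -> U -> 'rV[R]_n) :
  (forall p, exists V Y, [/\ open V, V p, killing_field g h V Y & eq_field_on V X Y]) ->
  killing_field g h setT X.
Proof.
move=> H.
have key i k V Y : open V -> eq_field_on V X Y ->
    forall z, (map i @` (dom i `&` V)) z -> xcomp Y i k z = xcomp X i k z.
  by move=> oV XY z [p [pi Vp] <-]; rewrite /xcomp chart_mapK // XY.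
split; first split.
- move=> i j p _ pi pj; have [V [Y [oV Vp [[tY _] _] XY]]] := H p.
  by rewrite !XY //; exact: tY.
- move=> i k; apply: smooth_local => z [p [pi _] <-].
  have [V [Y [oV Vp [[_ sY] _] XY]]] := H p.
  exists (map i @` (dom i `&` V)); split; [exact: chart_image_open|by exists p|].
  apply: eq_smooth (sY i k); first exact: chart_image_open.
  exact: key.
move=> i p _ pi; have [V [Y [oV Vp [[_ _] HY] XY]]] := H p.
rewrite -(HY i p Vp pi) !lie_derivativeE; apply/matrixP => a b; rewrite !mxE.
have oV' : open (map i @` (dom i `&` V)) by exact: chart_image_open.
have V'p : (map i @` (dom i `&` V)) (map i p) by exists p.
rewrite /lie_coord; apply: eq_bigr => k _.
have E := key i k V Y oV XY.
by rewrite -(eq_partial a oV' V'p E) -(eq_partial b oV' V'p E) -(E _ V'p).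
Qed.

Lemma eq_field_chart (V W : set U) X Y i : killing_field g h V X -> killing_field g h V Y ->
  W `<=` V -> W `<=` dom i -> (forall p, W p -> X i p = Y i p) -> eq_field_on W X Y.
Proof.
move=> [[tX _] _] [[tY _] _] WV Wi XY j p Wp pj.
have Vp := WV p Wp; have pi := Wi p Wp.
by rewrite (tX i j p) // (tY i j p) // XY.
Qed.

End charts.

(** * Continuation of germs along paths *)

Section paths.
Context {R : realType} {U : topologicalType}.
Implicit Types (gam : R -> U) (J : set R).

(** Phrased with open sets and distances between parameters, so that it restricts
    to any interval of parameters without changing the topology of J. *)
Definition cont_on J gam := forall t V, J t -> open V -> V (gam t) ->
  exists2 e : R, 0 < e & forall s, J s -> `|s - t| < e -> V (gam s).

Lemma within_cont_on J gam : {within J, continuous gam} <-> cont_on J gam.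
Proof.
split=> [c t V Jt oV Vt|c].
  have := c t V (open_nbhs_nbhs (conj oV Vt)).
  rewrite /nbhs /= -nbhs_subspace_in // => /nbhs_ballP[e e0 H].
  exists e => // s Js st; apply: (H s) => //.
  by rewrite -ball_normE /= distrC.
apply/subspace_continuousP => t Jt V.
rewrite nbhsE => -[Q [oQ Qt] QV].
have [e e0 H] := c t Q Jt oQ Qt.
apply/nbhs_ballP; exists e => // s; rewrite -ball_normE /= => st Js.
by apply: QV; apply: H => //; rewrite distrC.
Qed.

Lemma cont_on_sub J J' gam : J' `<=` J -> cont_on J gam -> cont_on J' gam.
Proof.
move=> JJ c t V J't oV Vt; have [e e0 H] := c t V (JJ t J't) oV Vt.
by exists e => // s /JJ; exact: H.
Qed.

Lemma connected_near (t : R) (e : R) : connected [set s : R | 0 <= s <= 1 /\ `|s - t| < e].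
Proof.
apply/connected_intervalP => x y [/andP[x0 x1] xt] [/andP[y0 y1] yt] z /andP[xz zy].
split; first by rewrite (le_trans x0 xz) (le_trans zy y1).
move: xt yt; rewrite !ltr_norml => /andP[a b] /andP[c d].
by apply/andP; split; [apply: lt_le_trans a _; rewrite lerD2r|apply: le_lt_trans d; rewrite lerD2r].
Qed.

Lemma connected_segment (a b : R) : connected [set s : R | a <= s <= b].
Proof.
apply/connected_intervalP => x y /andP[x0 x1] /andP[y0 y1] z /andP[xz zy].
by rewrite /= (le_trans x0 xz) (le_trans zy y1).
Qed.

Definition I01 : set R := [set t | 0 <= t <= 1].

Definition concat gam del : R -> U := fun t =>
  if t <= 2^-1 then gam (2 * t) else del (2 * t - 1).

Lemma concat_cont gam del : cont_on I01 gam -> cont_on I01 del -> gam 1 = del 0 ->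
  cont_on I01 (concat gam del).
Proof.
move=> cg cd E t V /andP[t0 t1] oV.
have h2 : (2 : R) * 2^-1 = 1 by rewrite mulfV.
have [tlt|tgt|tE] := ltgtP t 2^-1; rewrite /concat.
- rewrite (ltW tlt) => Vt.
  have J2 : I01 (2 * t) by rewrite /I01 /=; lra.
  have [e e0 H] := cg (2 * t) V J2 oV Vt.
  exists (Num.min (2^-1 - t) (e / 2)); first by rewrite lt_min subr_gt0 tlt divr_gt0.
  move=> s /andP[s0 s1]; rewrite lt_min !ltr_norml => /andP[/andP[a b] /andP[c d]].
  have sl : s <= 2^-1 by lra.
  rewrite sl; apply: H; first by rewrite /I01 /=; lra.
  by rewrite ltr_norml; lra.
- rewrite leNgt tgt /= => Vt.
  have J2 : I01 (2 * t - 1) by rewrite /I01 /=; lra.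
  have [e e0 H] := cd (2 * t - 1) V J2 oV Vt.
  exists (Num.min (t - 2^-1) (e / 2)); first by rewrite lt_min subr_gt0 tgt divr_gt0.
  move=> s /andP[s0 s1]; rewrite lt_min !ltr_norml => /andP[/andP[a b] /andP[c d]].
  have sl : 2^-1 < s by lra.
  rewrite leNgt sl /=; apply: H; first by rewrite /I01 /=; lra.
  by rewrite ltr_norml; lra.
rewrite tE lexx h2 => Vt.
have J1 : I01 1 by rewrite /I01 /= ler01 lexx.
have J0 : I01 0 by rewrite /I01 /= ler01 lexx.
have [e e0 H] := cg 1 V J1 oV Vt.
have Vd : V (del 0) by rewrite -E.
have [e' e'0 H'] := cd 0 V J0 oV Vd.
exists (Num.min (e / 2) (e' / 2)); first by rewrite lt_min !divr_gt0.
move=> s /andP[s0 s1]; rewrite lt_min !ltr_norml => /andP[/andP[a b] /andP[c d]].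
have [sl|sl] := leP s 2^-1.
  by apply: H; [rewrite /I01 /=; lra|rewrite ltr_norml; lra].
by apply: H'; [rewrite /I01 /=; lra|rewrite ltr_norml; lra].
Qed.

Lemma reparam_cont J J' gam (a b : R) : cont_on J gam ->
  (forall t, J' t -> J (a * t + b)) -> cont_on J' (fun t => gam (a * t + b)).
Proof.
move=> c JJ t V J't oV Vt; have [e e0 H] := c _ V (JJ t J't) oV Vt.
have a0 : 0 < `|a| + 1 by rewrite ltr_wpDl.
exists (e / (`|a| + 1)); first by rewrite divr_gt0.
move=> s J's st; apply: H; first exact: JJ.
have -> : a * s + b - (a * t + b) = a * (s - t) by ring.
rewrite normrM; rewrite ltr_pdivlMr // in st; apply: le_lt_trans st.
by rewrite mulrC ler_wpM2l // lerDl.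
Qed.

End paths.

Section continuation.
Context {R : realType} {U : topologicalType} {F : Type}.
Variables (K : set U -> F -> Prop) (E : set U -> F -> F -> Prop).
Hypothesis K_sub : forall V W X, W `<=` V -> K V X -> K W X.
Hypothesis E_sub : forall V W X Y, W `<=` V -> E V X Y -> E W X Y.
Hypothesis E_refl : forall V X, E V X X.
Hypothesis E_sym : forall V X Y, E V X Y -> E V Y X.
Hypothesis E_trans : forall V X Y Z, E V X Y -> E V Y Z -> E V X Z.
Implicit Types (p q : U) (X Y : F) (gam : R -> U) (Z : R -> F) (J : set R) (V W : set U).

Definition sol_at p X := exists V, [/\ open V, V p & K V X].
Definition germ_eq p X Y := exists V, [/\ open V, V p & E V X Y].

Lemma germ_refl p X : germ_eq p X X.
Proof. by exists setT; split => //; exact: openT. Qed.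

Lemma germ_sym p X Y : germ_eq p X Y -> germ_eq p Y X.
Proof. by move=> [V [oV Vp EV]]; exists V; split => //; exact: E_sym. Qed.

Lemma germ_trans p X Y (T : F) : germ_eq p X Y -> germ_eq p Y T -> germ_eq p X T.
Proof.
move=> [V1 [oV1 V1p E1]] [V2 [oV2 V2p E2]]; exists (V1 `&` V2); split => //.
  exact: openI.
by apply: (@E_trans _ _ Y); [apply: E_sub E1|apply: E_sub E2] => x [].
Qed.

(** On such a W, a germ of a solution at any point extends to exactly one solution;
    solutions over W are thus the same as germs at any of its points. *)
Definition good_nbhd W := [/\ open W,
  forall q X, W q -> sol_at q X -> exists2 Y, K W Y & germ_eq q X Y,
  forall q X Y, W q -> K W X -> K W Y -> germ_eq q X Y -> E W X Y &
  forall q q', W q -> W q' -> exists gam : R -> U,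
    [/\ cont_on I01 gam, gam 0 = q, gam 1 = q' & forall t, I01 t -> W (gam t)]].

Hypothesis good_cover : forall p, exists2 W, good_nbhd W & W p.

(** A lift of the path gam to the space of germs of solutions, with one field
    representing the germ at each parameter. *)
Definition coherent gam J Z := forall t, J t -> sol_at (gam t) (Z t) /\
  exists2 e : R, 0 < e & forall s, J s -> `|s - t| < e -> germ_eq (gam s) (Z s) (Z t).

Lemma coherent_sub gam J J' Z : J' `<=` J -> coherent gam J Z -> coherent gam J' Z.
Proof.
move=> JJ c t /JJ /c[s [e e0 H]]; split => //; exists e => // u /JJ; exact: H.
Qed.

Lemma coherent_ext gam del J Z : (forall t, J t -> gam t = del t) ->
  coherent gam J Z -> coherent del J Z.
Proof.
move=> gd c t Jt; have [s [e e0 H]] := c t Jt; split; first by rewrite -gd.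
by exists e => // u Ju ut; rewrite -gd //; exact: H.
Qed.

Lemma germ_near gam J t X Y : cont_on J gam -> J t -> germ_eq (gam t) X Y ->
  exists2 e : R, 0 < e & forall s, J s -> `|s - t| < e -> germ_eq (gam s) X Y.
Proof.
move=> c Jt [V [oV Vt EV]]; have [e e0 H] := c t V Jt oV Vt.
by exists e => // s Js st; exists V; split => //; exact: H.
Qed.

(** Near each parameter both families are given by solutions on one good
    neighbourhood, which agree everywhere on it once their germs agree at one
    point. *)
Lemma coherent_unique gam J Z Z' t0 : connected J -> cont_on J gam ->
  coherent gam J Z -> coherent gam J Z' -> J t0 -> germ_eq (gam t0) (Z t0) (Z' t0) ->
  forall t, J t -> germ_eq (gam t) (Z t) (Z' t).
Proof.
move=> cJ cg cZ cZ' Jt0 E0.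
apply: (connected_ind cJ Jt0 E0) => t Jt.
have [W gW Wt] := good_cover (gam t); have [oW ext uniq _] := gW.
have [sZ [e1 e10 H1]] := cZ t Jt.
have [sZ' [e2 e20 H2]] := cZ' t Jt.
have [Y KY EY] := ext _ _ Wt sZ.
have [Y' KY' EY'] := ext _ _ Wt sZ'.
have [e3 e30 H3] := germ_near cg Jt EY.
have [e4 e40 H4] := germ_near cg Jt EY'.
have [e5 e50 H5] := cg t W Jt oW Wt.
pose e := Num.min (Num.min e1 e2) (Num.min (Num.min e3 e4) e5).
have e0 : 0 < e by rewrite !lt_min e10 e20 e30 e40.
exists (ball t e); first by split; [exact: ball_open|exact: ballxx].
move=> y z; rewrite -ball_normE /= ![`|t - _|]distrC !lt_min.
move=> /andP[/andP[y1 y2] /andP[/andP[y3 y4] y5]] /andP[/andP[z1 z2] /andP[/andP[z3 z4] z5]].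
move=> Jy Jz Ey.
have EYY : E W Y Y'.
  apply: (uniq (gam y)) => //; first exact: H5.
  apply: germ_trans (germ_sym (H3 y Jy y3)) _.
  apply: germ_trans (germ_sym (H1 y Jy y1)) _.
  apply: germ_trans Ey _; apply: germ_trans (H2 y Jy y2) _; exact: H4.
apply: germ_trans (H1 z Jz z1) _; apply: germ_trans (H3 z Jz z3) _.
apply: (@germ_trans _ _ Y'); first by exists W; split => //; exact: H5.
by apply: germ_trans (germ_sym (H4 z Jz z4)) _; apply: germ_sym; exact: H2.
Qed.

Lemma coherent_reparam gam J J' Z (a b : R) : coherent gam J Z ->
  (forall t, J' t -> J (a * t + b)) ->
  coherent (fun t => gam (a * t + b)) J' (fun t => Z (a * t + b)).
Proof.
move=> c JJ t J't; have [s [e e0 H]] := c _ (JJ t J't); split => //.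
have a0 : 0 < `|a| + 1 by rewrite ltr_wpDl.
exists (e / (`|a| + 1)); first by rewrite divr_gt0.
move=> u J'u ut; apply: H; first exact: JJ.
have -> : a * u + b - (a * t + b) = a * (u - t) by ring.
rewrite normrM; rewrite ltr_pdivlMr // in ut; apply: le_lt_trans ut.
by rewrite mulrC ler_wpM2l // lerDl.
Qed.

Lemma coherent_const gam J W X : open W -> K W X -> (forall t, J t -> W (gam t)) ->
  coherent gam J (fun=> X).
Proof.
move=> oW KX JW t Jt; split; first by exists W; split => //; exact: JW.
by exists 1 => // s _ _; exact: germ_refl.
Qed.

Definition splice (b : R) Z Y : R -> F := fun t => if t <= b then Z t else Y.

Lemma coherent_splice gam W Z Y (b c : R) : 0 <= b ->
  cont_on [set t | 0 <= t <= c] gam -> b <= c ->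
  coherent gam [set t | 0 <= t <= b] Z -> open W -> K W Y ->
  (forall t, b <= t <= c -> W (gam t)) -> germ_eq (gam b) (Z b) Y ->
  coherent gam [set t | 0 <= t <= c] (splice b Z Y).
Proof.
move=> b0 cg bc cZ oW KY Wg EY t /= /andP[t0 tc]; rewrite /splice.
have [tb|bt|tb] := ltgtP t b.
- have [|s [e e0 H]] := cZ t; first by rewrite /= t0 (ltW tb).
  split => //; exists (Num.min e (b - t)); first by rewrite lt_min e0 subr_gt0.
  move=> u /andP[u0 uc]; rewrite lt_min => /andP[ue]; rewrite ltr_norml => /andP[_ ub].
  have ub' : u <= b by lra.
  by rewrite ub'; apply: H => //=; rewrite u0.
- split; first by exists W; split => //; apply: Wg; rewrite (ltW bt).
  exists (t - b); first by rewrite subr_gt0.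
  move=> u /andP[u0 uc]; rewrite ltr_norml => /andP[ub _].
  have ub' : b < u by lra.
  by rewrite leNgt ub' /=; exact: germ_refl.
rewrite tb; have [|s [e e0 H]] := cZ b; first by rewrite /= b0 lexx.
split => //.
have Jb : [set t | 0 <= t <= c] b by rewrite /= b0.
have [e' e'0 H'] := germ_near cg Jb (germ_sym EY).
exists (Num.min e e'); first by rewrite lt_min e0.
move=> u /andP[u0 uc]; rewrite lt_min => /andP[ue ue'].
have [ub|bu] := leP u b; first by apply: H => //=; rewrite u0.
by apply: H' => //=; rewrite u0.
Qed.

(** The parameters up to which a continuation exists form a set that is locally
    constant: in a good neighbourhood the germ reached extends at once to the rest
    of the path. *)
Lemma continuation_exists gam X : cont_on I01 gam -> sol_at (gam 0) X ->
  exists2 Z, coherent gam I01 Z & Z 0 = X.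
Proof.
move=> cg sX.
have J0 : I01 (0 : R) by rewrite /I01 /= lexx ler01.
have J1 : I01 (1 : R) by rewrite /I01 /= lexx ler01.
suff H : forall b, I01 b -> exists Z, coherent gam [set t | 0 <= t <= b] Z /\ Z 0 = X.
  by have [Z [cZ Z0]] := H 1 J1; exists Z.
apply: (connected_ind (@connected_segment R 0 1) J0).
  exists (fun=> X); split => // t /= t0.
  have -> : t = 0 by apply/eqP; rewrite eq_le andbC.
  split => //; exists 1 => // s _ _; exact: germ_refl.
move=> t Jt.
have [W gW Wt] := good_cover (gam t); have [oW ext _ _] := gW.
have [e e0 He] := cg t W Jt oW Wt.
exists (ball t e); first by split; [exact: ball_open|exact: ballxx].
move=> y z; rewrite -ball_normE /= ![`|t - _|]distrC => ye ze /andP[y0 y1] /andP[z0 z1] [Z [cZ Z0]].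
have [zy|yz] := leP z y.
  exists Z; split => //; apply: coherent_sub cZ => u /= /andP[u0 uz].
  by rewrite u0 (le_trans uz).
have sy : sol_at (gam y) (Z y) by apply: (cZ y _).1; rewrite /= y0 lexx.
have Wy : W (gam y) by apply: He => //; rewrite /I01 /= y0.
have [Y KY EY] := ext _ _ Wy sy.
exists (splice y Z Y); split; last by rewrite /splice y0.
apply: (coherent_splice y0 _ (ltW yz) cZ oW KY _ EY).
  apply: cont_on_sub cg => u /= /andP[u0 uz]; rewrite /I01 /= u0; exact: le_trans z1.
move=> u /andP[yu uz]; apply: He; first by rewrite /I01 /= (le_trans y0 yu) (le_trans uz z1).
move: ye ze; rewrite !ltr_norml => /andP[a b] /andP[c d].
by apply/andP; split; [apply: lt_le_trans a _; rewrite lerD2r|apply: le_lt_trans d; rewrite lerD2r].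
Qed.

Definition cont2 (H : R * R -> U) := forall s t V, I01 s -> I01 t -> open V -> V (H (s, t)) ->
  exists2 e : R, 0 < e & forall s' t', I01 s' -> I01 t' -> `|s' - s| < e -> `|t' - t| < e ->
    V (H (s', t')).

Lemma cont2_t H s : cont2 H -> I01 s -> cont_on I01 (fun t => H (s, t)).
Proof.
move=> cH Is t V It oV Vt; have [e e0 He] := cH s t V Is It oV Vt.
by exists e => // t' It' tt'; apply: He => //; rewrite subrr normr0.
Qed.

Lemma cont2_s H t : cont2 H -> I01 t -> cont_on I01 (fun s => H (s, t)).
Proof.
move=> cH It s V Is oV Vt; have [e e0 He] := cH s t V Is It oV Vt.
by exists e => // s' Is' ss'; apply: He => //; rewrite subrr normr0.
Qed.

(** For s near s0 the two families along H (s, .) and H (s0, .) are compared, over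
    a short interval of t, with one solution Y on a good neighbourhood; agreement
    propagates in t by uniqueness along H (s, .). *)
Lemma homotopy_locally_constant H (Zf : R -> R -> F) X p s0 : cont2 H ->
  (forall s, I01 s -> H (s, 0) = p) ->
  (forall s, I01 s -> coherent (fun t => H (s, t)) I01 (Zf s) /\ Zf s 0 = X) ->
  I01 s0 -> forall t, I01 t -> exists2 e : R, 0 < e &
    forall s, I01 s -> `|s - s0| < e -> germ_eq (H (s, t)) (Zf s t) (Zf s0 t).
Proof.
move=> cH H0 cZ Is0.
have J0 : I01 (0 : R) by rewrite /I01 /= lexx ler01.
apply: (connected_ind (@connected_segment R 0 1) J0).
  by exists 1 => // s Is _; rewrite (cZ s Is).2 (cZ s0 Is0).2; exact: germ_refl.
move=> t It.
have [W gW Wt] := good_cover (H (s0, t)); have [oW ext _ _] := gW.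
have [e e0 He] := cH s0 t W Is0 It oW Wt.
pose J := [set u : R | 0 <= u <= 1 /\ `|u - t| < e].
have cJ : connected J by exact: connected_near.
have JI : J `<=` I01 by move=> u [].
have Jt : J t by split => //; rewrite subrr normr0.
have [Y KY EY] := ext _ _ Wt ((cZ s0 Is0).1 t It).1.
have cY s : I01 s -> `|s - s0| < e -> coherent (fun t => H (s, t)) J (fun=> Y).
  by move=> Is ss; apply: (coherent_const oW KY) => u [Iu ut]; exact: He.
have along s u v : I01 s -> `|s - s0| < e -> J u -> J v ->
    germ_eq (H (s, u)) (Zf s u) Y -> germ_eq (H (s, v)) (Zf s v) Y.
  move=> Is ss Ju Jv Eu.
  apply: (@coherent_unique (fun t => H (s, t)) J (Zf s) (fun=> Y) u cJ _ _ (cY s Is ss) Ju Eu v Jv).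
    exact: cont_on_sub JI (cont2_t cH Is).
  exact: coherent_sub JI (cZ s Is).1.
have base u : J u -> germ_eq (H (s0, u)) (Zf s0 u) Y.
  by move=> Ju; apply: (along s0 t u) => //; rewrite subrr normr0.
have base_near u : J u -> exists2 d : R, 0 < d & forall s, I01 s -> `|s - s0| < d ->
    germ_eq (H (s, u)) (Zf s0 u) Y.
  by move=> Ju; exact: (germ_near (cont2_s cH (JI _ Ju)) Is0 (base u Ju)).
exists (ball t e); first by split; [exact: ball_open|exact: ballxx].
move=> y z; rewrite -ball_normE /= ![`|t - _|]distrC => ye ze Iy Iz [d d0 Hd].
have Jy : J y by []. have Jz : J z by [].
have [d1 d10 H1] := base_near y Jy.
have [d2 d20 H2] := base_near z Jz.
exists (Num.min (Num.min d e) (Num.min d1 d2)); first by rewrite !lt_min d0 e0 d10.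
move=> s Is; rewrite !lt_min => /andP[/andP[sd se] /andP[s1 s2]].
apply: germ_trans (germ_sym (H2 s Is s2)).
apply: (along s y z) => //.
by apply: germ_trans (Hd s Is sd) _; exact: H1.
Qed.

(** At t = 1 all the paths have the same end, so that the germ reached is a
    locally constant function of s. *)
Lemma homotopy_invariance H (Z Z' : R -> F) X p q : cont2 H ->
  (forall s, I01 s -> H (s, 0) = p /\ H (s, 1) = q) -> sol_at p X ->
  coherent (fun t => H (0, t)) I01 Z -> coherent (fun t => H (1, t)) I01 Z' ->
  Z 0 = X -> Z' 0 = X -> germ_eq q (Z 1) (Z' 1).
Proof.
move=> cH Hpq sX cZ cZ' Z0 Z'0.
have J0 : I01 (0 : R) by rewrite /I01 /= lexx ler01.
have J1 : I01 (1 : R) by rewrite /I01 /= lexx ler01.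
have /choice[Zf HZf] : forall s : R, exists Z, I01 s -> coherent (fun t => H (s, t)) I01 Z /\ Z 0 = X.
  move=> s; have [Is|nIs] := pselect (I01 s); last by exists (fun=> X).
  have [||Zs cZs Zs0] := @continuation_exists (fun t => H (s, t)) X.
  - exact: cont2_t.
  - by rewrite (Hpq s Is).1.
  by exists Zs.
have H0 s : I01 s -> H (s, 0) = p by move=> /Hpq[].
have H1 s : I01 s -> H (s, 1) = q by move=> /Hpq[].
have step : forall s, I01 s -> germ_eq q (Zf 0 1) (Zf s 1).
  apply: (connected_ind (@connected_segment R 0 1) J0 (germ_refl _ _)) => s Is.
  have [e e0 He] := homotopy_locally_constant cH H0 HZf Is J1.
  exists (ball s e); first by split; [exact: ball_open|exact: ballxx].
  move=> y z; rewrite -ball_normE /= ![`|s - _|]distrC => ye ze Iy Iz Ey.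
  have := He y Iy ye; have := He z Iz ze; rewrite !H1 // => Ez Ey'.
  by apply: germ_trans Ey _; apply: germ_trans Ey' (germ_sym Ez).
have same s Zs : I01 s -> coherent (fun t => H (s, t)) I01 Zs -> Zs 0 = X ->
    germ_eq q (Zs 1) (Zf s 1).
  move=> Is cZs Zs0; rewrite -(H1 s Is).
  apply: (coherent_unique (@connected_segment R 0 1) (cont2_t cH Is) cZs (HZf s Is).1 J0 _ J1).
  by rewrite Zs0 (HZf s Is).2; exact: germ_refl.
apply: germ_trans (same 0 Z J0 cZ Z0) _.
by apply: germ_trans (step 1 J1) (germ_sym (same 1 Z' J1 cZ' Z'0)).
Qed.

Section global.
Variables (Omega : set U) (X : F) (p0 : U).
Hypothesis oO : open Omega.
Hypothesis Op0 : Omega p0.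
Hypothesis cO : connected Omega.
Hypothesis cU : connected [set: U].
Hypothesis KX : K Omega X.
Hypothesis monodromy : forall gam : R -> U, cont_on I01 gam -> gam 0 = p0 -> gam 1 = p0 ->
  exists H : R * R -> U, [/\ cont2 H, forall t, I01 t -> H (0, t) = gam t,
    forall t, I01 t -> Omega (H (1, t)) & forall s, I01 s -> H (s, 0) = p0 /\ H (s, 1) = p0].

Let J0 : I01 (0 : R). Proof. by rewrite /I01 /= lexx ler01. Qed.
Let J1 : I01 (1 : R). Proof. by rewrite /I01 /= lexx ler01. Qed.

Lemma solX : sol_at p0 X. Proof. by exists Omega. Qed.

Definition reach q (Y : F) := exists gam Z, [/\ cont_on I01 gam, gam 0 = p0 /\ gam 1 = q,
  coherent gam I01 Z, Z 0 = X & Z 1 = Y].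

Lemma half2 : 2 * 2^-1 = 1 :> R. Proof. by rewrite mulfV. Qed.

Lemma path_exists q : exists gam : R -> U, [/\ cont_on I01 gam, gam 0 = p0 & gam 1 = q].
Proof.
have P0 : exists gam : R -> U, [/\ cont_on I01 gam, gam 0 = p0 & gam 1 = p0].
  by exists (fun=> p0); split => // t V _ _ Vp; exists 1.
have Ip0 : [set: U] p0 by [].
suff H : forall q, [set: U] q -> exists gam : R -> U, [/\ cont_on I01 gam, gam 0 = p0 & gam 1 = q].
  exact: H.
apply: (connected_ind cU Ip0 P0) => p _.
have [W [oW ext uniq path] Wp] := good_cover p.
exists W => // y z Wy Wz _ _ [gam [cg g0 g1]].
have [del [cd d0 d1 _]] := path y z Wy Wz.
exists (concat gam del); split; first by apply: concat_cont => //; rewrite g1 d0.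
  by rewrite /concat mulr0 invr_ge0 ler0n.
by rewrite /concat lt_geF ?invf_lt1 ?ltr1n // mulr1 [2 - 1](_ : _ = 1) // -[2]/(1 + 1) addrK.
Qed.

Lemma reach_exists q : exists Y, reach q Y.
Proof.
have [gam [cg g0 g1]] := path_exists q.
have [|Z cZ Z0] := @continuation_exists gam X cg; first by rewrite g0; exact: solX.
by exists (Z 1), gam, Z.
Qed.

(** The first path followed by the inverse of the second one is a loop, homotopic
    to a loop in Omega, along which X is its own continuation.  Continuing X
    around the first loop therefore gives X back.  At half time the continuation is
    compared with the given families, from the start and from the end of the loop. *)
Lemma reach_unique q Y Y' : reach q Y -> reach q Y' -> germ_eq q Y Y'.
Proof.
move=> [gam [Z [cg [g0 g1] cZ Z0 <-]]] [del [Z' [cd [d0 d1] cZ' Z'0 <-]]].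
pose rdel (t : R) := del (-1 * t + 1).
have crdel : cont_on I01 rdel.
  by apply: (reparam_cont cd) => t; rewrite /I01 /= => /andP[a b]; apply/andP; split; lra.
pose loop := concat gam rdel.
have cl : cont_on I01 loop.
  by apply: concat_cont => //; rewrite /rdel mulr0 add0r g1 d1.
have l0 : loop 0 = p0 by rewrite /loop /concat mulr0 invr_ge0 ler0n.
have l1 : loop 1 = p0.
  rewrite /loop /concat lt_geF ?invf_lt1 ?ltr1n // /rdel.
  by rewrite (_ : -1 * _ + 1 = 0) //; ring.
have [H [cH HA HB Hp]] := monodromy cl l0 l1.
have [|L cL L0] := @continuation_exists loop X cl; first by rewrite l0; exact: solX.
have LX : germ_eq p0 (L 1) X.
  apply: (@homotopy_invariance H L (fun=> X) X p0 p0 cH Hp solX) => //.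
    by apply: coherent_ext cL => t It; rewrite HA.
  exact: (coherent_const oO KX HB).
have E1 : germ_eq q (Z 1) (L (2^-1 * 1 + 0)).
  rewrite -g1; apply: (coherent_unique (Z' := fun t => L (2^-1 * t + 0)) (@connected_segment R 0 1) cg cZ _ J0 _ J1).
    apply: (@coherent_ext (fun t => loop (2^-1 * t + 0))).
      move=> t /andP[t0 t1]; rewrite /loop /concat addr0 ler_piMr ?invr_ge0 ?ler0n //.
      by rewrite mulrA half2 mul1r.
    by apply: (coherent_reparam cL) => t /andP[t0 t1]; rewrite /I01 /=; apply/andP; split; lra.
  by rewrite mulr0 addr0 L0 Z0; exact: germ_refl.
have E2 : germ_eq q (Z' 1) (L (- 2^-1 * 1 + 1)).
  rewrite -d1; apply: (coherent_unique (Z' := fun t => L (- 2^-1 * t + 1)) (@connected_segment R 0 1) cd cZ' _ J0 _ J1).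
    apply: (@coherent_ext (fun t => loop (- 2^-1 * t + 1))).
      move=> t /andP[t0 t1]; rewrite /loop /concat.
      have [h|h] := leP (- 2^-1 * t + 1) 2^-1.
        have -> : t = 1 by lra.
        by rewrite d1 -g1; congr gam; field.
      by rewrite /rdel; congr del; field.
    by apply: (coherent_reparam cL) => t /andP[t0 t1]; rewrite /I01 /=; apply/andP; split; lra.
  by rewrite mulr0 add0r Z'0 d0; exact: germ_sym.
apply: germ_trans E1 _.
rewrite (_ : 2^-1 * 1 + 0 = - 2^-1 * 1 + 1); first exact: germ_sym.
by field.
Qed.

Lemma reach_step W p q Y T : good_nbhd W -> W p -> W q -> reach p Y -> K W T ->
  germ_eq p Y T -> reach q T.
Proof.
move=> [oW ext uniq path] Wp Wq [gam [Z [cg [g0 g1] cZ Z0 Z1]]] KT EYT.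
have [del [cd d0 d1 Wd]] := path p q Wp Wq.
have cc : cont_on I01 (concat gam del) by apply: concat_cont => //; rewrite g1 d0.
have n12 : (1 <= 2^-1 :> R) = false by rewrite lt_geF // invf_lt1 ?ltr1n.
have h0 : 0 <= 2^-1 :> R by rewrite invr_ge0.
have h1 : 2^-1 <= 1 :> R by rewrite invf_le1 ?ler1n.
exists (concat gam del), (splice 2^-1 (fun t => Z (2 * t + 0)) T); split => //.
- by rewrite /concat mulr0 h0 n12 mulr1; split => //; rewrite (_ : 2 - 1 = 1) //; ring.
- apply: (coherent_splice h0 cc h1 _ oW KT).
  + apply: (@coherent_ext (fun t => gam (2 * t + 0))).
      by move=> t /andP[_ t1]; rewrite /concat t1 addr0.
    by apply: (coherent_reparam cZ) => t /andP[a b]; rewrite /I01 /=; apply/andP; split; lra.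
  + move=> t /andP[a b]; rewrite /concat; case: ifP => th.
      have -> : t = 2^-1 by apply/eqP; rewrite eq_le th.
      by rewrite half2 g1.
    by apply: Wd; rewrite /I01 /=; apply/andP; split; lra.
  + by rewrite /concat lexx half2 addr0 g1 Z1.
- by rewrite /splice h0 mulr0 addr0.
- by rewrite /splice n12.
Qed.

(** Zf chooses at each point a germ reached by some path.  On a good neighbourhood
    all the choices are germs of one solution, by [reach_step] and [reach_unique]. *)
Lemma global_continuation : exists Zf : U -> F,
  (forall p, exists W Y, [/\ open W, W p, K W Y & forall q, W q -> germ_eq q (Zf q) Y]) /\
  forall q, Omega q -> germ_eq q (Zf q) X.
Proof.
have /choice[Zf HZ] : forall q, exists Y, reach q Y by exact: reach_exists.
have sol_reach q : sol_at q (Zf q).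
  have [gam [Z [cg [g0 <-] cZ Z0 <-]]] := HZ q.
  exact: (cZ 1 J1).1.
have loc p W : good_nbhd W -> W p -> exists2 Y, K W Y & forall q, W q -> germ_eq q (Zf q) Y.
  move=> gW Wp; have [oW ext uniq path] := gW.
  have [Y KY EY] := ext p (Zf p) Wp (sol_reach p).
  exists Y => // q Wq; apply: reach_unique (HZ q) _.
  exact: reach_step gW Wp Wq (HZ p) KY EY.
exists Zf; split.
  move=> p; have [W gW Wp] := good_cover p; have [Y KY HY] := loc p W gW Wp.
  by exists W, Y; split => //; case: gW.
have E0 : germ_eq p0 (Zf p0) X.
  apply: reach_unique (HZ p0) _; exists (fun=> p0), (fun=> X); split => //.
    by move=> t V _ _ Vp; exists 1.
  by apply: (coherent_const oO KX).
apply: (connected_ind cO Op0 E0) => q Oq.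
have [W gW Wq] := good_cover q; have [oW ext uniq path] := gW.
have [Y KY HY] := loc q W gW Wq.
have [Y' KY' [V [oV Vq EV]]] := ext q X Wq (ex_intro _ Omega (And3 oO Oq KX)).
exists (V `&` W); first by split => //; exact: openI.
move=> y z [Vy Wy] [Vz Wz] Oy Oz Ey.
have EYY : E W Y Y'.
  apply: (uniq y) => //; apply: germ_trans (germ_sym (HY y Wy)) _.
  by apply: germ_trans Ey _; exists V.
apply: germ_trans (HY z Wz) _; apply: (@germ_trans _ _ Y'); first by exists W.
by apply: germ_sym; exists V.
Qed.

Lemma global_unique p1 (Y Y' : F) : K setT Y -> K setT Y' -> germ_eq p1 Y Y' ->
  forall q, germ_eq q Y Y'.
Proof.
move=> KY KY' E1.
have Ip1 : [set: U] p1 by [].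
suff H : forall q, [set: U] q -> germ_eq q Y Y' by move=> q; exact: H.
apply: (connected_ind cU Ip1 E1) => p _.
have [W [oW ext uniq path] Wp] := good_cover p.
exists W => // y z Wy Wz _ _ Ey; exists W; split => //.
by apply: (uniq y) => //; [exact: K_sub KY|exact: K_sub KY'].
Qed.

End global.

End continuation.

(** * Killing fields on the manifold *)

Lemma posdef_unitmx (R : realType) (n : nat) (M : 'M[R]_n) :
  (forall v : 'rV[R]_n, v != 0 -> 0 < (v *m M *m v^T) 0 0) -> M \in unitmx.
Proof.
move=> H; rewrite -row_free_unit -kermx_eq0; apply/eqP/row_matrixP => i.
rewrite row0; apply/eqP; apply: contraT => /H.
by rewrite -row_mul mulmx_ker row0 mul0mx mxE ltxx.
Qed.

Section manifold_cover.
Context {R : realType} {n : nat} {U : topologicalType}.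
Variable A : analytic_atlas R n U.
Variables (g h : atlas_index A -> U -> 'M[R]_n).
Hypothesis hg : analytic_riemannian_metric g.
Hypothesis hh : analytic_symmetric_tensor02 h.
Local Notation dom i := (chart_dom (A i)).
Local Notation map i := (chart_map (A i)).
Local Notation inv i := (chart_inv (A i)).

Lemma field_of_chart_self i Y p : dom i p ->
  @field_of_chart R n U A i Y i p = \row_k Y k (map i p).
Proof.
by move=> pi; rewrite /field_of_chart (jac_refl pi) mulmx1.
Qed.

(** The neighbourhoods are preimages of cubes given by [killing_local_extension] in
    a chart; any two points of a cube are joined by a segment. *)
Lemma killing_good_cover p : exists2 W,
  good_nbhd (R := R) (killing_field g h) (@eq_field_on R n U A) W & W p.
Proof.
have [[tg sg ag] pg] := hg; have [th sh ah] := hh.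
have [i pi] := atlas_cover A p.
set Ui := map i @` dom i.
have oUi : open Ui by exact: chart_map_open.
pose G := gcomp g i; pose H := gcomp h i.
pose Gi a b (y : 'rV[R]_n) := invmx (g i (inv i y)) a b.
have gu y : Ui y -> g i (inv i y) \in unitmx.
  by move=> /chart_invK[yi _]; apply: posdef_unitmx; exact: pg.
have HG x a b : Ui x -> cauchy_at (G a b) x by move=> Ux; apply: analytic_cauchy_at; exact: ag.
have HH x a b : Ui x -> cauchy_at (H a b) x by move=> Ux; apply: analytic_cauchy_at; exact: ah.
have sG a b : smooth_on Ui (G a b) by apply: cauchy_at_smooth => x; exact: HG.
have sH a b : smooth_on Ui (H a b) by apply: cauchy_at_smooth => x; exact: HH.
have symG a b x : Ui x -> G a b x = G b a x.
  by move=> /chart_invK[xi _]; rewrite /G /gcomp -[in LHS](sg i _ xi) mxE.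
have symH a b x : Ui x -> H a b x = H b a x.
  by move=> /chart_invK[xi _]; rewrite /H /gcomp -[in LHS](sh i _ xi) mxE.
have GGi k l x : Ui x -> \sum_b G k b x * Gi b l x = (k == l)%:R.
  by move=> Ux; have /matrixP /(_ k l) := mulmxV (gu x Ux); rewrite !mxE => <-.
have GiG k l x : Ui x -> \sum_b Gi k b x * G b l x = (k == l)%:R.
  by move=> Ux; have /matrixP /(_ k l) := mulVmx (gu x Ux); rewrite !mxE => <-.
have HGi x a b : Ui x -> cauchy_at (Gi a b) x.
  move=> Ux; have [r r0 rU] := open_cube oUi Ux.
  apply: (cauchy_at_invmx r0) => [k l|y /rU]; [exact: HG|exact: gu].
pose a0 := map i p.
have Ua : Ui a0 by exists p.
have [r [r0 rU ext uniq]] :=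
  killing_local_extension oUi sG sH symG symH GGi GiG HG HH HGi Ua.
pose W := dom i `&` map i @^-1` cube a0 r.
have oW : open W by apply: chart_preimage_open; exact: cube_open.
have Wi : W `<=` dom i by move=> q [].
have Wcube : map i @` W = cube a0 r.
  apply/seteqP; split=> [x [q [_ qr] <-] //|x xr].
  have [xi E] := chart_invK (rU x xr).
  by exists (inv i x) => //; split => //; rewrite /= E.
have Wsub (V : set U) : V `<=` W -> map i @` (dom i `&` V) `<=` cube a0 r.
  by move=> VW x [q [_ /VW Wq] <-]; rewrite -Wcube; exists q.
have solW X : killing_field g h W X -> killing_coord G H (cube a0 r) (xcomp X i).
  move=> KX; have := killing_in_chart i KX.
  by rewrite (_ : dom i `&` W = W) ?Wcube //; apply/setIidr.
exists W; last by split => //; exact: cubexx.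
split => //.
- move=> q X Wq [V [oV Vq KV]].
  have qi := Wi q Wq.
  have qr : cube a0 r (map i q) by rewrite -Wcube; exists q.
  have Vq' : (map i @` (dom i `&` V)) (map i q) by exists q.
  have [Y sY [W' [oW' W'q EY]]] := ext _ _ _ qr (chart_image_open oV) Vq' (killing_in_chart i KV).
  have KY : killing_field g h W (field_of_chart i Y).
    by apply: (killing_of_chart tg th ag oW Wi); rewrite Wcube.
  exists (field_of_chart i Y) => //.
  pose V2 := dom i `&` map i @^-1` W'.
  exists ((V `&` W) `&` V2); split.
  + apply: openI; first exact: openI.
    exact: chart_preimage_open.
  + by [].
  apply: (@eq_field_chart _ _ _ _ g h (V `&` W) _ X (field_of_chart i Y) i).
  + by apply: killing_sub KV => x [].
  + by apply: killing_sub KY => x [].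
  + by move=> x [].
  + by move=> x [[_ /Wi]].
  move=> x [[Vx Wx] [xi W'x]]; rewrite field_of_chart_self //.
  by apply/rowP => k; rewrite mxE EY // /xcomp chart_mapK.
- move=> q X Y Wq KX KY [V [oV Vq EV]].
  have qi := Wi q Wq.
  have qr : cube a0 r (map i q) by rewrite -Wcube; exists q.
  have Vq' : (map i @` (dom i `&` V)) (map i q) by exists q.
  have EXY x : (map i @` (dom i `&` V)) x -> forall k, xcomp X i k x = xcomp Y i k x.
    by move=> [z [zi Vz] <-] k; rewrite /xcomp chart_mapK // EV.
  have key := uniq _ _ _ _ qr (chart_image_open oV) Vq' (solW X KX) (solW Y KY) EXY.
  apply: (@eq_field_chart _ _ _ _ g h W _ X Y i) => // x Wx.
  have xr : cube a0 r (map i x) by rewrite -Wcube; exists x.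
  by apply/rowP => k; have := key _ xr k; rewrite /xcomp chart_mapK //; exact: Wi.
move=> q q' Wq Wq'.
have qr : cube a0 r (map i q) by rewrite -Wcube; exists q.
have q'r : cube a0 r (map i q') by rewrite -Wcube; exists q'.
pose line (t : R) := t *: (map i q' - map i q) + map i q.
have lr t : I01 t -> cube a0 r (line t) by move=> It; exact: cube_line.
exists (fun t => inv i (line t)); split.
- move=> t V It oV Vt.
  have ct : {for t, continuous (fun t => inv i (line t))}.
    apply: continuous_comp; first exact: line_continuous.
    by apply: chart_inv_cont_at; apply: rU; exact: lr.
  have nb : nbhs (inv i (line t)) V by exact: open_nbhs_nbhs.
  have [e e0 He] := (nbhs_ballP _ _).1 (ct V nb).
  exists e => // s Is st; apply: (He s).
  by rewrite -ball_normE /= distrC.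
- by rewrite /line scale0r add0r chart_mapK //; exact: Wi.
- by rewrite /line scale1r subrK chart_mapK //; exact: Wi.
move=> t It; have lt := lr t It; have [xi E] := chart_invK (rU _ lt).
by split => //; rewrite /= E.
Qed.

End manifold_cover.

Lemma I01E (R : realType) : `[0, 1]%classic = I01 :> set R.
Proof. by apply/seteqP; split=> t; rewrite /= in_itv. Qed.

Lemma within_cont2 (R : realType) (U : topologicalType) (H : R * R -> U) :
  {within `[0, 1] `*` `[0, 1], continuous H} -> cont2 H.
Proof.
move=> cH s t V Is It oV Vst.
have Jst : (`[0, 1] `*` `[0, 1])%classic (s, t) by rewrite !I01E.
have := cH (s, t) V (open_nbhs_nbhs (conj oV Vst)).
rewrite /nbhs /= -nbhs_subspace_in // => /nbhs_ballP[e e0 He].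
exists e => // s' t' Is' It' ss tt.
apply: (He (s', t')); last by rewrite !I01E.
by split; rewrite -ball_normE /= distrC.
Qed.

Theorem theorem9 (R : realType) (n : nat) (U : topologicalType)
  (hausU : hausdorff_space U) (countU : @second_countable U)
  (connU : connected [set: U])
  (A : analytic_atlas R n U)
  (g : atlas_index A -> U -> 'M[R]_n) (hg : analytic_riemannian_metric g)
  (h : atlas_index A -> U -> 'M[R]_n) (hh : analytic_symmetric_tensor02 h)
  (Omega : set U) (openO : open Omega) (connO : connected Omega)
  (pi1O : pi1_rel_trivial R Omega)
  (X : atlas_index A -> U -> 'rV[R]_n) (hX : killing_field g h Omega X) :
  exists Y : atlas_index A -> U -> 'rV[R]_n,
    [/\ killing_field g h setT Y,
        eq_field_on Omega Y X
      & forall Z : atlas_index A -> U -> 'rV[R]_n,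
          killing_field g h setT Z -> eq_field_on Omega Z X ->
          eq_field_on setT Z Y].
Proof.
have [[p0 Op0] _ pi1] := pi1O.
pose E := @eq_field_on R n U A.
pose K := killing_field g h.
have K_sub V W Y : W `<=` V -> K V Y -> K W Y by exact: killing_sub.
have E_sub V W Y Z : W `<=` V -> E V Y Z -> E W Y Z.
  by move=> WV EV i p /WV; exact: EV.
have E_refl V Y : E V Y Y by [].
have E_sym V Y Z : E V Y Z -> E V Z Y by move=> EV i p Vp pi; rewrite EV.
have E_trans V Y Z T : E V Y Z -> E V Z T -> E V Y T.
  by move=> EV EV' i p Vp pi; rewrite EV // EV'.
have cover := killing_good_cover hg hh.
have mono gam : cont_on I01 gam -> gam 0 = p0 -> gam 1 = p0 ->
    exists H : R * R -> U, [/\ cont2 H, forall t, I01 t -> H (0, t) = gam t,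
      forall t, I01 t -> Omega (H (1, t)) & forall s, I01 s -> H (s, 0) = p0 /\ H (s, 1) = p0].
  move=> cg g0 g1.
  have [|del [_ _ _ Od] [H [cH HA HB Hp]]] := pi1 p0 Op0 gam.
    by split => //; apply/within_cont_on; rewrite I01E.
  have mem t : I01 t -> t \in `[0, 1]%R by rewrite in_itv.
  exists H; split; first exact: within_cont2.
  - by move=> t /mem; exact: HA.
  - by move=> t /mem It; rewrite HB //; exact: Od.
  - by move=> s /mem; exact: Hp.
have [Zf [loc agree]] := global_continuation E_sub E_refl E_sym E_trans cover
  openO Op0 connO connU hX mono.
have germ_at p Y Z : germ_eq E p Y Z -> forall i, chart_dom (A i) p -> Y i p = Z i p.
  by move=> [V [_ Vp EV]] i; exact: EV.
pose Y i p := Zf p i p.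
have KY : K setT Y.
  apply: killing_local => p; have [W [T [oW Wp KT HT]]] := loc p.
  by exists W, T; split => // i q Wq; exact: germ_at (HT q Wq) i.
have YX : E Omega Y X by move=> i q Oq; exact: germ_at (agree q Oq) i.
exists Y; split => // Z KZ ZX i q _.
apply: germ_at.
apply: (global_unique (R := R) K_sub cover connU KZ KY).
by exists Omega; split => //; [exact: Op0|apply: E_trans ZX (E_sym _ _ _ YX)].
Qed.
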